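(* Let $f(z)=\sum_{n=1}^\infty a_n e(nz)$ be a cusp form of weight $r>0$ (with respect to a congruence group $\Gamma$ for which the cusp at $i\infty$ has width $1$). Then for any $\alpha>r/2$ the function $f_\alpha(x)=\sum_{n=1}^\infty \frac{a_n}{n^\alpha}e(nx)$ (the series being assumed absolutely convergent) satisfies $$\beta(x_0)=\beta^{*}(x_0)=\beta^{**}(x_0)=\alpha-\frac r2$$ for $x_0$ irrational. If the coefficients $a_n$ are real, then the same holds for $f_\alpha^c(x)=\sum_{n=1}^\infty \frac{a_n}{n^\alpha}\cos(2\pi nx)$ and $f_\alpha^s(x)=\sum_{n=1}^\infty \frac{a_n}{n^\alpha}\sin(2\pi nx)$.
   Context: Notation: $e(x)=e^{2\pi i x}$. Absolute convergence of the series defining $f_\alpha$ is a standing assumption, so that $f_\alpha$ is a continuous function. Modular forms: $\Gamma$ is a congruence group, i.e. $\Gamma(N)<\Gamma<\mathrm{SL}_2(\mathbb{Z})$ where $\Gamma(N)$ is the principal congruence subgroup of some level $N$. A modular form of weight $r$ (a real number $r>0$) with respect to $\Gamma$ is a function $f$, holomorphic on the upper half plane and at the cusps of $\Gamma$, with $f(\gamma z)=m_\gamma\,(j_\gamma(z))^r f(z)$ for every $\gamma\in\Gamma$, where $m_\gamma$ is a multiplier system with $|m_\gamma|=1$ and $j_\gamma(z)$ is the denominator of the linear fractional transformation corresponding to $\gamma$. It is assumed that the width of the cusp at $i\infty$ is $1$, so that the integral translations belong to $\Gamma$ and $f(z)=\sum_{n\ge0}a_n e(nz)$. A cusp form is a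 modular form vanishing at all cusps. Hölder exponents of a continuous function $g:\mathbb{R}\to\mathbb{C}$ at $x_0\in\mathbb{R}$ (in the claim, $\beta,\beta^*,\beta^{**}$ are those of the function under consideration): (1) For $s\ge 0$, $C^s(x_0)$ is the set of continuous functions $g:\mathbb{R}\to\mathbb{C}$ for which there is a polynomial $P$ of degree at most $s$ with $|g(x)-P(x-x_0)|=O(|x-x_0|^s)$ as $x\to x_0$. The pointwise Hölder exponent is $\beta(x_0)=\sup\{s\ge0: g\in C^s(x_0)\}$. (2) For $0<s\le1$, $\Lambda^s(x_0)$ is the set of continuous functions $h$ (defined near $x_0$) with $|h(x)-h(x_0)|=O(|x-x_0|^s)$ as $x\to x_0$. For an integer $k\ge0$ and $0<s\le1$, $C^{k,s}(x_0)$ is the set of continuous functions $g:\mathbb{R}\to\mathbb{C}$ such that $g^{(k)}$ is continuous in an open interval containing $x_0$ and $g^{(k)}\in\Lambda^s(x_0)$. The restricted local Hölder exponent is $\beta^*(x_0)=\sup\{k+s: g\in C^{k,s}(x_0),\ k\ge0,\ 0<s\le1\}$. (3) For an open set $\mathcal{U}\subset\mathbb{R}$, an integer $k\ge0$ and $0<s\le 1$, $C^{k,s}(\mathcal{U})$ is the set of $k$-times differentiable functions with $|g^{(k)}(x)-g^{(k)}(y)|=O(|x-y|^s)$ for all $x,y\in\mathcal{U}$; $C^{k,0}(\mathcal{U})$ is the set of functions with $k$ continuous derivatives on $\mathcal{U}$. The local Hölder exponent is $\beta^{**}(x_0)=\lim_{n\to\infty}\sup\{k+s: g\in C^{k,s}(I_n),\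 k\ge0,\ 0\le s\le1\}$, where $I_1\supset I_2\supset\cdots$ are nested open intervals with $\bigcap I_n=\{x_0\}$ (the value does not depend on the choice of the intervals).
   Formalization: The cusp form f is assumed not to be identically zero; for f = 0 the function f_α is zero and all three Hölder exponents are infinite rather than α − r/2. *)

(* Defs.v *)
From Stdlib Require Import Reals ZArith.
From Coquelicot Require Import Coquelicot.

Open Scope R_scope.

Definition Cexp (z : C) : C := (exp (Re z) * cos (Im z), exp (Re z) * sin (Im z)).

Definition e (z : C) : C := Cexp (RtoC (2 * PI) * Ci * z)%C.

(* Principal argument, with values in (-PI, PI]; meaningful for z <> 0. *)
Definition Carg (z : C) : R :=
  if Rle_dec 0 (Im z) then acos (Re z / Cmod z) else - acos (Re z / Cmod z).

Definition Clog (z : C) : C := (ln (Cmod z), Carg z).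

(* z^r for real r, principal branch; meaningful for z <> 0. *)
Definition Cpowr (z : C) (r : R) : C := Cexp (RtoC r * Clog z)%C.

Definition is_Cseries (u : nat -> C) (l : C) : Prop :=
  @is_series C_AbsRing C_NormedModule u l.

Definition CSeries (u : nat -> C) : C :=
  (Series (fun n => Re (u n)), Series (fun n => Im (u n))).

Definition irrational (x : R) : Prop :=
  ~ exists p q : Z, q <> 0%Z /\ x = IZR p / IZR q.

Record mat2 : Type := Mat2 { ma : Z; mb : Z; mc : Z; md : Z }.

Definition mdet (g : mat2) : Z := (ma g * md g - mb g * mc g)%Z.

Definition mmul (g h : mat2) : mat2 :=
  Mat2 (ma g * ma h + mb g * mc h) (ma g * mb h + mb g * md h)
       (mc g * ma h + md g * mc h) (mc g * mb h + md g * md h).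

Definition mone : mat2 := Mat2 1 0 0 1.

(* The adjugate, which is the inverse in SL_2(Z). *)
Definition minv (g : mat2) : mat2 := Mat2 (md g) (- mb g) (- mc g) (ma g).

Definition SL2Z (g : mat2) : Prop := mdet g = 1%Z.

Definition principal_congruence (N : Z) (g : mat2) : Prop :=
  SL2Z g /\ (N | ma g - 1)%Z /\ (N | mb g)%Z /\ (N | mc g)%Z /\ (N | md g - 1)%Z.

Definition SL2Z_subgroup (G : mat2 -> Prop) : Prop :=
  (forall g, G g -> SL2Z g) /\
  G mone /\
  (forall g h, G g -> G h -> G (mmul g h)) /\
  (forall g, G g -> G (minv g)).

Definition congruence_group (G : mat2 -> Prop) : Prop :=
  SL2Z_subgroup G /\
  exists N : Z, (1 <= N)%Z /\ forall g, principal_congruence N g -> G g.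

(* The translation z |-> z + 1 is induced by an element of G; a matrix and its
   opposite induce the same transformation, whence the two cases. *)
Definition cusp_infty_width_one (G : mat2 -> Prop) : Prop :=
  G (Mat2 1 1 0 1) \/ G (Mat2 (-1) (-1) 0 (-1)).

Definition upper_half_plane (z : C) : Prop := 0 < Im z.

Definition jden (g : mat2) (z : C) : C :=
  (RtoC (IZR (mc g)) * z + RtoC (IZR (md g)))%C.

Definition mobius (g : mat2) (z : C) : C :=
  ((RtoC (IZR (ma g)) * z + RtoC (IZR (mb g))) / jden g z)%C.

(* The cocycle relation says that m g * (jden g z)^r is an automorphy factor. *)
Definition multiplier_system (G : mat2 -> Prop) (r : R) (m : mat2 -> C) : Prop :=
  (forall g, G g -> Cmod (m g) = 1) /\
  (forall g h z, G g -> G h -> upper_half_plane z ->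
     (m (mmul g h) * Cpowr (jden (mmul g h) z) r =
      (m g * Cpowr (jden g (mobius h z)) r) * (m h * Cpowr (jden h z) r))%C).

Definition holomorphic_on_H (f : C -> C) : Prop :=
  forall z, upper_half_plane z -> @ex_derive C_AbsRing C_NormedModule f z.

(* The Fourier expansion of f at the cusp s(oo), s in SL_2(Z), with no negative
   exponents:
     (jden s z)^(-r) f(s z) = sum_(n >= 0) b_n e((n + kappa) z / h).
   Here h is a period of the cusp and e(kappa) is the value of the multiplier
   system on the corresponding parabolic element, so that kappa need not vanish. *)
Definition cusp_expansion (r : R) (f : C -> C) (s : mat2)
    (h : nat) (kappa : R) (b : nat -> C) : Prop :=
  (1 <= h)%nat /\ 0 <= kappa < 1 /\
  forall z, upper_half_plane z ->
    is_Cseries (fun n => (b n * e (RtoC ((INR n + kappa) / INR h) * z))%C)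
      (Cpowr (jden s z) (- r) * f (mobius s z))%C.

Definition holomorphic_at_cusps (r : R) (f : C -> C) : Prop :=
  forall s, SL2Z s -> exists h kappa b, cusp_expansion r f s h kappa b.

(* If kappa > 0 then every exponent in the expansion is positive and f vanishes
   at the cusp automatically. *)
Definition vanishes_at_cusps (r : R) (f : C -> C) : Prop :=
  forall s h kappa b, SL2Z s -> cusp_expansion r f s h kappa b ->
    kappa = 0 -> b 0%nat = RtoC 0.

Definition modular_form (G : mat2 -> Prop) (r : R) (m : mat2 -> C) (f : C -> C) : Prop :=
  multiplier_system G r m /\
  holomorphic_on_H f /\
  holomorphic_at_cusps r f /\
  (forall g z, G g -> upper_half_plane z ->
     (f (mobius g z) = m g * Cpowr (jden g z) r * f z)%C).

Definition cusp_form (G : mat2 -> Prop) (r : R) (m : mat2 -> C) (f : C -> C) : Prop :=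
  modular_form G r m f /\ vanishes_at_cusps r f.

(* The sums start at n = 1; a 0 is never used. *)

Definition coef (a : nat -> C) (alpha : R) (n : nat) : C :=
  (a n / RtoC (Rpower (INR n) alpha))%C.

Definition f_exp (a : nat -> C) (alpha : R) (x : R) : C :=
  CSeries (fun n => (coef a alpha (S n) * e (RtoC (INR (S n) * x)))%C).

Definition f_cos (a : nat -> C) (alpha : R) (x : R) : C :=
  CSeries (fun n => (coef a alpha (S n) * RtoC (cos (2 * PI * INR (S n) * x)))%C).

Definition f_sin (a : nat -> C) (alpha : R) (x : R) : C :=
  CSeries (fun n => (coef a alpha (S n) * RtoC (sin (2 * PI * INR (S n) * x)))%C).

Definition Ccontinuous (g : R -> C) : Prop := forall x : R, continuous g x.

(* O-conditions exclude coinciding points, since Rpower 0 s = 1. *)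

Definition pointwise_C (s : R) (x0 : R) (g : R -> C) : Prop :=
  Ccontinuous g /\
  exists (d : nat) (p : nat -> C), INR d <= s /\
  exists K delta : R, 0 < delta /\
    forall x, x <> x0 -> Rabs (x - x0) < delta ->
      Cmod (g x - sum_n (fun i => (p i * RtoC ((x - x0) ^ i))%C) d)%C
        <= K * Rpower (Rabs (x - x0)) s.

Definition beta (g : R -> C) (x0 : R) : Rbar :=
  Lub_Rbar (fun s => 0 <= s /\ pointwise_C s x0 g).

Definition CDerive_n (g : R -> C) (k : nat) (x : R) : C :=
  (Derive_n (fun t => Re (g t)) k x, Derive_n (fun t => Im (g t)) k x).

(* Meaningful for U open, since ex_derive_n at x looks at a neighbourhood of x. *)
Definition k_differentiable_on (U : R -> Prop) (k : nat) (g : R -> C) : Prop :=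
  forall (j : nat) (x : R), (j <= k)%nat -> U x ->
    ex_derive_n (fun t => Re (g t)) j x /\ ex_derive_n (fun t => Im (g t)) j x.

Definition Lambda_C (s : R) (x0 : R) (h : R -> C) : Prop :=
  exists K delta : R, 0 < delta /\
    forall x, x <> x0 -> Rabs (x - x0) < delta ->
      Cmod (h x - h x0)%C <= K * Rpower (Rabs (x - x0)) s.

Definition open_interval (lo hi : R) (x : R) : Prop := lo < x < hi.

Definition restricted_C (k : nat) (s : R) (x0 : R) (g : R -> C) : Prop :=
  Ccontinuous g /\
  (exists lo hi : R, open_interval lo hi x0 /\
     k_differentiable_on (open_interval lo hi) k g /\
     forall x, open_interval lo hi x -> continuous (CDerive_n g k) x) /\
  Lambda_C s x0 (CDerive_n g k).

Definition beta_star (g : R -> C) (x0 : R) : Rbar :=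
  Lub_Rbar (fun t => exists (k : nat) (s : R),
    0 < s <= 1 /\ t = INR k + s /\ restricted_C k s x0 g).

Definition uniform_C (k : nat) (s : R) (U : R -> Prop) (g : R -> C) : Prop :=
  k_differentiable_on U k g /\
  ((0 < s /\ exists K : R, forall x y, U x -> U y -> x <> y ->
      Cmod (CDerive_n g k x - CDerive_n g k y)%C <= K * Rpower (Rabs (x - y)) s)
   \/
   (s = 0 /\ forall (j : nat) (x : R), (j <= k)%nat -> U x ->
      continuous (CDerive_n g j) x)).

Definition local_sup (g : R -> C) (U : R -> Prop) : Rbar :=
  Lub_Rbar (fun t => exists (k : nat) (s : R),
    0 <= s <= 1 /\ t = INR k + s /\ uniform_C k s U g).

(* Convergence in the extended reals (order topology). *)
Definition is_Rbar_lim_seq (u : nat -> Rbar) (l : Rbar) : Prop :=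
  (forall y : R, Rbar_lt y l -> eventually (fun n => Rbar_lt y (u n))) /\
  (forall y : R, Rbar_lt l y -> eventually (fun n => Rbar_lt (u n) y)).

Definition nested_intervals (x0 : R) (lo hi : nat -> R) : Prop :=
  (forall n x, open_interval (lo (S n)) (hi (S n)) x -> open_interval (lo n) (hi n) x) /\
  (forall x, (forall n, open_interval (lo n) (hi n) x) <-> x = x0).

(* beta**(x0) = l, for every admissible choice of the intervals. *)
Definition is_beta_star_star (g : R -> C) (x0 : R) (l : Rbar) : Prop :=
  forall lo hi : nat -> R, nested_intervals x0 lo hi ->
    is_Rbar_lim_seq (fun n => local_sup g (open_interval (lo n) (hi n))) l.

Definition all_holder_exponents_eq (g : R -> C) (x0 : R) (v : R) : Prop :=
  beta g x0 = Finite v /\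
  beta_star g x0 = Finite v /\
  is_beta_star_star g x0 (Finite v).

(* Main.v *)
Require Import Defs.
From Stdlib Require Import Reals ZArith Lra Lia Classical Ranalysis5.
From Coquelicot Require Import Coquelicot.
Open Scope R_scope.

(** Write s = alpha - r/2 and let E_g(x + iy) be the series of the numbers
    a_n n^(g - alpha) e(n(x + iy)), so that E_alpha = f and E_0 has the boundary values
    f_alpha.  Everything rests on two facts about f.

    First, |f(x + iy)| = O(y^(-r/2)) on the whole half plane [cusp_form_upper_bound]: the
    function |f| y^(r/2) is invariant under the group, it is bounded above height 1/2 by the
    Fourier expansions at the cusps, and Dirichlet's approximation theorem moves every point
    there by a matrix of SL_2(Z); residues modulo the level leave finitely many cases.
    Secondly, near an irrational x0 this is sharp inside a cone with vertex x0
    [cusp_form_lower_bound]: the matrices built from good approximations of x0 send a fixed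
    point, at which f does not vanish, into such a cone and arbitrarily near x0.

    Two transfers connect the size of f to the regularity of f_alpha.  Euler's integral
    n^(-d) = const * int v^(d-1) e^(-2 pi n v) dv shows that a bound v^(-rho) for E_g on
    a vertical half-line becomes y^(d-rho) for E_(g-d), 0 < d < rho
    [Lap_fractional_integral].  The kernels sum_n n^k q^n e(nu), which contain positive
    frequencies only, turn bounds on a horizontal line into bounds for derivatives above it
    [analytic_kernel_bound].

    Regularity from below: the kernel with k = 1 bounds E_(alpha+1) by y^(-r/2-1), and
    fractional integration gives E_(j+1) = O(y^(sigma-1)) for all j <= k whenever
    k + sigma < s and 0 < sigma < 1.  Hence E_0, ..., E_k converge uniformly at the boundary,
    and the k-th derivative of f_alpha is sigma-Hoelder on the line
    [trig_series_regularity].  This bounds all three exponents from below by s.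

    Regularity from above: if f_alpha is of class C^t at x0 with t > s, the Taylor polynomial
    is replaced by a trigonometric polynomial without positive frequencies, which the kernels
    annihilate; so E_k(x + iy) = O(y^(t-k)) in each cone at x0 for k large, and fractional
    integration of order k - alpha yields f = O(y^(t-alpha)) there [cone_bound].  As
    t - alpha > -r/2, this contradicts the lower bound.  The restricted and the local exponents
    are at most the pointwise one by Taylor's formula.

    The cosine and sine series are combinations la F(x) + mu F(-x) of F = f_alpha with
    la <> 0; kernels with positive frequencies see the part la F only, so the three cases are
    treated together. *)

(** * Real powers, series and complex-valued series *)

Lemma Rpower_gt0 x y : 0 < Rpower x y.
Proof. apply exp_pos. Qed.

(** An exponential beats every real power on [1, +oo); the constant comes from
    the tangent line of the logarithm. *)
Lemma Rpower_exp_bounded g c : 0 < c ->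
  exists B, 0 < B /\ forall x, 1 <= x -> Rpower x g * exp (- (c * x)) <= B.
Proof.
intros Hc.
destruct (Rle_dec g 0) as [Hg|Hg].
- exists 1; split; [lra|]. intros x Hx.
  assert (H1 : Rpower x g <= 1).
  { rewrite <- exp_0. unfold Rpower.
    assert (0 <= ln x) by (rewrite <- ln_1; apply ln_le; lra).
    destruct (Req_dec (g * ln x) 0) as [->|]; [lra|].
    left; apply exp_increasing. nra. }
  assert (H2 : exp (- (c * x)) <= 1).
  { rewrite <- exp_0. left; apply exp_increasing. nra. }
  pose proof (Rpower_gt0 x g). pose proof (exp_pos (- (c * x))). nra.
- exists (exp (g * (ln (g / c) - 1))); split; [apply exp_pos|].
  intros x Hx. unfold Rpower. rewrite <- exp_plus.
  assert (Ht : 0 < c / g * x) by (apply Rmult_lt_0_compat; [apply Rdiv_lt_0_compat|]; lra).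
  assert (Hgc : 0 < g / c) by (apply Rdiv_lt_0_compat; lra).
  assert (Hl : ln x = ln (c / g * x) + ln (g / c)).
  { rewrite <- ln_mult by assumption. f_equal. field. lra. }
  assert (Hln : ln (c / g * x) <= c / g * x - 1).
  { pose proof (exp_ineq1_le (ln (c / g * x))) as H. rewrite exp_ln in H by assumption. lra. }
  assert (Hm : g * (c / g * x) = c * x) by (field; lra).
  destruct (Req_dec (g * ln x + - (c * x)) (g * (ln (g / c) - 1))) as [->|]; [lra|].
  left; apply exp_increasing. rewrite Hl in *. nra.
Qed.

Lemma is_lim_seq_le_lim (u e : nat -> R) (l B : R) :
  is_lim_seq u l -> is_lim_seq e 0 -> (forall n, u n <= B + e n) -> l <= B.
Proof.
intros Hu He H.
assert (Hc : is_lim_seq (fun n => B + e n) B).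
{ replace (Finite B) with (Rbar_plus B 0) by (simpl; f_equal; lra).
  apply is_lim_seq_plus'; [apply is_lim_seq_const|exact He]. }
exact (is_lim_seq_le _ _ _ _ H Hu Hc).
Qed.

Definition tail (M : nat -> R) (N : nat) : R := Series M - sum_n M N.

Lemma is_lim_seq_tail M : ex_series M -> is_lim_seq (tail M) 0.
Proof.
intros H. unfold tail.
replace (Finite 0) with (Finite (Series M - Series M)) by (f_equal; lra).
apply is_lim_seq_minus'; [apply is_lim_seq_const|].
exact (Series_correct _ H).
Qed.

Lemma ex_series_dom (a b : nat -> R) :
  (forall n, Rabs (a n) <= b n) -> ex_series b -> ex_series a.
Proof. exact (@ex_series_le R_AbsRing R_CompleteNormedModule a b). Qed.

Lemma sum_n_le_Series M N : (forall n, 0 <= M n) -> ex_series M -> sum_n M N <= Series M.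
Proof.
intros H0 H.
apply (is_lim_seq_incr_compare (sum_n M)); [exact (Series_correct _ H)|].
intros n. rewrite sum_Sn. unfold plus; simpl. specialize (H0 (S n)). lra.
Qed.

Lemma Series_tail_bound (a M : nat -> R) N :
  (forall n, Rabs (a n) <= M n) -> ex_series M ->
  Rabs (Series a - sum_n a N) <= tail M N.
Proof.
intros H HM.
assert (Ha : ex_series a) by exact (ex_series_dom a M H HM).
assert (Hs : forall b : nat -> R, ex_series b ->
  Series b - sum_n b N = Series (fun k => b (S N + k)%nat)).
{ intros b Hb. rewrite (Series_incr_n b (S N)); [|lia|exact Hb].
  simpl pred. rewrite <- sum_n_Reals. ring. }
unfold tail. rewrite !Hs by assumption.
assert (HM' : ex_series (fun k => M (S N + k)%nat)) by exact (proj1 (ex_series_incr_n M (S N)) HM).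
eapply Rle_trans; [apply Series_Rabs|].
- apply ex_series_dom with (2 := HM'). intros n. rewrite Rabs_Rabsolu. apply H.
- apply Series_le; [|exact HM']. intros n; split; [apply Rabs_pos|apply H].
Qed.

Lemma Series_abs_le (a M : nat -> R) :
  (forall n, Rabs (a n) <= M n) -> ex_series M -> Rabs (Series a) <= Series M.
Proof.
intros H HM. eapply Rle_trans; [apply Series_Rabs|].
- apply ex_series_dom with (2 := HM). intros n. rewrite Rabs_Rabsolu. apply H.
- apply Series_le; [|exact HM]. intros n; split; [apply Rabs_pos|apply H].
Qed.

(** Tannery's theorem: the remainders are uniformly small, so finitely many terms decide. *)
Lemma Series_dominated (u : nat -> nat -> R) (l M : nat -> R) :
  (forall p n, Rabs (u p n) <= M n) -> ex_series M ->
  (forall n, is_lim_seq (fun p => u p n) (l n)) ->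
  is_lim_seq (fun p => Series (u p)) (Series l).
Proof.
intros Hb HM Hl.
assert (Hlb : forall n, Rabs (l n) <= M n).
{ intros n. pose proof (is_lim_seq_abs _ _ (Hl n)) as Ha. simpl in Ha.
  exact (is_lim_seq_le _ _ (Finite (Rabs (l n))) (Finite (M n)) (fun p => Hb p n) Ha
           (is_lim_seq_const (M n))). }
assert (Hs : forall N, is_lim_seq (fun p => sum_n (u p) N) (sum_n l N)).
{ induction N as [|N IH].
  - eapply is_lim_seq_ext; [|rewrite sum_O; apply (Hl 0%nat)]. intros p. now rewrite sum_O.
  - rewrite sum_Sn. eapply is_lim_seq_ext; [|apply is_lim_seq_plus'; [exact IH|apply (Hl (S N))]].
    intros p. now rewrite sum_Sn. }
apply is_lim_seq_spec. intros eps.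
pose proof (is_lim_seq_tail M HM) as Ht. apply is_lim_seq_spec in Ht.
destruct (Ht (mkposreal (eps / 3) ltac:(destruct eps; simpl; lra))) as [N HN].
specialize (HN N (le_n N)). simpl in HN.
specialize (Hs N). apply is_lim_seq_spec in Hs.
destruct (Hs (mkposreal (eps / 3) ltac:(destruct eps; simpl; lra))) as [P HP].
exists P. intros p Hp. specialize (HP p Hp). simpl in HP.
pose proof (Series_tail_bound (u p) M N (Hb p) HM) as H1.
pose proof (Series_tail_bound l M N Hlb HM) as H2.
apply Rabs_def2 in HP. apply Rabs_def2 in HN.
apply Rabs_le_between in H1. apply Rabs_le_between in H2.
apply Rabs_def1; lra.
Qed.

(** ** Complex numbers *)

Lemma Re_plus z w : Re (z + w)%C = Re z + Re w. Proof. reflexivity. Qed.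
Lemma Im_plus z w : Im (z + w)%C = Im z + Im w. Proof. reflexivity. Qed.
Lemma Re_mult z w : Re (z * w)%C = Re z * Re w - Im z * Im w. Proof. reflexivity. Qed.
Lemma Im_mult z w : Im (z * w)%C = Re z * Im w + Im z * Re w. Proof. reflexivity. Qed.
Lemma Re_minus z w : Re (z - w)%C = Re z - Re w. Proof. reflexivity. Qed.
Lemma Im_minus z w : Im (z - w)%C = Im z - Im w. Proof. reflexivity. Qed.

Lemma C_ext (z w : C) : Re z = Re w -> Im z = Im w -> z = w.
Proof. destruct z, w; simpl; intros; subst; reflexivity. Qed.

Lemma Rabs_Re_le z : Rabs (Re z) <= Cmod z.
Proof. apply re_le_Cmod. Qed.

Lemma Rabs_Im_le z : Rabs (Im z) <= Cmod z.
Proof. eapply Rle_trans; [|apply (Rmax_Cmod z)]. apply Rmax_r. Qed.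

Lemma Cmod_le_Re_Im z : Cmod z <= Rabs (Re z) + Rabs (Im z).
Proof.
assert (E : z = (RtoC (Re z) + RtoC (Im z) * Ci)%C) by (apply C_ext; simpl; ring).
rewrite E at 1. eapply Rle_trans; [apply Cmod_triangle|].
rewrite Cmod_mult, Cmod_Ci, !Cmod_R. lra.
Qed.

(** The modulus is the largest real part among the rotations; this reduces norm
    bounds for sums and integrals to the real case. *)
Lemma Cmod_le_rotations (w : C) B :
  (forall th, Cmod th = 1 -> Re (th * w)%C <= B) -> Cmod w <= B.
Proof.
intros H. destruct (Req_dec (Cmod w) 0) as [H0|H0].
- specialize (H 1%C Cmod_1). rewrite (Cmod_eq_0 _ H0) in *. rewrite Cmod_0.
  rewrite Cmult_0_r in H. exact H.
- assert (Hp : 0 < Cmod w) by (pose proof (Cmod_ge_0 w); lra).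
  specialize (H (Cconj w * RtoC (/ Cmod w))%C).
  rewrite Cmod_mult, Cmod_conj, Cmod_R, Rabs_pos_eq in H
    by (left; apply Rinv_0_lt_compat; lra).
  rewrite Rinv_r in H by lra. specialize (H eq_refl).
  replace (Re _) with (Cmod w) in H; [exact H|].
  pose proof (Cmod2_alt w) as E.
  rewrite !Re_mult, Im_mult. simpl.
  replace (snd w) with (Im w) by reflexivity. replace (fst w) with (Re w) by reflexivity.
  apply (Rmult_eq_reg_r (Cmod w)); [|exact H0]. field_simplify; [|exact H0]. nra.
Qed.

Definition Csummable (u : nat -> C) : Prop := ex_series (fun n => Cmod (u n)).

Lemma Csummable_Re u : Csummable u -> ex_series (fun n => Re (u n)).
Proof. intros H. apply ex_series_dom with (2 := H). intros n. apply Rabs_Re_le. Qed.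
Lemma Csummable_Im u : Csummable u -> ex_series (fun n => Im (u n)).
Proof. intros H. apply ex_series_dom with (2 := H). intros n. apply Rabs_Im_le. Qed.

Lemma Csummable_dom u (M : nat -> R) :
  (forall n, Cmod (u n) <= M n) -> ex_series M -> Csummable u.
Proof.
intros H HM. apply ex_series_dom with (2 := HM). intros n.
rewrite Rabs_pos_eq; [apply H|apply Cmod_ge_0].
Qed.

Lemma Re_CSeries u : Re (CSeries u) = Series (fun n => Re (u n)). Proof. reflexivity. Qed.
Lemma CSeries_scal (t : C) u : Csummable u -> CSeries (fun n => t * u n)%C = (t * CSeries u)%C.
Proof.
intros H. pose proof (Csummable_Re u H). pose proof (Csummable_Im u H).
unfold CSeries. apply C_ext; simpl.
- rewrite Series_minus.
  + now rewrite !Series_scal_l.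
  + now apply (ex_series_scal (fst t) (fun n => Re (u n))).
  + now apply (ex_series_scal (snd t) (fun n => Im (u n))).
- rewrite Series_plus.
  + now rewrite !Series_scal_l.
  + now apply (ex_series_scal (fst t) (fun n => Im (u n))).
  + now apply (ex_series_scal (snd t) (fun n => Re (u n))).
Qed.

Lemma CSeries_plus u v : Csummable u -> Csummable v ->
  CSeries (fun n => u n + v n)%C = (CSeries u + CSeries v)%C.
Proof.
intros Hu Hv. unfold CSeries. apply C_ext; simpl; apply Series_plus;
  try apply Csummable_Re; try apply Csummable_Im; assumption.
Qed.

Lemma CSeries_ext u v : (forall n, u n = v n) -> CSeries u = CSeries v.
Proof. intros H. unfold CSeries. f_equal; apply Series_ext; intros n; now rewrite H. Qed.

Lemma Re_sum_n (u : nat -> C) N : Re (sum_n u N) = sum_n (fun n => Re (u n)) N.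
Proof. induction N; [now rewrite !sum_O|]. rewrite !sum_Sn. now rewrite <- IHN. Qed.
Lemma Im_sum_n (u : nat -> C) N : Im (sum_n u N) = sum_n (fun n => Im (u n)) N.
Proof. induction N; [now rewrite !sum_O|]. rewrite !sum_Sn. now rewrite <- IHN. Qed.

Lemma Csum_n_ext (a b : nat -> C) N : (forall n, a n = b n) -> sum_n a N = sum_n b N.
Proof. exact (sum_n_ext (G := C_AbelianMonoid) a b N). Qed.

Lemma Csum_n_scal (t : C) (u : nat -> C) N :
  sum_n (fun n => t * u n)%C N = (t * sum_n u N)%C.
Proof.
induction N; [now rewrite !sum_O|]. rewrite !sum_Sn, IHN.
unfold plus; simpl. ring.
Qed.

Lemma CSeries_tail_bound u M N :
  (forall n, Cmod (u n) <= M n) -> ex_series M ->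
  Cmod (CSeries u - sum_n u N)%C <= tail M N.
Proof.
intros H HM. apply Cmod_le_rotations. intros th Hth.
assert (Hu : Csummable u) by (eapply Csummable_dom; eauto).
replace (th * (CSeries u - sum_n u N))%C
  with (CSeries (fun n => th * u n) - sum_n (fun n => th * u n) N)%C
  by (rewrite CSeries_scal by exact Hu; rewrite Csum_n_scal; ring).
rewrite Re_minus. rewrite Re_sum_n. rewrite Re_CSeries.
eapply Rle_trans; [apply Rle_abs|]. apply Series_tail_bound; [|exact HM].
intros n. eapply Rle_trans; [apply (Rabs_Re_le (th * u n)%C)|]. rewrite Cmod_mult, Hth. now rewrite Rmult_1_l.
Qed.

Lemma Cmod_CSeries_le u M :
  (forall n, Cmod (u n) <= M n) -> ex_series M -> Cmod (CSeries u) <= Series M.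
Proof.
intros H HM. apply Cmod_le_rotations. intros th Hth.
assert (Hu : Csummable u) by (eapply Csummable_dom; eauto).
rewrite <- CSeries_scal by exact Hu. unfold CSeries. simpl Re at 1.
eapply Rle_trans; [apply Rle_abs|]. apply Series_abs_le; [|exact HM].
intros n. eapply Rle_trans; [apply (Rabs_Re_le (th * u n)%C)|]. rewrite Cmod_mult, Hth. now rewrite Rmult_1_l.
Qed.

(** Used in place of exchanging a series with an integral: only finite sums are integrated,
    and the error is the remainder of a convergent series. *)
Lemma Cmod_CSeries_le_partial u (e : nat -> R) B :
  Csummable u -> is_lim_seq e 0 ->
  (forall N, Cmod (sum_n u N) <= B + e N) -> Cmod (CSeries u) <= B.
Proof.
intros Hu He H.
apply (is_lim_seq_le_lim (fun _ => Cmod (CSeries u))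
         (fun N => e N + tail (fun n => Cmod (u n)) N)).
- apply is_lim_seq_const.
- replace (Finite 0) with (Finite (0 + 0)) by (f_equal; lra).
  apply is_lim_seq_plus'; [exact He|apply is_lim_seq_tail, Hu].
- intros N. pose proof (CSeries_tail_bound u _ N (fun n => Rle_refl _) Hu) as H1.
  replace (CSeries u) with ((CSeries u - sum_n u N) + sum_n u N)%C by ring.
  eapply Rle_trans; [apply Cmod_triangle|]. specialize (H N). lra.
Qed.

Lemma is_Cseries_Re_Im u l : is_Cseries u l ->
  is_series (fun n => Re (u n)) (Re l) /\ is_series (fun n => Im (u n)) (Im l).
Proof.
intros H. unfold is_Cseries, is_series in *.
assert (Hc : forall eps : posreal, eventually (fun N => Cmod (sum_n u N - l)%C < eps)).
{ intros eps. apply (H (fun z => Cmod (z - l)%C < eps)).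
  apply (locally_le_locally_norm (V := C_NormedModule) l). exists eps. intros z Hz. exact Hz. }
split; [change (is_lim_seq (sum_n (fun n => Re (u n))) (Re l))
  |change (is_lim_seq (sum_n (fun n => Im (u n))) (Im l))];
  apply is_lim_seq_spec; intros eps; destruct (Hc eps) as [N HN]; exists N;
  intros n Hn; specialize (HN n Hn).
- rewrite <- Re_sum_n, <- Re_minus. eapply Rle_lt_trans; [apply Rabs_Re_le|exact HN].
- rewrite <- Im_sum_n, <- Im_minus. eapply Rle_lt_trans; [apply Rabs_Im_le|exact HN].
Qed.

Lemma is_Cseries_unique u l : is_Cseries u l -> CSeries u = l.
Proof.
intros H. destruct (is_Cseries_Re_Im u l H) as [H1 H2].
unfold CSeries. rewrite (is_series_unique _ _ H1), (is_series_unique _ _ H2).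
now destruct l.
Qed.

(** ** The character [e] *)

Definition cis (u : R) : C := (cos (2 * PI * u), sin (2 * PI * u)).

Lemma e_eq x y : e (x, y) = (RtoC (exp (- (2 * PI * y))) * cis x)%C.
Proof.
unfold e, Cexp, cis.
apply C_ext; rewrite ?Re_mult, ?Im_mult; simpl;
replace ((2 * PI * 0 - 0 * 1) * x - (2 * PI * 1 + 0 * 0) * y) with (- (2 * PI * y)) by ring;
replace ((2 * PI * 0 - 0 * 1) * y + (2 * PI * 1 + 0 * 0) * x) with (2 * PI * x) by ring; ring.
Qed.

Lemma e_RtoC x : e (RtoC x) = cis x.
Proof.
unfold RtoC. rewrite e_eq. replace (- (2 * PI * 0)) with 0 by ring.
rewrite exp_0. ring.
Qed.

Lemma cis_plus u v : cis (u + v) = (cis u * cis v)%C.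
Proof.
unfold cis. apply C_ext; simpl; rewrite Rmult_plus_distr_l.
- apply cos_plus.
- rewrite sin_plus. ring.
Qed.

Lemma cis_0 : cis 0 = 1%C.
Proof. unfold cis. rewrite Rmult_0_r, cos_0, sin_0. reflexivity. Qed.

Lemma Cmod_cis u : Cmod (cis u) = 1.
Proof.
unfold Cmod, cis; simpl fst; simpl snd. rewrite <- sqrt_1. f_equal.
pose proof (sin2_cos2 (2 * PI * u)) as H. unfold Rsqr in H. simpl. lra.
Qed.

Lemma cis_pow u n : (cis u ^ n)%C = cis (INR n * u).
Proof.
induction n; [simpl; now rewrite Rmult_0_l, cis_0|].
rewrite S_INR, Rmult_plus_distr_r, Rmult_1_l, Rplus_comm, cis_plus, <- IHn.
reflexivity.
Qed.

(** * Fractional integration in the vertical direction *)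

Lemma is_derive_Rpower s x : 0 < x ->
  is_derive (fun t => Rpower t s) x (s * Rpower x (s - 1)).
Proof.
intros Hx. unfold Rpower at 1. auto_derive; [exact Hx|].
replace (Rpower x (s - 1)) with (Rpower x s * / x).
- unfold Rpower. field. lra.
- unfold Rminus. rewrite Rpower_plus, Rpower_Ropp, Rpower_1 by exact Hx. reflexivity.
Qed.

Lemma continuous_Rpower s x : 0 < x -> continuous (fun t => Rpower t s) x.
Proof. intros Hx. apply (ex_derive_continuous (V := R_NormedModule)). eexists. now apply is_derive_Rpower. Qed.

Lemma RInt_Rpower s a b : s <> 0 -> 0 < a <= b ->
  RInt (fun u => Rpower u (s - 1)) a b = (Rpower b s - Rpower a s) / s.
Proof.
intros Hs Hab. apply is_RInt_unique.
replace ((Rpower b s - Rpower a s) / s) with (minus (Rpower b s / s) (Rpower a s / s))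
  by (unfold minus, plus, opp; simpl; field; exact Hs).
apply (is_RInt_derive (fun u => Rpower u s / s)).
- intros x Hx. rewrite Rmin_left, Rmax_right in Hx by lra.
  replace (Rpower x (s - 1)) with (/ s * (s * Rpower x (s - 1))) by (field; exact Hs).
  eapply is_derive_ext; [|apply is_derive_scal, is_derive_Rpower; lra].
  intros t. simpl. unfold Rdiv; ring.
- intros x Hx. rewrite Rmin_left, Rmax_right in Hx by lra. apply continuous_Rpower. lra.
Qed.

Lemma ex_RInt_cont (f : R -> R) a b : a <= b ->
  (forall x, a <= x <= b -> continuous f x) -> ex_RInt f a b.
Proof.
intros Hab H. apply (ex_RInt_continuous (V := R_CompleteNormedModule)).
intros z Hz. rewrite Rmin_left, Rmax_right in Hz by lra. now apply H.
Qed.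

Lemma Rabs_RInt_le (f g : R -> R) a b : a <= b ->
  (forall x, a <= x <= b -> continuous f x) -> (forall x, a <= x <= b -> continuous g x) ->
  (forall x, a <= x <= b -> Rabs (f x) <= g x) -> Rabs (RInt f a b) <= RInt g a b.
Proof.
intros Hab Hf Hg H.
apply (norm_RInt_le (V := R_NormedModule) f g a b); [exact Hab|exact H| |];
  apply (RInt_correct (V := R_CompleteNormedModule)), ex_RInt_cont; assumption.
Qed.

(** The n-th frequency is n + 1: sequences start at 0, Fourier series at 1. *)
Definition freq (n : nat) : R := INR (S n).
Definition wgt (g y : R) (n : nat) : R := Rpower (freq n) g * exp (- (2 * PI * freq n * y)).
(** The Laplace form, at height y, of a Fourier series on one vertical line; g is the order of
    differentiation, up to powers of 2 PI i. *)
Definition Lap (b : nat -> R) (g y : R) : R := Series (fun n => b n * wgt g y n).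

Lemma freq_ge1 n : 1 <= freq n.
Proof. unfold freq. rewrite S_INR. pose proof (pos_INR n). lra. Qed.

Lemma PI_ge_1 : 1 <= PI.
Proof. pose proof PI2_1. lra. Qed.

Lemma wgt_gt0 g y n : 0 < wgt g y n.
Proof. apply Rmult_lt_0_compat; apply exp_pos. Qed.

Lemma wgt_decr g y y' n : y <= y' -> wgt g y' n <= wgt g y n.
Proof.
intros H. apply Rmult_le_compat_l; [left; apply exp_pos|].
destruct (Req_dec y y') as [->|]; [lra|]. left; apply exp_increasing.
pose proof (freq_ge1 n). pose proof PI_ge_1.
assert (0 < 2 * PI * freq n) by nra. nra.
Qed.

Lemma wgt_bounded g y : 0 < y -> exists B, 0 < B /\ forall n, wgt g y n <= B.
Proof.
intros Hy. destruct (Rpower_exp_bounded g (2 * PI * y)) as [B [HB H]].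
{ pose proof PI_ge_1. nra. }
exists B; split; [exact HB|]. intros n. unfold wgt.
replace (2 * PI * freq n * y) with (2 * PI * y * freq n) by ring. apply H, freq_ge1.
Qed.

Lemma ex_series_wgt (b : nat -> R) g y : ex_series (fun n => Rabs (b n)) -> 0 < y ->
  ex_series (fun n => Rabs (b n) * wgt g y n).
Proof.
intros Hb Hy. destruct (wgt_bounded g y Hy) as [B [HB H]].
apply ex_series_dom with (b := fun n => Rabs (b n) * B).
- intros n. rewrite Rabs_mult, Rabs_Rabsolu. apply Rmult_le_compat_l; [apply Rabs_pos|].
  rewrite Rabs_pos_eq; [apply H|left; apply wgt_gt0].
- now apply ex_series_scal_r.
Qed.

Lemma Rabs_wgt_mult b g y n : Rabs (b * wgt g y n) = Rabs b * wgt g y n.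
Proof. rewrite Rabs_mult. f_equal. apply Rabs_pos_eq. left; apply wgt_gt0. Qed.

Lemma is_RInt_sum_n (F : nat -> R -> R) (I : nat -> R) a b N :
  (forall n, is_RInt (F n) a b (I n)) ->
  is_RInt (fun v => sum_n (fun n => F n v) N) a b (sum_n I N).
Proof.
intros H. induction N as [|N IH].
- rewrite sum_O. eapply is_RInt_ext; [|apply (H 0%nat)]. intros x _. now rewrite sum_O.
- rewrite sum_Sn. eapply is_RInt_ext; [|apply (is_RInt_plus (V := R_NormedModule)); [exact IH|apply (H (S N))]].
  intros x _. now rewrite sum_Sn.
Qed.

Lemma continuous_sum_n (F : nat -> R -> R) N x :
  (forall n, continuous (F n) x) -> continuous (fun v => sum_n (fun n => F n v) N) x.
Proof.
intros H. induction N as [|N IH].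
- eapply continuous_ext; [|apply (H 0%nat)]. intros v. now rewrite sum_O.
- eapply continuous_ext; [|apply (continuous_plus (V := R_NormedModule)); [exact IH|apply (H (S N))]].
  intros v. now rewrite sum_Sn.
Qed.

Lemma sum_n_ext_R (a b : nat -> R) N : (forall n, a n = b n) -> sum_n a N = sum_n b N.
Proof. exact (sum_n_ext (G := R_AbelianMonoid) a b N). Qed.

Lemma sum_n_scal_l c (u : nat -> R) N : sum_n (fun n => c * u n) N = c * sum_n u N.
Proof. exact (sum_n_mult_l (K := R_Ring) c u N). Qed.

(** Integrating the series in y against a weight: it is enough to compare the
    partial sums with the sum, because the remainder is uniform on [y1, y2]. *)
Lemma Lap_weighted_integral (b : nat -> R) g y1 y2 (wt Bd : R -> R) :
  ex_series (fun n => Rabs (b n)) -> 0 < y1 <= y2 ->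
  (forall v, y1 <= v <= y2 -> continuous wt v) ->
  (forall v, y1 <= v <= y2 -> continuous Bd v) ->
  (forall v, y1 <= v <= y2 -> 0 <= wt v) ->
  (forall v, y1 <= v <= y2 -> Rabs (Lap b g v) <= Bd v) ->
  Rabs (Series (fun n => b n * Rpower (freq n) g *
          RInt (fun v => wt v * exp (- (2 * PI * freq n * v))) y1 y2))
    <= RInt (fun v => wt v * Bd v) y1 y2.
Proof.
intros Hb Hy Hwt HBd Hwt0 HL.
set (W := fun n => RInt (fun v => wt v * exp (- (2 * PI * freq n * v))) y1 y2).
set (M := fun n => Rabs (b n) * wgt g y1 n).
assert (HM : ex_series M) by (apply ex_series_wgt; [exact Hb|lra]).
set (J := RInt wt y1 y2).
assert (Hexp : forall n v, continuous (fun v => exp (- (2 * PI * freq n * v))) v).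
{ intros n v. apply (ex_derive_continuous (V := R_NormedModule)). now auto_derive. }
assert (HcW : forall n v, y1 <= v <= y2 ->
   continuous (fun v => wt v * exp (- (2 * PI * freq n * v))) v).
{ intros n v Hv. apply (continuous_mult (K := R_AbsRing)); [now apply Hwt|apply Hexp]. }
assert (HW : forall n, Rabs (b n * Rpower (freq n) g * W n) <= M n * J).
{ intros n. unfold M, wgt. rewrite !Rabs_mult.
  rewrite (Rabs_pos_eq (Rpower _ _)) by (left; apply exp_pos).
  replace (Rabs (b n) * (Rpower (freq n) g * exp (- (2 * PI * freq n * y1))) * J)
    with (Rabs (b n) * Rpower (freq n) g * (exp (- (2 * PI * freq n * y1)) * J)) by ring.
  apply Rmult_le_compat_l; [apply Rmult_le_pos; [apply Rabs_pos|left; apply exp_pos]|].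
  unfold J. rewrite <- (RInt_scal (V := R_CompleteNormedModule)) by (apply ex_RInt_cont; [lra|exact Hwt]).
  apply Rabs_RInt_le; [lra|apply HcW| |].
  - intros v Hv. apply (continuous_scal_r (K := R_AbsRing) (V := R_NormedModule)). now apply Hwt.
  - intros v Hv. rewrite Rabs_mult, !Rabs_pos_eq; [|left; apply exp_pos|now apply Hwt0].
    unfold scal; simpl; unfold mult; simpl. rewrite Rmult_comm. apply Rmult_le_compat_r; [now apply Hwt0|].
    pose proof (wgt_decr 0 y1 v n ltac:(lra)) as H. unfold wgt in H.
    rewrite Rpower_O in H by (pose proof (freq_ge1 n); lra). lra. }
assert (HS : ex_series (fun n => Rabs (b n * Rpower (freq n) g * W n))).
{ apply ex_series_dom with (b := fun n => M n * J); [intros n; rewrite Rabs_Rabsolu; apply HW|].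
  now apply ex_series_scal_r. }
assert (HS' : ex_series (fun n => b n * Rpower (freq n) g * W n)) by now apply ex_series_Rabs.
set (P := RInt (fun v => wt v * Bd v) y1 y2).
assert (HN : forall N, Rabs (sum_n (fun n => b n * Rpower (freq n) g * W n) N) <= P + tail M N * J).
{ intros N.
  assert (E : sum_n (fun n => b n * Rpower (freq n) g * W n) N =
     RInt (fun v => sum_n (fun n => b n * Rpower (freq n) g * (wt v * exp (- (2 * PI * freq n * v)))) N) y1 y2).
  { symmetry. apply is_RInt_unique, is_RInt_sum_n. intros n.
    apply (is_RInt_scal (V := R_NormedModule)).
    apply (RInt_correct (V := R_CompleteNormedModule)), ex_RInt_cont; [lra|apply HcW]. }
  rewrite E.
  replace (P + tail M N * J) with (RInt (fun v => wt v * Bd v + tail M N * wt v) y1 y2).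
  2:{ unfold P, J. apply is_RInt_unique. apply (is_RInt_plus (V := R_NormedModule)).
      - apply (RInt_correct (V := R_CompleteNormedModule)), ex_RInt_cont; [lra|].
        intros v Hv. apply (continuous_mult (K := R_AbsRing)); auto.
      - apply (is_RInt_scal (V := R_NormedModule)).
        apply (RInt_correct (V := R_CompleteNormedModule)), ex_RInt_cont; [lra|exact Hwt]. }
  apply Rabs_RInt_le; [lra| | |].
  - intros v Hv. apply (continuous_sum_n (fun n v => b n * Rpower (freq n) g * (wt v * exp (- (2 * PI * freq n * v))))).
    intros n. apply (continuous_scal_r (K := R_AbsRing) (V := R_NormedModule)). now apply HcW.
  - intros v Hv. apply (continuous_plus (V := R_NormedModule)).
    + apply (continuous_mult (K := R_AbsRing)); auto.
    + apply (continuous_scal_r (K := R_AbsRing) (V := R_NormedModule)). auto.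
  - intros v Hv.
    replace (sum_n _ N) with (wt v * sum_n (fun n => b n * wgt g v n) N).
    2:{ rewrite <- sum_n_scal_l. apply sum_n_ext_R. intros n. unfold wgt. ring. }
    rewrite Rabs_mult, Rabs_pos_eq by now apply Hwt0.
    rewrite (Rmult_comm (tail M N)), <- Rmult_plus_distr_l.
    apply Rmult_le_compat_l; [now apply Hwt0|].
    assert (Ht : Rabs (Lap b g v - sum_n (fun n => b n * wgt g v n) N) <= tail M N).
    { apply Series_tail_bound; [|exact HM]. intros n. rewrite Rabs_wgt_mult.
      apply Rmult_le_compat_l; [apply Rabs_pos|]. apply wgt_decr; lra. }
    specialize (HL v Hv). revert HL Ht. unfold Rabs. repeat destruct Rcase_abs; lra. }
apply (is_lim_seq_le_lim (fun N => Rabs (sum_n (fun n => b n * Rpower (freq n) g * W n) N))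
         (fun N => tail M N * J)); [| |exact HN].
- change (Finite (Rabs ?s)) with (Rbar_abs (Finite s)).
  apply is_lim_seq_abs. exact (Series_correct _ HS').
- replace (Finite 0) with (Rbar_mult 0 J) by (simpl; f_equal; ring).
  apply is_lim_seq_scal_r. now apply is_lim_seq_tail.
Qed.

(** Truncations of Euler's integral for the Gamma function at d. *)
Definition gam (d a b : R) : R := RInt (fun t => Rpower t (d - 1) * exp (- t)) a b.

Lemma gam_cont d t : 0 < t -> continuous (fun t => Rpower t (d - 1) * exp (- t)) t.
Proof.
intros Ht. apply (continuous_mult (K := R_AbsRing)); [now apply continuous_Rpower|].
apply (ex_derive_continuous (V := R_NormedModule)). now auto_derive.
Qed.

Lemma RInt_ge0 (f : R -> R) a b : a <= b -> (forall x, a <= x <= b -> continuous f x) ->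
  (forall x, a <= x <= b -> 0 <= f x) -> 0 <= RInt f a b.
Proof.
intros Hab Hc H. apply RInt_ge_0; [exact Hab|now apply ex_RInt_cont|]. intros; apply H; lra.
Qed.

Lemma gam_ge0 d a b : 0 < a <= b -> 0 <= gam d a b.
Proof.
intros H. apply RInt_ge0; [lra| |]; intros x Hx; [apply gam_cont; lra|].
apply Rmult_le_pos; left; apply exp_pos.
Qed.

Lemma gam_Chasles d a b c : 0 < a <= b -> b <= c -> gam d a c = gam d a b + gam d b c.
Proof.
intros H1 H2. unfold gam. symmetry.
apply (RInt_Chasles (V := R_CompleteNormedModule)); apply ex_RInt_cont; try lra;
  intros; apply gam_cont; lra.
Qed.

Lemma gam_bounded d : 0 < d -> exists K, forall a b, 0 < a <= 1 -> 1 <= b -> gam d a b <= K.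
Proof.
intros Hd. destruct (Rpower_exp_bounded (d - 1) (/ 2)) as [B [HB H]]; [lra|].
exists (1 / d + 2 * B). intros a b Ha Hb.
rewrite (gam_Chasles d a 1 b) by lra. apply Rplus_le_compat.
- unfold gam. apply Rle_trans with (RInt (fun t => Rpower t (d - 1)) a 1).
  + apply RInt_le; [lra|apply ex_RInt_cont; [lra|intros; apply gam_cont; lra]
      |apply ex_RInt_cont; [lra|intros; apply continuous_Rpower; lra]|].
    intros x Hx. rewrite <- (Rmult_1_r (Rpower x (d - 1))) at 2.
    apply Rmult_le_compat_l; [left; apply exp_pos|].
    rewrite <- exp_0. left; apply exp_increasing; lra.
  + rewrite RInt_Rpower by lra. unfold Rdiv. apply Rmult_le_compat_r; [left; now apply Rinv_0_lt_compat|].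
    pose proof (Rpower_gt0 a d). replace (Rpower 1 d) with 1; [lra|].
    unfold Rpower. rewrite ln_1, Rmult_0_r, exp_0. reflexivity.
- unfold gam. apply Rle_trans with (RInt (fun t => B * exp (- (/ 2 * t))) 1 b).
  + assert (forall x, continuous (fun t => B * exp (- (/ 2 * t))) x).
    { intros x. apply (ex_derive_continuous (V := R_NormedModule)). now auto_derive. }
    apply RInt_le; [lra|apply ex_RInt_cont; [lra|intros; apply gam_cont; lra]
      |apply ex_RInt_cont; [lra|auto]|].
    intros x Hx. replace (- x) with (- (/ 2 * x) + - (/ 2 * x)) by lra. rewrite exp_plus.
    rewrite <- Rmult_assoc. apply Rmult_le_compat_r; [left; apply exp_pos|]. apply H. lra.
  + replace (RInt _ 1 b) with (minus (- 2 * B * exp (- (/ 2 * b))) (- 2 * B * exp (- (/ 2 * 1)))).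
    * unfold minus, plus, opp; simpl. pose proof (exp_pos (- (/ 2 * b))).
      assert (exp (- (/ 2 * 1)) < 1) by (rewrite <- exp_0 at 2; apply exp_increasing; lra).
      assert (0 < B * exp (- (/ 2 * b))) by now apply Rmult_lt_0_compat.
      assert (B * exp (- (/ 2 * 1)) < B * 1) by now apply Rmult_lt_compat_l. lra.
    * symmetry. apply is_RInt_unique.
      apply (is_RInt_derive (V := R_CompleteNormedModule) (fun t => - 2 * B * exp (- (/ 2 * t)))).
      -- intros x _. auto_derive; [trivial|]. field.
      -- intros x _. apply (ex_derive_continuous (V := R_NormedModule)). now auto_derive.
Qed.

(** The truncations increase with the interval; their least upper bound is Gamma(d) > 0. *)
Lemma gam_limit d : 0 < d ->
  exists K, 0 < K /\ (forall a b, 0 < a <= b -> gam d a b <= K) /\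
  forall (a b : nat -> R), (forall p, 0 < a p <= b p) ->
    is_lim_seq a 0 -> is_lim_seq b p_infty -> is_lim_seq (fun p => gam d (a p) (b p)) K.
Proof.
intros Hd. destruct (gam_bounded d Hd) as [K0 HK0].
assert (Hmono : forall a b a' b', 0 < a' -> a' <= a -> a <= b -> b <= b' -> gam d a b <= gam d a' b').
{ intros a b a' b' H1 H2 H3 H4. rewrite (gam_Chasles d a' a b'), (gam_Chasles d a b b') by lra.
  pose proof (gam_ge0 d a' a ltac:(lra)). pose proof (gam_ge0 d b b' ltac:(lra)). lra. }
assert (Hle : forall a b, 0 < a <= b -> gam d a b <= K0).
{ intros a b H. eapply Rle_trans; [apply (Hmono a b (Rmin a 1) (Rmax b 1))|apply HK0].
  - apply Rmin_glb_lt; lra.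
  - apply Rmin_l. - lra. - apply Rmax_l.
  - split; [apply Rmin_glb_lt; lra|apply Rmin_r].
  - apply Rmax_r. }
destruct (completeness (fun z => exists a b, 0 < a <= b /\ z = gam d a b)) as [K [HK1 HK2]].
- exists K0. intros z [a [b [H ->]]]. now apply Hle.
- exists (gam d 1 1), 1, 1. split; [lra|reflexivity].
- assert (HKle : forall a b, 0 < a <= b -> gam d a b <= K).
  { intros a b H. apply HK1. now exists a, b. }
  exists K. split; [|split; [exact HKle|]].
  + apply Rlt_le_trans with (gam d 1 2); [|apply HKle; lra].
    apply RInt_gt_0; [lra| |intros; apply gam_cont; lra].
    intros; apply Rmult_lt_0_compat; apply exp_pos.
  + intros a b Hab Ha Hb. apply is_lim_seq_spec. intros eps.
    assert (Hex : exists a0 b0, 0 < a0 <= b0 /\ K - eps < gam d a0 b0).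
    { apply NNPP. intros Hn. assert (K <= K - eps); [|destruct eps; simpl in *; lra].
      apply HK2. intros z [a0 [b0 [H ->]]]. apply Rnot_lt_le. intros Hlt.
      apply Hn. now exists a0, b0. }
    destruct Hex as [a0 [b0 [H0 H1]]].
    apply is_lim_seq_spec in Ha. apply is_lim_seq_spec in Hb.
    destruct (Ha (mkposreal a0 (proj1 H0))) as [n1 Hn1]. destruct (Hb b0) as [n2 Hn2].
    exists (max n1 n2). intros n Hn.
    specialize (Hn1 n ltac:(lia)). specialize (Hn2 n ltac:(lia)). simpl in Hn1, Hn2.
    rewrite Rminus_0_r in Hn1. apply Rabs_def2 in Hn1.
    pose proof (Hmono a0 b0 (a n) (b n) (proj1 (Hab n)) ltac:(lra) ltac:(lra) ltac:(lra)).
    pose proof (HKle (a n) (b n) (Hab n)). apply Rabs_def1; destruct eps; simpl in *; lra.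
Qed.

(** Below u = y the factor (y + u)^(-rho) is at most y^(-rho), above it is at most u^(-rho);
    0 < d makes the first piece converge at 0, d < rho the second at infinity. *)
Lemma RInt_split_bound y d rho e T : 0 < d < rho -> 0 < e <= y -> y <= T ->
  RInt (fun u => Rpower u (d - 1) * Rpower (y + u) (- rho)) e T
    <= (1 / d + 1 / (rho - d)) * Rpower y (d - rho).
Proof.
intros Hd He HT.
assert (Hc : forall u, 0 < u -> continuous (fun u => Rpower u (d - 1) * Rpower (y + u) (- rho)) u).
{ intros u Hu. apply (continuous_mult (K := R_AbsRing)); [now apply continuous_Rpower|].
  apply (continuous_comp (fun u => y + u) (fun t => Rpower t (- rho))).
  - apply (ex_derive_continuous (V := R_NormedModule)). now auto_derive.
  - apply continuous_Rpower. lra. }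
rewrite <- (RInt_Chasles (V := R_CompleteNormedModule) _ e y T)
  by (apply ex_RInt_cont; [lra|intros; apply Hc; lra]).
assert (Hneg : forall u v, 0 < u <= v -> Rpower v (- rho) <= Rpower u (- rho)).
{ intros u v Huv. rewrite !Rpower_Ropp. apply Rinv_le_contravar; [apply exp_pos|].
  apply Rle_Rpower_l; lra. }
rewrite Rmult_plus_distr_r. unfold plus; simpl. apply Rplus_le_compat.
- apply Rle_trans with (RInt (fun u => Rpower y (- rho) * Rpower u (d - 1)) e y).
  + apply RInt_le; [lra|apply ex_RInt_cont; [lra|intros; apply Hc; lra]| |].
    * apply ex_RInt_cont; [lra|]. intros; apply (continuous_scal_r (K := R_AbsRing) (V := R_NormedModule)).
      apply continuous_Rpower; lra.
    * intros x Hx. rewrite Rmult_comm. apply Rmult_le_compat_r; [left; apply exp_pos|].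
      apply Hneg; lra.
  + rewrite (RInt_scal (V := R_CompleteNormedModule)) by
      (apply ex_RInt_cont; [lra|intros; apply continuous_Rpower; lra]).
    rewrite RInt_Rpower by lra. unfold scal; simpl; unfold mult; simpl.
    replace (Rpower y (d - rho)) with (Rpower y (- rho) * Rpower y d)
      by (rewrite <- Rpower_plus; f_equal; ring).
    replace (1 / d * (Rpower y (- rho) * Rpower y d)) with (Rpower y (- rho) * (Rpower y d / d)) by (field; lra).
    apply Rmult_le_compat_l; [left; apply exp_pos|]. unfold Rdiv.
    apply Rmult_le_compat_r; [left; apply Rinv_0_lt_compat; lra|].
    pose proof (Rpower_gt0 e d). lra.
- apply Rle_trans with (RInt (fun u => Rpower u ((d - rho) - 1)) y T).
  + apply RInt_le; [lra|apply ex_RInt_cont; [lra|intros; apply Hc; lra]| |].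
    * apply ex_RInt_cont; [lra|]. intros; apply continuous_Rpower; lra.
    * intros x Hx. replace (d - rho - 1) with ((d - 1) + - rho) by ring. rewrite Rpower_plus.
      apply Rmult_le_compat_l; [left; apply exp_pos|]. apply Hneg; lra.
  + rewrite RInt_Rpower by lra.
    replace (1 / (rho - d) * Rpower y (d - rho)) with (Rpower y (d - rho) / (rho - d)) by (field; lra).
    replace ((Rpower T (d - rho) - Rpower y (d - rho)) / (d - rho))
      with ((Rpower y (d - rho) - Rpower T (d - rho)) / (rho - d)) by (field; lra).
    unfold Rdiv. apply Rmult_le_compat_r; [left; apply Rinv_0_lt_compat; lra|].
    pose proof (Rpower_gt0 T (d - rho)). lra.
Qed.

(** Euler's integral turns the factor w^(-d) into an integral over the vertical
    half-line above y; a bound v^(-rho) there integrates to y^(d - rho). *)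
Lemma Lap_fractional_integral d rho : 0 < d < rho ->
  exists K, 0 < K /\ forall (b : nat -> R) g y C0,
    ex_series (fun n => Rabs (b n)) -> 0 < y -> 0 <= C0 ->
    (forall v, y <= v -> Rabs (Lap b g v) <= C0 * Rpower v (- rho)) ->
    Rabs (Lap b (g - d) y) <= K * C0 * Rpower y (d - rho).
Proof.
intros Hd. destruct (gam_limit d (proj1 Hd)) as [Gm [HGm [HGle HGlim]]].
set (P := Rpower (2 * PI) (- d)).
assert (HP : 0 < P) by apply Rpower_gt0.
set (S0 := 1 / d + 1 / (rho - d)).
assert (HS0 : 0 < S0).
{ unfold S0. apply Rplus_lt_0_compat; apply Rdiv_lt_0_compat; lra. }
exists (S0 / (P * Gm)). split; [apply Rdiv_lt_0_compat; [exact HS0|now apply Rmult_lt_0_compat]|].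
intros b g y C0 Hb Hy HC HL.
pose proof PI_ge_1 as HPI.
set (ep := fun p : nat => y / INR (S p)). set (Tp := fun p : nat => y * INR (S p)).
assert (HSp : forall p, 1 <= INR (S p)) by (intros p; rewrite S_INR; pose proof (pos_INR p); lra).
assert (Hep : forall p, 0 < ep p <= y).
{ intros p. specialize (HSp p). unfold ep, Rdiv. split.
  - apply Rmult_lt_0_compat; [exact Hy|]. apply Rinv_0_lt_compat; lra.
  - rewrite <- (Rmult_1_r y) at 2. apply Rmult_le_compat_l; [lra|].
    rewrite <- Rinv_1. apply Rinv_le_contravar; lra. }
assert (HTp : forall p, y <= Tp p) by (intros p; specialize (HSp p); unfold Tp; nra).
assert (HlimS : is_lim_seq (fun p => INR (S p)) p_infty)
  by (apply (is_lim_seq_incr_1 INR); apply is_lim_seq_INR).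
(* substitution t = 2 PI w (v - y) *)
assert (HW : forall p n,
  RInt (fun v => Rpower (v - y) (d - 1) * exp (- (2 * PI * freq n * v))) (y + ep p) (y + Tp p)
  = exp (- (2 * PI * freq n * y)) * (P * Rpower (freq n) (- d) *
     gam d (2 * PI * freq n * ep p) (2 * PI * freq n * Tp p))).
{ intros p n. set (w := 2 * PI * freq n).
  pose proof (freq_ge1 n) as Hfr.
  assert (Hw : 0 < w) by (unfold w; nra).
  specialize (Hep p). specialize (HTp p).
  assert (HPw : P * Rpower (freq n) (- d) = Rpower w (- d)).
  { unfold P, w. rewrite Rpower_mult_distr by lra. reflexivity. }
  rewrite HPw. unfold gam.
  replace (w * ep p) with (w * (y + ep p) + - (w * y)) by ring.
  replace (w * Tp p) with (w * (y + Tp p) + - (w * y)) by ring.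
  rewrite <- (RInt_comp_lin (V := R_CompleteNormedModule)).
  2:{ apply ex_RInt_cont; [nra|]. intros x Hx. apply gam_cont. nra. }
  assert (Hcc : forall x, y + ep p <= x <= y + Tp p ->
    continuous (fun y0 => scal w (Rpower (w * y0 + - (w * y)) (d - 1) * exp (- (w * y0 + - (w * y))))) x).
  { intros x Hx. apply (continuous_scal_r (K := R_AbsRing) (V := R_NormedModule)).
    apply (continuous_comp (fun u => w * u + - (w * y)) (fun t => Rpower t (d - 1) * exp (- t))).
    - apply (ex_derive_continuous (V := R_NormedModule)). now auto_derive.
    - apply gam_cont. nra. }
  rewrite <- Rmult_assoc.
  change (?c * RInt ?f ?u ?v) with (scal c (RInt f u v)).
  rewrite <- (RInt_scal (V := R_CompleteNormedModule)) by (apply ex_RInt_cont; [lra|exact Hcc]).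
  apply RInt_ext. intros x Hx. rewrite Rmin_left, Rmax_right in Hx by lra.
  unfold scal; simpl; unfold mult; simpl.
  replace (w * x + - (w * y)) with (w * (x - y)) by ring.
  rewrite <- Rpower_mult_distr by lra.
  replace (Rpower w (d - 1)) with (Rpower w d * / w)
    by (unfold Rminus; rewrite Rpower_plus, Rpower_Ropp, Rpower_1 by exact Hw; reflexivity).
  rewrite Rpower_Ropp.
  replace (- (w * (x - y))) with (- (w * x) + w * y) by ring.
  rewrite exp_plus, (exp_Ropp (w * y)).
  pose proof (exp_pos (w * y)). pose proof (Rpower_gt0 w d). field. lra. }
assert (HB : forall p, Rabs (Series (fun n => b n * Rpower (freq n) g *
   RInt (fun v => Rpower (v - y) (d - 1) * exp (- (2 * PI * freq n * v))) (y + ep p) (y + Tp p)))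
   <= C0 * (S0 * Rpower y (d - rho))).
{ intros p. specialize (Hep p). specialize (HTp p).
  assert (Hc1 : forall v, y + ep p <= v <= y + Tp p -> continuous (fun v => Rpower (v - y) (d - 1)) v).
  { intros v Hv. apply (continuous_comp (fun u => u - y) (fun t => Rpower t (d - 1))).
    - apply (ex_derive_continuous (V := R_NormedModule)). now auto_derive.
    - apply continuous_Rpower. lra. }
  assert (Hc2 : forall v, y + ep p <= v <= y + Tp p -> continuous (fun v => C0 * Rpower v (- rho)) v).
  { intros v Hv. apply (continuous_scal_r (K := R_AbsRing) (V := R_NormedModule)).
    apply continuous_Rpower. lra. }
  eapply Rle_trans; [apply (Lap_weighted_integral b g _ _ _ (fun v => C0 * Rpower v (- rho)))|].
  - exact Hb. - lra. - exact Hc1. - exact Hc2.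
  - intros; left; apply exp_pos.
  - intros v Hv. apply HL. lra.
  - apply Rle_trans with (C0 * RInt (fun u => Rpower u (d - 1) * Rpower (y + u) (- rho)) (ep p) (Tp p)).
    + right. assert (Hcx : forall u, ep p <= u <= Tp p ->
        continuous (fun u => Rpower u (d - 1) * Rpower (y + u) (- rho)) u).
      { intros u Hu. apply (continuous_mult (K := R_AbsRing)); [apply continuous_Rpower; lra|].
        apply (continuous_comp (fun u => y + u) (fun t => Rpower t (- rho))).
        - apply (ex_derive_continuous (V := R_NormedModule)). now auto_derive.
        - apply continuous_Rpower. lra. }
      set (F := fun u => Rpower u (d - 1) * Rpower (y + u) (- rho)) in *.
      assert (Esub : RInt F (ep p) (Tp p) =
        RInt (fun x => scal 1 (F (1 * x + - y))) (y + ep p) (y + Tp p)).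
      { rewrite (RInt_comp_lin (V := R_CompleteNormedModule)).
        - f_equal; ring.
        - apply ex_RInt_cont; [lra|]. intros; apply Hcx; lra. }
      rewrite Esub. unfold F.
      change (?c * RInt ?f ?u ?v) with (scal c (RInt f u v)).
      rewrite <- (RInt_scal (V := R_CompleteNormedModule)).
      * apply RInt_ext. intros x Hx. unfold scal; simpl; unfold mult; simpl.
        replace (1 * x + - y) with (x - y) by ring.
        replace (y + (x - y)) with x by ring. ring.
      * apply ex_RInt_cont; [lra|]. intros x Hx.
        apply (continuous_scal_r (K := R_AbsRing) (V := R_NormedModule)).
        apply (continuous_comp (fun u => 1 * u + - y) (fun u => Rpower u (d - 1) * Rpower (y + u) (- rho))).
        -- apply (ex_derive_continuous (V := R_NormedModule)). now auto_derive.
        -- apply Hcx. lra.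
    + apply Rmult_le_compat_l; [exact HC|]. apply RInt_split_bound; lra. }
(* every truncation is dominated by the complete integral Gm *)
assert (Hlim : is_lim_seq (fun p => Series (fun n => b n * Rpower (freq n) g *
   RInt (fun v => Rpower (v - y) (d - 1) * exp (- (2 * PI * freq n * v))) (y + ep p) (y + Tp p)))
   (Series (fun n => P * Gm * (b n * wgt (g - d) y n)))).
{ apply (Series_dominated _ _ (fun n => P * Gm * (Rabs (b n) * wgt (g - d) y n))).
  - intros p n. rewrite HW. pose proof (freq_ge1 n) as Hfr.
    assert (Hwp : 0 < 2 * PI * freq n) by nra.
    specialize (Hep p). specialize (HTp p).
    assert (H0g : 0 < 2 * PI * freq n * ep p <= 2 * PI * freq n * Tp p) by nra.
    rewrite !Rabs_mult.
    rewrite (Rabs_pos_eq (Rpower _ _)), (Rabs_pos_eq (exp _)), (Rabs_pos_eq P),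
      (Rabs_pos_eq (Rpower _ (- d))), (Rabs_pos_eq (gam _ _ _)) by
      (first [now apply gam_ge0|left; apply exp_pos]).
    unfold wgt.
    replace (Rpower (freq n) (g - d)) with (Rpower (freq n) g * Rpower (freq n) (- d))
      by (rewrite <- Rpower_plus; reflexivity).
    set (q := gam _ _ _). assert (Hq : q <= Gm) by now apply HGle.
    replace (P * Gm * (Rabs (b n) * (Rpower (freq n) g * Rpower (freq n) (- d) * exp (- (2 * PI * freq n * y)))))
      with (Rabs (b n) * Rpower (freq n) g * (exp (- (2 * PI * freq n * y)) * (P * Rpower (freq n) (- d) * Gm)))
      by ring.
    apply Rmult_le_compat_l; [apply Rmult_le_pos; [apply Rabs_pos|left; apply exp_pos]|].
    apply Rmult_le_compat_l; [left; apply exp_pos|].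
    apply Rmult_le_compat_l; [|exact Hq]. apply Rmult_le_pos; left; apply exp_pos.
  - apply (ex_series_scal (P * Gm) (fun n => Rabs (b n) * wgt (g - d) y n)). now apply ex_series_wgt.
  - intros n. pose proof (freq_ge1 n) as Hfr.
    assert (Hwp : 0 < 2 * PI * freq n) by nra.
    apply is_lim_seq_ext with (fun p => (b n * Rpower (freq n) g * exp (- (2 * PI * freq n * y)) * (P * Rpower (freq n) (- d))) *
      gam d (2 * PI * freq n * ep p) (2 * PI * freq n * Tp p)).
    { intros p. rewrite HW. ring. }
    replace (Finite (P * Gm * (b n * wgt (g - d) y n))) with
      (Rbar_mult (b n * Rpower (freq n) g * exp (- (2 * PI * freq n * y)) * (P * Rpower (freq n) (- d))) Gm).
    2:{ simpl. f_equal. unfold wgt.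
      replace (Rpower (freq n) (g - d)) with (Rpower (freq n) g * Rpower (freq n) (- d))
        by (rewrite <- Rpower_plus; reflexivity). ring. }
    apply is_lim_seq_scal_l. apply HGlim.
    + intros p. specialize (Hep p). specialize (HTp p). nra.
    + unfold ep.
      apply is_lim_seq_ext with (fun p => (2 * PI * freq n * y) * / INR (S p)); [intros p; unfold Rdiv; ring|].
      replace (Finite 0) with (Rbar_mult (2 * PI * freq n * y) 0) by (simpl; f_equal; ring).
      apply is_lim_seq_scal_l. apply (is_lim_seq_inv _ p_infty HlimS). easy.
    + unfold Tp.
      apply is_lim_seq_ext with (fun p => (2 * PI * freq n * y) * INR (S p)); [intros p; ring|].
      replace p_infty with (Rbar_mult (2 * PI * freq n * y) p_infty).
      * apply is_lim_seq_scal_l. exact HlimS.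
      * simpl. destruct Rle_dec as [H|H]; [|exfalso; apply H; nra].
        destruct Rle_lt_or_eq_dec as [H'|H']; [reflexivity|]. exfalso; nra. }
apply is_lim_seq_abs in Hlim. simpl in Hlim.
pose proof (is_lim_seq_le _ _ (Finite _) (Finite _) HB Hlim (is_lim_seq_const _)) as Hfin. simpl in Hfin.
rewrite Series_scal_l in Hfin. fold (Lap b (g - d) y) in Hfin.
assert (HPG : 0 < P * Gm) by now apply Rmult_lt_0_compat.
rewrite Rabs_mult, (Rabs_pos_eq (P * Gm)) in Hfin by lra.
apply (Rmult_le_reg_l (P * Gm)); [exact HPG|].
replace (P * Gm * (S0 / (P * Gm) * C0 * Rpower y (d - rho))) with (C0 * (S0 * Rpower y (d - rho)))
  by (field; lra).
exact Hfin.
Qed.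

(** * Size of a cusp form *)

(** ** Diophantine approximation by columns of unimodular matrices *)

(** As long as the sum of the denominators is at most n, the mediant replaces the neighbour on
    its side of x; this preserves the determinant. *)
Lemma Farey_pair (x : R) (n : nat) : (1 <= n)%nat ->
  exists a c b d : Z, (1 <= c <= Z.of_nat n)%Z /\ (1 <= d <= Z.of_nat n)%Z /\
    (Z.of_nat n < c + d)%Z /\ (b * c - a * d = 1)%Z /\
    IZR a <= IZR c * x /\ IZR d * x <= IZR b.
Proof.
intros Hn. induction n as [|n IH]; [lia|].
destruct (Nat.eq_dec n 0) as [->|Hn0].
- destruct (archimed x) as [H1 H2].
  exists (up x - 1)%Z, 1%Z, (up x), 1%Z. repeat split; try lia.
  + rewrite minus_IZR. lra.
  + lra.
- destruct (IH ltac:(lia)) as (a & c & b & d & Hc & Hd & Hcd & Hdet & Ha & Hb).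
  destruct (Z_lt_le_dec (Z.of_nat (S n)) (c + d)) as [H|H].
  + exists a, c, b, d. repeat split; try assumption; lia.
  + destruct (Rle_dec (IZR (c + d) * x) (IZR (a + b))) as [Hm|Hm].
    * exists a, c, (a + b)%Z, (c + d)%Z. repeat split; try assumption; lia.
    * exists (a + b)%Z, (c + d)%Z, b, d. repeat split; try assumption; try lia. lra.
Qed.

(** Dirichlet's theorem: p/q is the Farey neighbour on the same side of the mediant as x, and
    the other neighbour, up to sign, supplies the second column. *)
Lemma Dirichlet_unimodular (x : R) (n : nat) : (1 <= n)%nat ->
  exists p q u v : Z, (1 <= q <= Z.of_nat n)%Z /\ (p * v - u * q = 1)%Z /\
    Rabs (IZR q * x - IZR p) <= / INR (S n).
Proof.
intros Hn. destruct (Farey_pair x n Hn) as (a & c & b & d & Hc & Hd & Hcd & Hdet & Ha & Hb).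
assert (Hc' : 1 <= IZR c) by (apply IZR_le; lia).
assert (Hd' : 1 <= IZR d) by (apply IZR_le; lia).
assert (HS : INR (S n) <= IZR (c + d)) by (rewrite INR_IZR_INZ; apply IZR_le; lia).
assert (HSp : 0 < INR (S n)) by (apply lt_0_INR; lia).
assert (HdetR : IZR b * IZR c - IZR a * IZR d = 1) by (rewrite <- !mult_IZR, <- minus_IZR; now f_equal).
rewrite plus_IZR in HS.
assert (key : forall t, 0 <= t -> t * (IZR c + IZR d) <= 1 -> Rabs t <= / INR (S n)).
{ intros t Ht H. rewrite Rabs_pos_eq by exact Ht.
  apply (Rmult_le_reg_r (INR (S n))); [exact HSp|]. rewrite Rinv_l by lra. nra. }
destruct (Rle_dec ((IZR c + IZR d) * x) (IZR a + IZR b)) as [Hm|Hm].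
- exists a, c, (- b)%Z, (- d)%Z. split; [lia|]. split; [lia|]. apply key; nra.
- exists b, d, a, c. split; [lia|]. split; [lia|].
  rewrite <- Rabs_Ropp. apply key; nra.
Qed.

(** The distance from q x to the integers is positive for each q, and only finitely many q
    are concerned. *)
Lemma irrational_denominators (x : R) (Q : nat) : irrational x ->
  exists n : nat, (1 <= n)%nat /\ forall p q : Z, (1 <= q <= Z.of_nat Q)%Z ->
    / INR (S n) < Rabs (IZR q * x - IZR p).
Proof.
intros Hx.
assert (H : exists eps, 0 < eps /\ forall p q : Z, (1 <= q <= Z.of_nat Q)%Z -> eps <= Rabs (IZR q * x - IZR p)).
{ induction Q as [|Q [eps [He IH]]].
  - exists 1. split; [lra|]. intros; lia.
  - set (t := IZR (Z.of_nat (S Q)) * x).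
    destruct (archimed t) as [H1 H2].
    assert (H3 : t - IZR (up t - 1) <> 0).
    { intros H. apply Hx. exists (up t - 1)%Z, (Z.of_nat (S Q)). split; [lia|].
      assert (Hq : IZR (Z.of_nat (S Q)) <> 0) by (apply not_0_IZR; lia).
      apply (Rmult_eq_reg_l (IZR (Z.of_nat (S Q)))); [|exact Hq]. fold t. field_simplify; [lra|exact Hq]. }
    rewrite minus_IZR in H3.
    exists (Rmin eps (Rmin (t - (IZR (up t) - 1)) (IZR (up t) - t))). split.
    + repeat apply Rmin_glb_lt; lra.
    + intros p q Hq. destruct (Z.eq_dec q (Z.of_nat (S Q))) as [->|Hne].
      * eapply Rle_trans; [apply Rmin_r|]. fold t.
        destruct (Z_le_gt_dec p (up t - 1)) as [Hp|Hp].
        -- apply IZR_le in Hp. rewrite minus_IZR in Hp.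
           eapply Rle_trans; [apply Rmin_l|]. rewrite Rabs_pos_eq; lra.
        -- assert (Hp' : (up t <= p)%Z) by lia. apply IZR_le in Hp'.
           eapply Rle_trans; [apply Rmin_r|]. rewrite <- Rabs_Ropp, Rabs_pos_eq; lra.
      * eapply Rle_trans; [apply Rmin_l|]. apply IH. lia. }
destruct H as [eps [He H]].
destruct (archimed_cor1 eps He) as [n [Hn Hn0]].
exists n. split; [lia|]. intros p q Hq. eapply Rlt_le_trans; [|now apply H].
eapply Rle_lt_trans; [|exact Hn]. apply Rinv_le_contravar; [now apply lt_0_INR|].
apply le_INR. lia.
Qed.

(** ** The action of SL_2(Z) on the upper half plane *)

Lemma Cmod_sq z : Cmod z ^ 2 = Re z ^ 2 + Im z ^ 2.
Proof. apply Cmod2_alt. Qed.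

Lemma jden_sq g z :
  Cmod (jden g z) ^ 2 = (IZR (mc g) * Re z + IZR (md g)) ^ 2 + (IZR (mc g) * Im z) ^ 2.
Proof.
rewrite Cmod_sq. unfold jden. rewrite Re_plus, Im_plus, Re_mult, Im_mult. simpl. ring.
Qed.

Lemma SL2Z_det g : SL2Z g -> IZR (ma g) * IZR (md g) - IZR (mb g) * IZR (mc g) = 1.
Proof.
intros H. unfold SL2Z, mdet in H. rewrite <- !mult_IZR, <- minus_IZR. now f_equal.
Qed.

Lemma sum_sq_eq_0 a b : 0 ^ 2 = a ^ 2 + b ^ 2 -> a = 0 /\ b = 0.
Proof. intros H. apply Rplus_sqr_eq_0. rewrite !Rsqr_pow2, <- H. ring. Qed.

Lemma jden_neq_0 g z : SL2Z g -> upper_half_plane z -> jden g z <> 0%C.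
Proof.
intros Hg Hz H. pose proof (jden_sq g z) as E. rewrite H, Cmod_0 in E.
pose proof (SL2Z_det g Hg) as D. unfold upper_half_plane in Hz.
destruct (sum_sq_eq_0 _ _ E) as [Hd Hc].
destruct (Rmult_integral _ _ Hc) as [Hc0|]; [|lra].
rewrite Hc0, Rmult_0_l, Rplus_0_l in Hd. rewrite Hc0, Hd in D. lra.
Qed.

Lemma Cmod_jden_gt0 g z : SL2Z g -> upper_half_plane z -> 0 < Cmod (jden g z).
Proof. intros. now apply Cmod_gt_0, jden_neq_0. Qed.

Lemma Im_mobius g z : SL2Z g -> upper_half_plane z ->
  Im (mobius g z) = Im z / Cmod (jden g z) ^ 2.
Proof.
intros Hg Hz. pose proof (Cmod_jden_gt0 g z Hg Hz) as Hp.
assert (Hsq : 0 < Cmod (jden g z) ^ 2) by now apply pow_lt.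
pose proof (SL2Z_det g Hg) as D.
rewrite jden_sq in *. unfold mobius, jden in *.
destruct z as [x y]. unfold upper_half_plane in *.
unfold Cdiv, Cinv. simpl in *.
rewrite <- (Rmult_1_r (y / _)), <- D. field.
intros E. apply (Rgt_not_eq _ _ Hsq). rewrite D in E. exact E.
Qed.

Lemma mobius_upper g z : SL2Z g -> upper_half_plane z -> upper_half_plane (mobius g z).
Proof.
intros Hg Hz. unfold upper_half_plane. rewrite Im_mobius by assumption.
apply Rdiv_lt_0_compat; [exact Hz|]. apply pow_lt. now apply Cmod_jden_gt0.
Qed.

Lemma mobius_mmul g h z : SL2Z g -> SL2Z h -> upper_half_plane z ->
  mobius (mmul g h) z = mobius g (mobius h z).
Proof.
intros Hg Hh Hz.
pose proof (jden_neq_0 h z Hh Hz) as H1.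
pose proof (jden_neq_0 g _ Hg (mobius_upper h z Hh Hz)) as H2.
unfold mobius at 1 2.
assert (E : jden (mmul g h) z = (jden g (mobius h z) * jden h z)%C).
{ unfold mobius, jden in *. simpl. rewrite !plus_IZR, !mult_IZR, !RtoC_plus, !RtoC_mult.
  field. exact H1. }
assert (E' : (RtoC (IZR (ma (mmul g h))) * z + RtoC (IZR (mb (mmul g h))) =
  (RtoC (IZR (ma g)) * mobius h z + RtoC (IZR (mb g))) * jden h z)%C).
{ unfold mobius, jden in *. simpl. rewrite !plus_IZR, !mult_IZR, !RtoC_plus, !RtoC_mult.
  field. exact H1. }
rewrite E, E'. field. now split.
Qed.

Lemma mobius_mone z : mobius mone z = z.
Proof. unfold mobius, jden, mone. simpl. field. Qed.

Lemma SL2Z_minv g : SL2Z g -> SL2Z (minv g).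
Proof. unfold SL2Z, mdet, minv; simpl. lia. Qed.

Lemma SL2Z_mmul g h : SL2Z g -> SL2Z h -> SL2Z (mmul g h).
Proof. destruct g, h. unfold SL2Z, mdet, mmul; simpl. intros. nia. Qed.

Lemma mat2_ext a b c d a' b' c' d' : a = a' -> b = b' -> c = c' -> d = d' ->
  Mat2 a b c d = Mat2 a' b' c' d'.
Proof. now intros -> -> -> ->. Qed.

Lemma mmul_minv_r g : SL2Z g -> mmul g (minv g) = mone.
Proof.
intros H. unfold SL2Z, mdet in H. destruct g as [a b c d]; unfold mmul, minv, mone; simpl in *.
apply mat2_ext; lia.
Qed.

Lemma mobius_minv_r g z : SL2Z g -> upper_half_plane z -> mobius g (mobius (minv g) z) = z.
Proof.
intros Hg Hz. rewrite <- mobius_mmul by (try apply SL2Z_minv; assumption).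
rewrite mmul_minv_r by assumption. apply mobius_mone.
Qed.

(** ** Uniformity over residue classes *)

Definition congruent_mod (N : Z) (g h : mat2) : Prop :=
  (N | ma g - ma h)%Z /\ (N | mb g - mb h)%Z /\ (N | mc g - mc h)%Z /\ (N | md g - md h)%Z.

Lemma congruent_quotient N g s : SL2Z g -> SL2Z s -> congruent_mod N g s ->
  principal_congruence N (mmul g (minv s)).
Proof.
intros Hg Hs (Ha & Hb & Hc & Hd). split; [apply SL2Z_mmul; [exact Hg|now apply SL2Z_minv]|].
unfold SL2Z, mdet in Hs. destruct g as [a b c d], s as [a' b' c' d']; simpl in *.
destruct Ha as [ka Ha], Hb as [kb Hb], Hc as [kc Hc], Hd as [kd Hd].
replace a with (a' + ka * N)%Z by lia. replace b with (b' + kb * N)%Z by lia.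
replace c with (c' + kc * N)%Z by lia. replace d with (d' + kd * N)%Z by lia.
repeat split.
- exists (ka * d' - kb * c')%Z. rewrite <- Hs. ring.
- exists (kb * a' - ka * b')%Z. ring.
- exists (kc * d' - kd * c')%Z. ring.
- exists (kd * a' - kc * b')%Z. rewrite <- Hs. ring.
Qed.

Lemma mmul_quotient g s : SL2Z s -> mmul (mmul g (minv s)) s = g.
Proof.
intros Hs. unfold SL2Z, mdet in Hs. destruct g as [a b c d], s as [a' b' c' d'].
unfold mmul, minv; simpl in *.
apply mat2_ext;
  [transitivity (a * (a' * d' - b' * c'))%Z|transitivity (b * (a' * d' - b' * c'))%Z
  |transitivity (c * (a' * d' - b' * c'))%Z|transitivity (d * (a' * d' - b' * c'))%Z];
  first [ring|rewrite Hs; ring].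
Qed.

Lemma finite_uniform_bound (Q : nat -> R -> Prop) :
  (forall i B B', Q i B -> B <= B' -> Q i B') -> (forall i, exists B, Q i B) ->
  forall n, exists B, forall i, (i < n)%nat -> Q i B.
Proof.
intros Hm He n. induction n as [|n [B IH]].
- exists 0. intros; lia.
- destruct (He n) as [B' HB']. exists (Rmax B B'). intros i Hi.
  destruct (Nat.eq_dec i n) as [->|Hne].
  + eapply Hm; [exact HB'|apply Rmax_r].
  + eapply Hm; [apply IH; lia|apply Rmax_l].
Qed.

(** There are N^4 residues, and a residue without a matrix of determinant 1 is vacuous. *)
Lemma residue_uniform_bound N (Q : mat2 -> R -> Prop) : (1 <= N)%Z ->
  (forall g B B', Q g B -> B <= B' -> Q g B') ->
  (forall s, SL2Z s -> exists B, forall g, SL2Z g -> congruent_mod N g s -> Q g B) ->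
  exists B, forall g, SL2Z g -> Q g B.
Proof.
intros HN Hm Hs.
set (res := fun k : Z => Z.to_nat (k mod N)).
assert (Hres : forall k, (res k < Z.to_nat N)%nat).
{ intros k. unfold res. pose proof (Z.mod_pos_bound k N ltac:(lia)). lia. }
assert (Hdiv : forall k l, res k = res l -> (N | k - l)%Z).
{ intros k l H. unfold res in H.
  pose proof (Z.mod_pos_bound k N ltac:(lia)). pose proof (Z.mod_pos_bound l N ltac:(lia)).
  apply Z.mod_divide; [lia|]. rewrite Zminus_mod.
  replace (k mod N)%Z with (l mod N)%Z by lia. rewrite Z.sub_diag. apply Z.mod_0_l. lia. }
set (Q4 := fun i j k l B => forall g, SL2Z g -> res (ma g) = i -> res (mb g) = j ->
   res (mc g) = k -> res (md g) = l -> Q g B).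
assert (H4 : forall i j k l, exists B, Q4 i j k l B).
{ intros i j k l.
  destruct (classic (exists s, SL2Z s /\ res (ma s) = i /\ res (mb s) = j /\
    res (mc s) = k /\ res (md s) = l)) as [(s & H & H1 & H2 & H3 & H4)|Hno].
  - destruct (Hs s H) as [B HB]. exists B. intros g Hg E1 E2 E3 E4. apply HB; [exact Hg|].
    repeat split; apply Hdiv; congruence.
  - exists 0. intros g Hg E1 E2 E3 E4. exfalso. apply Hno. now exists g. }
set (n := Z.to_nat N) in *.
assert (M4 : forall i j k l B B', Q4 i j k l B -> B <= B' -> Q4 i j k l B').
{ intros i j k l B B' H HB g Hg E1 E2 E3 E4. eapply Hm; [now apply H|exact HB]. }
assert (H3 : forall i j k, exists B, forall l, (l < n)%nat -> Q4 i j k l B).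
{ intros. apply finite_uniform_bound; [apply M4|apply H4]. }
assert (H2 : forall i j, exists B, forall k, (k < n)%nat -> forall l, (l < n)%nat -> Q4 i j k l B).
{ intros i j. apply (finite_uniform_bound (fun k B => forall l, (l < n)%nat -> Q4 i j k l B)); [|apply H3].
  intros k B B' H HB l Hl. eapply M4; [now apply H|exact HB]. }
assert (H1 : forall i, exists B, forall j, (j < n)%nat -> forall k, (k < n)%nat -> forall l, (l < n)%nat -> Q4 i j k l B).
{ intros i. apply (finite_uniform_bound (fun j B => forall k, (k < n)%nat -> forall l, (l < n)%nat -> Q4 i j k l B)); [|apply H2].
  intros j B B' H HB k Hk l Hl. eapply M4; [now apply H|exact HB]. }
destruct (finite_uniform_bound (fun i B => forall j, (j < n)%nat -> forall k, (k < n)%nat -> forall l, (l < n)%nat -> Q4 i j k l B)) with (n := n) as [B HB].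
{ intros i B B' H HB j Hj k Hk l Hl. eapply M4; [now apply H|exact HB]. }
{ exact H1. }
exists B. intros g Hg. eapply (HB (res (ma g)) (Hres _) (res (mb g)) (Hres _) (res (mc g)) (Hres _) (res (md g)) (Hres _)); auto.
Qed.

(** ** The invariant height of a modular form *)

Definition height (r : R) (f : C -> C) (z : C) : R := Cmod (f z) * Rpower (Im z) (r / 2).

Lemma Cmod_Cexp z : Cmod (Cexp z) = exp (Re z).
Proof.
assert (E : Cexp z = (RtoC (exp (Re z)) * cis (Im z / (2 * PI)))%C).
{ unfold cis, Cexp. replace (2 * PI * (Im z / (2 * PI))) with (Im z) by (field; apply PI_neq0).
  apply C_ext; simpl; ring. }
rewrite E, Cmod_mult, Cmod_R, Cmod_cis, Rmult_1_r. apply Rabs_pos_eq. left; apply exp_pos.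
Qed.

Lemma Cmod_Cpowr z r : Cmod (Cpowr z r) = Rpower (Cmod z) r.
Proof.
unfold Cpowr. rewrite Cmod_Cexp. unfold Rpower. f_equal.
rewrite Re_mult. unfold Clog. simpl. ring.
Qed.

Lemma Cmod_e z : Cmod (e z) = exp (- (2 * PI * Im z)).
Proof.
destruct z as [x y]. rewrite e_eq, Cmod_mult, Cmod_cis, Cmod_R, Rabs_pos_eq by (left; apply exp_pos).
simpl. ring.
Qed.

(** The automorphy factor cancels the change of the imaginary part. *)
Lemma height_slash r f s z : SL2Z s -> upper_half_plane z ->
  height r f (mobius s z) = Cmod (Cpowr (jden s z) (- r) * f (mobius s z))%C * Rpower (Im z) (r / 2).
Proof.
intros Hs Hz. unfold height. rewrite Im_mobius by assumption.
pose proof (Cmod_jden_gt0 s z Hs Hz) as Hp. unfold upper_half_plane in Hz.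
rewrite Cmod_mult, Cmod_Cpowr.
replace (Im z / Cmod (jden s z) ^ 2) with (Im z * Rpower (Cmod (jden s z)) (Ropp 2)).
- rewrite <- Rpower_mult_distr by (try apply Rpower_gt0; exact Hz).
  rewrite Rpower_mult. replace (Ropp 2 * (r / 2)) with (- r) by field. ring.
- rewrite Rpower_Ropp. unfold Rdiv. f_equal. f_equal.
  change 2 with (INR 2). now rewrite Rpower_pow.
Qed.

Lemma height_invariant G r m f g z : congruence_group G -> modular_form G r m f ->
  G g -> upper_half_plane z -> height r f (mobius g z) = height r f z.
Proof.
intros HG [[Hm1 _] [_ [_ Hf]]] Hg Hz.
assert (Hs : SL2Z g) by (apply HG; exact Hg).
rewrite height_slash by assumption. unfold height. rewrite (Hf g z Hg Hz).
rewrite !Cmod_mult, !Cmod_Cpowr, Hm1 by exact Hg.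
rewrite Rpower_Ropp. pose proof (Rpower_gt0 (Cmod (jden g z)) r). field. lra.
Qed.

(** g s^-1 lies in the principal congruence subgroup, hence in G. *)
Lemma height_congruent G r m f N g s z : congruence_group G ->
  (forall g, principal_congruence N g -> G g) -> modular_form G r m f ->
  SL2Z g -> SL2Z s -> congruent_mod N g s -> upper_half_plane z ->
  height r f (mobius g z) = height r f (mobius s z).
Proof.
intros HG HN Hf Hg Hs Hc Hz.
rewrite <- (mmul_quotient g s Hs) at 1.
rewrite mobius_mmul; [|apply SL2Z_mmul; [exact Hg|now apply SL2Z_minv]|exact Hs|exact Hz].
apply (height_invariant G r m f); [exact HG|exact Hf| |now apply mobius_upper].
now apply HN, congruent_quotient.
Qed.

Lemma is_Cseries_terms_bounded u l : is_Cseries u l -> exists B, 0 <= B /\ forall n, Cmod (u n) <= B.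
Proof.
intros H. destruct (is_Cseries_Re_Im u l H) as [H1 H2].
assert (Hb : forall v : nat -> R, ex_series v -> exists B, forall n, Rabs (v n) <= B).
{ intros v Hv. apply ex_series_lim_0 in Hv.
  destruct (filterlim_bounded (K := R_AbsRing) (V := R_NormedModule) v) as [B HB].
  - now exists 0.
  - exists B. exact HB. }
destruct (Hb _ (ex_intro _ _ H1)) as [B1 HB1]. destruct (Hb _ (ex_intro _ _ H2)) as [B2 HB2].
exists (B1 + B2). split.
- specialize (HB1 0%nat). specialize (HB2 0%nat).
  pose proof (Rabs_pos (Re (u 0%nat))). pose proof (Rabs_pos (Im (u 0%nat))). lra.
- intros n. specialize (HB1 n). specialize (HB2 n).
  eapply Rle_trans; [apply Cmod_le_Re_Im|]. lra.
Qed.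

(** Exponential decay of the expansion at a cusp: the exponents that occur with
    a nonzero coefficient are at least a positive multiple of n + 1. *)
Lemma height_bounded_at_cusp r f s : SL2Z s ->
  holomorphic_at_cusps r f -> vanishes_at_cusps r f ->
  exists B, forall z, / 2 <= Im z -> height r f (mobius s z) <= B.
Proof.
intros Hs Hhol Hvan.
destruct (Hhol s Hs) as (h & kappa & b & Hexp).
pose proof (Hvan s h kappa b Hs Hexp) as Hb0.
destruct Hexp as (Hh & Hk & Hser).
pose proof PI2_1 as HPI.
assert (HhR : 1 <= INR h) by (change 1 with (INR 1); apply le_INR; exact Hh).
destruct (is_Cseries_terms_bounded _ _ (Hser (0, / 4) ltac:(unfold upper_half_plane; simpl; lra)))
  as [B0 [HB0 HB]].
set (nu := if Req_EM_T kappa 0 then / 2 else kappa).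
assert (Hnu : 0 < nu) by (unfold nu; destruct Req_EM_T; lra).
assert (Hnun : forall n, b n <> RtoC 0 -> nu * (INR n + 1) <= INR n + kappa).
{ intros n Hn. pose proof (pos_INR n). unfold nu. destruct (Req_EM_T kappa 0) as [E|E].
  - destruct n as [|n]; [exfalso; apply Hn, Hb0, E|]. rewrite S_INR in *. pose proof (pos_INR n). lra.
  - assert (kappa * INR n <= 1 * INR n) by (apply Rmult_le_compat_r; lra). lra. }
set (c := PI * nu / INR h).
assert (Hc : 0 < c) by (unfold c; apply Rdiv_lt_0_compat; [apply Rmult_lt_0_compat|]; lra).
set (q := exp (- (c / 2))).
assert (Hq : 0 < q < 1).
{ unfold q; split; [apply exp_pos|]. rewrite <- exp_0. apply exp_increasing. lra. }
assert (Hterm : forall n z, / 2 <= Im z ->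
  Cmod (b n * e (RtoC ((INR n + kappa) / INR h) * z))%C <= B0 * exp (- (c * Im z)) * q ^ n).
{ intros n z Hz. specialize (HB n). pose proof (pos_INR n) as Hn.
  rewrite Cmod_mult, Cmod_e in HB |- *. rewrite !Im_mult in HB |- *. simpl in HB.
  change (Re (RtoC ?x)) with x. change (Im (RtoC ?x)) with 0.
  destruct (classic (b n = RtoC 0)) as [E|E].
  - rewrite E, Cmod_0, Rmult_0_l. apply Rmult_le_pos; [apply Rmult_le_pos; [exact HB0|left; apply exp_pos]|].
    left; now apply pow_lt.
  - specialize (Hnun n E).
    set (k := (INR n + kappa) / INR h) in *.
    assert (Hk' : nu * (INR n + 1) / INR h <= k).
    { unfold k, Rdiv. apply Rmult_le_compat_r; [left; apply Rinv_0_lt_compat; lra|exact Hnun]. }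
    assert (Hck : c * (INR n + 1) <= PI * k).
    { unfold c. replace (PI * nu / INR h * (INR n + 1)) with (PI * (nu * (INR n + 1) / INR h)) by (field; lra).
      apply Rmult_le_compat_l; lra. }
    replace (exp (- (2 * PI * (k * Im z + 0 * Re z)))) with
      (exp (- (2 * PI * (k * / 4 + 0 * 0))) * exp (- (2 * PI * k * (Im z - / 4))))
      by (rewrite <- exp_plus; f_equal; field).
    rewrite <- Rmult_assoc, (Rmult_assoc B0).
    apply Rmult_le_compat; [apply Rmult_le_pos; [apply Cmod_ge_0|left; apply exp_pos]
      |left; apply exp_pos|exact HB|].
    unfold q. rewrite <- (Rpower_pow n) by apply exp_pos. unfold Rpower. rewrite ln_exp, <- exp_plus.
    assert (Hfin : 2 * PI * k * (Im z - / 4) >= c * Im z + INR n * (c / 2)).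
    { set (t := Im z) in *.
      assert (Hpk : 0 <= c * (INR n + 1)) by (apply Rmult_le_pos; lra).
      assert (H1 : c * (INR n + 1) * t <= PI * k * (2 * (t - / 4)))
        by (apply Rmult_le_compat; lra).
      assert (H2 : c * INR n * / 2 <= c * INR n * t)
        by (apply Rmult_le_compat_l; [apply Rmult_le_pos|]; lra).
      apply Rle_ge. replace (2 * PI * k * (t - / 4)) with (PI * k * (2 * (t - / 4))) by ring.
      eapply Rle_trans; [|exact H1]. lra. }
    destruct (Rle_lt_or_eq_dec (- (2 * PI * k * (Im z - / 4))) (- (c * Im z) + INR n * - (c / 2)) ltac:(lra)) as [Hlt|Heq].
    + left. now apply exp_increasing.
    + right. now rewrite Heq. }
assert (Hgeo : ex_series (fun n => q ^ n)).
{ eexists. apply is_series_geom. rewrite Rabs_pos_eq; lra. }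
destruct (Rpower_exp_bounded (r / 2) (c / 2)) as [B1 [HB1 HB1']]; [lra|].
set (S0 := Series (fun n => q ^ n)).
assert (HS0 : 0 <= S0).
{ eapply Rle_trans; [|apply (sum_n_le_Series (fun n => q ^ n) 0)]; [rewrite sum_O; simpl; lra| |exact Hgeo].
  intros n; left; now apply pow_lt. }
exists (B0 * S0 * (Rpower (/ 2) (r / 2) * B1)). intros z Hz.
assert (Hzu : upper_half_plane z) by (unfold upper_half_plane; lra).
rewrite height_slash by assumption.
rewrite <- (is_Cseries_unique _ _ (Hser z Hzu)).
apply Rle_trans with (B0 * exp (- (c * Im z)) * S0 * Rpower (Im z) (r / 2)).
- apply Rmult_le_compat_r; [left; apply exp_pos|].
  unfold S0. rewrite <- Series_scal_l. apply Cmod_CSeries_le.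
  + intros n. now apply Hterm.
  + now apply (ex_series_scal (B0 * exp (- (c * Im z))) (fun n => q ^ n)).
- replace (Rpower (Im z) (r / 2)) with (Rpower (/ 2) (r / 2) * Rpower (2 * Im z) (r / 2))
    by (rewrite Rpower_mult_distr by lra; f_equal; field).
  replace (B0 * exp (- (c * Im z)) * S0 * (Rpower (/ 2) (r / 2) * Rpower (2 * Im z) (r / 2)))
    with (B0 * S0 * (Rpower (/ 2) (r / 2) * (Rpower (2 * Im z) (r / 2) * exp (- (c / 2 * (2 * Im z))))))
    by (replace (c / 2 * (2 * Im z)) with (c * Im z) by field; ring).
  apply Rmult_le_compat_l; [now apply Rmult_le_pos|].
  apply Rmult_le_compat_l; [left; apply exp_pos|]. apply HB1'. lra.
Qed.

(** Dirichlet's theorem with denominators up to y^(-1/2) brings every point above height 1/2,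
    and there the expansions at finitely many cusps apply. *)
Lemma cusp_form_height_bounded G r m f : congruence_group G -> cusp_form G r m f ->
  exists B, forall z, upper_half_plane z -> height r f z <= B.
Proof.
intros HG [Hmod Hvan].
destruct HG as [HG0 [N [HN HNG]]].
assert (HG : congruence_group G) by (split; [exact HG0|now exists N]).
destruct (residue_uniform_bound N
  (fun g B => forall z, / 2 <= Im z -> height r f (mobius g z) <= B) HN) as [B HB].
- intros g B B' H HB z Hz. eapply Rle_trans; [now apply H|exact HB].
- intros s Hs. destruct (height_bounded_at_cusp r f s Hs) as [B HB]; [apply Hmod|exact Hvan|].
  exists B. intros g Hg Hc z Hz.
  rewrite (height_congruent G r m f N g s z); try assumption; [now apply HB|].
  unfold upper_half_plane; lra.
- exists B. intros z Hz.
  destruct (Rle_dec (/ 2) (Im z)) as [H|H].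
  + rewrite <- (mobius_mone z). apply HB; [reflexivity|exact H].
  + destruct z as [x y]. unfold upper_half_plane in Hz. simpl in Hz, H.
    (* a denominator bound of the order of the inverse square root of y *)
    assert (Hs : 0 < sqrt y) by now apply sqrt_lt_R0.
    assert (Hss : sqrt y * sqrt y = y) by (apply sqrt_sqrt; lra).
    assert (Hs1 : sqrt y < 1) by nra.
    destruct (nfloor_ex (/ sqrt y)) as [n [Hn1 Hn2]]; [left; now apply Rinv_0_lt_compat|].
    assert (Hns : INR n * sqrt y <= 1).
    { apply (Rmult_le_compat_r (sqrt y)) in Hn1; [|lra]. rewrite Rinv_l in Hn1 by lra. lra. }
    assert (Hns2 : 1 < INR (S n) * sqrt y).
    { rewrite S_INR. apply (Rmult_lt_compat_r (sqrt y)) in Hn2; [|lra]. rewrite Rinv_l in Hn2 by lra. lra. }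
    assert (Hn : (1 <= n)%nat).
    { destruct n; [|lia]. simpl in Hns2. lra. }
    destruct (Dirichlet_unimodular x n Hn) as (p & q & u & v & Hq & Hdet & Happ).
    set (g := Mat2 p u q v).
    assert (Hg : SL2Z g) by (unfold SL2Z, mdet, g; simpl; lia).
    assert (Hz' : upper_half_plane (x, y)) by exact Hz.
    rewrite <- (mobius_minv_r g (x, y) Hg Hz').
    apply HB; [exact Hg|].
    rewrite Im_mobius by (try apply SL2Z_minv; assumption).
    pose proof (Cmod_jden_gt0 (minv g) (x, y) (SL2Z_minv g Hg) Hz') as Hp.
    apply pow_lt with (n := 2%nat) in Hp. rewrite jden_sq in *. simpl in Hp |- *.
    rewrite opp_IZR in *.
    assert (Hq1 : 1 <= IZR q) by (apply IZR_le; lia).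
    assert (Hq2 : IZR q <= INR n) by (rewrite INR_IZR_INZ; apply IZR_le; lia).
    assert (Hsq1 : (- IZR q * x + IZR p) ^ 2 <= y).
    { rewrite <- Rsqr_pow2.
      replace y with (Rsqr (sqrt y)) by exact Hss.
      apply Rsqr_le_abs_1. rewrite (Rabs_pos_eq (sqrt y)) by lra.
      rewrite <- Rabs_Ropp. replace (- (- IZR q * x + IZR p)) with (IZR q * x - IZR p) by ring.
      eapply Rle_trans; [exact Happ|]. apply (Rmult_le_reg_l (INR (S n))); [nra|].
      rewrite Rinv_r; nra. }
    assert (Hsq2 : (- IZR q * y) ^ 2 <= y).
    { assert (Eq : (IZR q * sqrt y) ^ 2 = IZR q ^ 2 * y)
        by (transitivity (IZR q ^ 2 * (sqrt y * sqrt y)); [ring|now rewrite Hss]).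
      replace ((- IZR q * y) ^ 2) with ((IZR q * sqrt y) ^ 2 * y) by (rewrite Eq; ring).
      assert (0 <= IZR q * sqrt y <= 1) by nra.
      assert ((IZR q * sqrt y) ^ 2 <= 1) by nra. nra. }
    apply (Rmult_le_reg_r ((- IZR q * x + IZR p) ^ 2 + (- IZR q * y) ^ 2)); [simpl; exact Hp|].
    unfold Rdiv. rewrite Rmult_assoc.
    simpl in Hsq1, Hsq2 |- *. rewrite Rinv_l by lra. lra.
Qed.

Lemma cusp_form_upper_bound G r m f : congruence_group G -> cusp_form G r m f ->
  exists B, 0 < B /\ forall z, upper_half_plane z -> Cmod (f z) <= B * Rpower (Im z) (- (r / 2)).
Proof.
intros HG Hf. destruct (cusp_form_height_bounded G r m f HG Hf) as [B HB].
exists (Rmax B 1). split; [apply Rlt_le_trans with 1; [lra|apply Rmax_r]|].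
intros z Hz. specialize (HB z Hz). unfold height in HB.
rewrite Rpower_Ropp. pose proof (Rpower_gt0 (Im z) (r / 2)) as Hp.
apply (Rmult_le_reg_r (Rpower (Im z) (r / 2))); [exact Hp|].
rewrite Rmult_assoc, Rinv_l, Rmult_1_r by lra.
eapply Rle_trans; [exact HB|apply Rmax_l].
Qed.

(** Near an irrational number the bound y^(-r/2) is sharp non-tangentially: the images of a
    fixed point under matrices with first column (p, q), p/q a good approximation,
    stay in a cone, and finitely many residue classes reduce these matrices
    to elements of the group. *)
Lemma cusp_form_lower_bound G r m f x0 : congruence_group G -> cusp_form G r m f ->
  (exists z, upper_half_plane z /\ f z <> RtoC 0) -> irrational x0 ->
  exists c0 D, 0 < c0 /\ 0 < D /\ forall eps, 0 < eps ->
    exists x y, 0 < y < eps /\ Rabs (x - x0) <= D * y /\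
      c0 * Rpower y (- (r / 2)) <= Cmod (f (x, y)).
Proof.
intros HG [Hmod _] [w0 [Hw0 Hfw0]] Hx0.
pose proof HG as [_ [N [HN HNG]]].
destruct (residue_uniform_bound N (fun g B => 1 <= B /\ exists w, / B <= Im w /\ Cmod w <= B /\
   height r f (mobius g w) = height r f w0) HN) as [B HB].
- intros g B B' [H1 [w [Hw1 [Hw2 Hw3]]]] HBB. split; [lra|]. exists w. split; [|split]; [|lra|exact Hw3].
  eapply Rle_trans; [|exact Hw1]. apply Rinv_le_contravar; lra.
- intros s Hs. set (w := mobius (minv s) w0).
  assert (Hw : upper_half_plane w) by (apply mobius_upper; [now apply SL2Z_minv|exact Hw0]).
  assert (Hiw : 0 < / Im w) by now apply Rinv_0_lt_compat.
  exists (Rmax 1 (Rmax (/ Im w) (Cmod w))). intros g Hg Hc. split; [apply Rmax_l|].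
  exists w. split; [|split].
  + apply Rle_trans with (/ / Im w); [|rewrite Rinv_inv; lra].
    apply Rinv_le_contravar; [exact Hiw|].
    eapply Rle_trans; [apply Rmax_l|apply Rmax_r].
  + eapply Rle_trans; [apply Rmax_r|apply Rmax_r].
  + rewrite (height_congruent G r m f N g s w); try assumption.
    unfold w. now rewrite mobius_minv_r.
- assert (HB1 : 1 <= B) by (apply (HB mone); reflexivity).
  assert (Hh0 : 0 < height r f w0).
  { apply Rmult_lt_0_compat; [now apply Cmod_gt_0|apply exp_pos]. }
  exists (height r f w0), (B * (B + 1) ^ 3). split; [exact Hh0|]. split.
  { apply Rmult_lt_0_compat; [lra|]. apply pow_lt. lra. }
  intros eps Heps.
  (* the denominators exceed B/eps, hence the ordinates B/q^2 are below eps *)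
  destruct (nfloor_ex (B / eps)) as [Q [HQ1 HQ2]]; [apply Rlt_le, Rdiv_lt_0_compat; lra|].
  destruct (irrational_denominators x0 (S Q) Hx0) as [n [Hn Hirr]].
  destruct (Dirichlet_unimodular x0 n Hn) as (p & q & u & v & Hq & Hdet & Happ).
  assert (HqQ : (Z.of_nat (S Q) < q)%Z).
  { apply Z.nle_gt. intros H. specialize (Hirr p q ltac:(lia)). lra. }
  set (g := Mat2 p (u - p * (v / q)) q (v - q * (v / q))).
  pose proof (Z.mod_pos_bound v q ltac:(lia)) as Hvq. rewrite Z.mod_eq in Hvq by lia.
  assert (Hg : SL2Z g) by (unfold SL2Z, mdet, g; simpl; nia).
  destruct (HB g Hg) as [_ [w [Hw1 [Hw2 Hw3]]]].
  assert (HiB : 0 < / B) by (apply Rinv_0_lt_compat; lra).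
  assert (Hw : upper_half_plane w) by (unfold upper_half_plane; lra).
  set (z := mobius g w). exists (Re z), (Im z).
  assert (Hz : upper_half_plane z) by now apply mobius_upper.
  set (V := IZR (v - q * (v / q))).
  assert (HV : 0 <= V <= IZR q) by (unfold V; split; apply IZR_le; lia).
  assert (Hq1 : 1 <= IZR q) by (apply IZR_le; lia).
  assert (Hq2 : IZR q <= INR n) by (rewrite INR_IZR_INZ; apply IZR_le; lia).
  assert (HqB : B / eps < IZR q).
  { eapply Rlt_le_trans; [exact HQ2|]. rewrite <- S_INR, INR_IZR_INZ. apply IZR_le. lia. }
  pose proof (Cmod_jden_gt0 g w Hg Hw) as HJ. set (J := Cmod (jden g w)) in *.
  assert (HJ1 : IZR q * Im w <= J).
  { unfold J. eapply Rle_trans; [|apply Rabs_Im_le]. unfold jden. rewrite Im_plus, Im_mult. simpl.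
    eapply Rle_trans; [|apply Rle_abs]. lra. }
  assert (HJ2 : J <= IZR q * (B + 1)).
  { unfold J, jden. eapply Rle_trans; [apply Cmod_triangle|].
    rewrite Cmod_mult, !Cmod_R. simpl mc; simpl md. fold V.
    rewrite !Rabs_pos_eq by lra. nra. }
  assert (HqIm : 0 < IZR q * Im w) by (apply Rmult_lt_0_compat; lra).
  assert (Hqq : 0 < / IZR q) by (apply Rinv_0_lt_compat; lra).
  assert (HImz : Im z = Im w / J ^ 2) by (apply Im_mobius; assumption).
  assert (HJB : / B * IZR q <= J).
  { eapply Rle_trans; [|exact HJ1]. rewrite Rmult_comm. apply Rmult_le_compat_l; lra. }
  assert (HBB : B * / B = 1) by (apply Rinv_r; lra).
  assert (HqBJ : IZR q <= B * J).
  { apply (Rmult_le_compat_l B) in HJB; [|lra]. rewrite <- Rmult_assoc, HBB in HJB. lra. }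
  assert (Hcone : Rabs (Re z - x0) <= (B + 1) * (/ IZR q) ^ 2).
  { replace (Re z - x0) with (Re (z - RtoC (IZR p / IZR q))%C + (IZR p / IZR q - x0))
      by (rewrite Re_minus; simpl; ring).
    eapply Rle_trans; [apply Rabs_triang|]. rewrite Rmult_plus_distr_r. apply Rplus_le_compat.
    - eapply Rle_trans; [apply Rabs_Re_le|].
      replace (z - RtoC (IZR p / IZR q))%C with (- / (RtoC (IZR q) * jden g w))%C.
      + rewrite Cmod_opp, Cmod_inv, Cmod_mult, Cmod_R, Rabs_pos_eq.
        * fold J. rewrite Rinv_mult. simpl. rewrite Rmult_1_r.
          rewrite (Rmult_comm B), Rmult_assoc. apply Rmult_le_compat_l; [lra|].
          apply (Rmult_le_reg_r (J * IZR q)); [apply Rmult_lt_0_compat; lra|].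
          field_simplify; lra.
        * lra.
        * apply Cmod_gt_0. rewrite Cmod_mult. apply Rmult_lt_0_compat; [|exact HJ].
          rewrite Cmod_R, Rabs_pos_eq; lra.
      + assert (Hjn : jden g w <> 0%C) by now apply jden_neq_0.
        assert (Hqn : RtoC (IZR q) <> 0%C) by (intros E; apply RtoC_inj in E; lra).
        unfold z, mobius. rewrite RtoC_div by lra.
        assert (Hgd : (RtoC (IZR (ma g)) * jden g w - (RtoC (IZR (ma g)) * w + RtoC (IZR (mb g))) * RtoC (IZR q) = 1)%C).
        { pose proof (SL2Z_det g Hg) as D. unfold jden.
          replace (RtoC 1) with (RtoC (IZR (ma g) * IZR (md g) - IZR (mb g) * IZR (mc g))) by now rewrite D.
          rewrite RtoC_minus, !RtoC_mult. change (mc g) with q. ring. }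
        change (IZR p) with (IZR (ma g)).
        transitivity (- (RtoC (IZR (ma g)) * jden g w - (RtoC (IZR (ma g)) * w + RtoC (IZR (mb g))) * RtoC (IZR q))
          / (RtoC (IZR q) * jden g w))%C.
        * rewrite Hgd. field. now split.
        * field. now split.
    - replace (IZR p / IZR q - x0) with (- ((IZR q * x0 - IZR p) * / IZR q)) by (field; lra).
      rewrite Rabs_Ropp, Rabs_mult, (Rabs_pos_eq (/ IZR q)) by lra.
      replace (1 * (/ IZR q) ^ 2) with (/ IZR q * / IZR q) by ring.
      apply Rmult_le_compat_r; [lra|]. eapply Rle_trans; [exact Happ|].
      apply Rinv_le_contravar; [lra|]. rewrite S_INR. lra. }
  assert (Hup : Im z <= B * (/ IZR q) ^ 2).
  { rewrite HImz. assert (HB2 : 0 < Im w) by exact Hw.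
    assert (Hup1 : Im w / J ^ 2 <= / J * / IZR q).
    { unfold Rdiv. rewrite <- pow_inv. simpl. rewrite Rmult_1_r, <- Rmult_assoc, (Rmult_comm _ (/ J)).
      apply Rmult_le_compat_l; [left; now apply Rinv_0_lt_compat|].
      apply (Rmult_le_reg_r (J * IZR q)); [apply Rmult_lt_0_compat; lra|]. field_simplify; lra. }
    eapply Rle_trans; [exact Hup1|]. simpl. rewrite Rmult_1_r, <- Rmult_assoc.
    apply Rmult_le_compat_r; [lra|].
    apply (Rmult_le_reg_r (J * IZR q)); [apply Rmult_lt_0_compat; lra|]. field_simplify; lra. }
  assert (Hlow : (/ IZR q) ^ 2 <= B * (B + 1) ^ 2 * Im z).
  { rewrite HImz.
    assert (HIB : 1 <= B * Im w) by (apply (Rmult_le_compat_l B) in Hw1; lra).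
    replace (B * (B + 1) ^ 2 * (Im w / J ^ 2)) with ((B * Im w) * ((B + 1) * / J) ^ 2) by (field; lra).
    assert (Hmid : / IZR q <= (B + 1) * / J).
    { apply (Rmult_le_reg_r (J * IZR q)); [apply Rmult_lt_0_compat; lra|]. field_simplify; lra. }
    assert ((/ IZR q) ^ 2 <= ((B + 1) * / J) ^ 2) by (apply pow_incr; lra).
    assert (0 <= ((B + 1) * / J) ^ 2) by apply pow2_ge_0. nra. }
  split; [split|split].
  + exact Hz.
  + eapply Rle_lt_trans; [exact Hup|].
    simpl. rewrite Rmult_1_r.
    assert (HBq : B * / IZR q < eps).
    { apply (Rmult_lt_reg_r (IZR q)); [lra|]. rewrite Rmult_assoc, Rinv_l by lra.
      apply (Rmult_lt_compat_r eps) in HqB; [|lra]. unfold Rdiv in HqB.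
      rewrite Rmult_assoc, Rinv_l in HqB by lra. lra. }
    assert (/ IZR q <= 1) by (rewrite <- Rinv_1; apply Rinv_le_contravar; lra).
    rewrite <- Rmult_assoc. nra.
  + eapply Rle_trans; [exact Hcone|].
    replace (B * (B + 1) ^ 3 * Im z) with ((B + 1) * (B * (B + 1) ^ 2 * Im z)) by ring.
    apply Rmult_le_compat_l; lra.
  + rewrite <- Hw3. fold z. unfold height. rewrite Rmult_assoc, <- Rpower_plus.
    replace (r / 2 + - (r / 2)) with 0 by ring. rewrite Rpower_O by exact Hz.
    destruct z. simpl. lra.
Qed.

(** * Analytic kernels on the circle *)

(** ** Integrals of complex-valued functions *)

Definition ccont (h : R -> C) (x : R) : Prop :=
  continuous (fun v => Re (h v)) x /\ continuous (fun v => Im (h v)) x.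

Definition is_CInt (h : R -> C) (a b : R) (l : C) : Prop :=
  is_RInt (fun v => Re (h v)) a b (Re l) /\ is_RInt (fun v => Im (h v)) a b (Im l).

Lemma ccont_ext g h x : (forall v, g v = h v) -> ccont g x -> ccont h x.
Proof.
intros E [H1 H2]; split.
- apply (continuous_ext (fun v => Re (g v))); [intros v; now rewrite E|exact H1].
- apply (continuous_ext (fun v => Im (g v))); [intros v; now rewrite E|exact H2].
Qed.

Lemma ccont_plus g h x : ccont g x -> ccont h x -> ccont (fun v => g v + h v)%C x.
Proof.
intros [G1 G2] [H1 H2]; split.
- exact (continuous_plus (V := R_NormedModule) (fun v => Re (g v)) (fun v => Re (h v)) x G1 H1).
- exact (continuous_plus (V := R_NormedModule) (fun v => Im (g v)) (fun v => Im (h v)) x G2 H2).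
Qed.

Lemma ccont_mult g h x : ccont g x -> ccont h x -> ccont (fun v => g v * h v)%C x.
Proof.
intros [G1 G2] [H1 H2]; split.
- apply (continuous_minus (V := R_NormedModule) (fun v => Re (g v) * Re (h v)) (fun v => Im (g v) * Im (h v)));
    apply (continuous_mult (K := R_AbsRing)); assumption.
- apply (continuous_plus (V := R_NormedModule) (fun v => Re (g v) * Im (h v)) (fun v => Im (g v) * Re (h v)));
    apply (continuous_mult (K := R_AbsRing)); assumption.
Qed.

Lemma ccont_const (c : C) x : ccont (fun _ => c) x.
Proof. split; apply continuous_const. Qed.

Lemma ccont_cis k x : ccont (fun v => cis (k * v)) x.
Proof.
split; unfold cis; simpl; apply (ex_derive_continuous (V := R_NormedModule)); now auto_derive.
Qed.

Lemma ccont_comp_aff h k c x : ccont h (k * x + c) -> ccont (fun v => h (k * v + c)) x.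
Proof.
intros [H1 H2]; split.
- apply (continuous_comp (fun v => k * v + c) (fun v => Re (h v))); [|exact H1].
  apply (ex_derive_continuous (V := R_NormedModule)). now auto_derive.
- apply (continuous_comp (fun v => k * v + c) (fun v => Im (h v))); [|exact H2].
  apply (ex_derive_continuous (V := R_NormedModule)). now auto_derive.
Qed.

Lemma is_CInt_ext g h a b l : (forall v, g v = h v) -> is_CInt g a b l -> is_CInt h a b l.
Proof.
intros E [H1 H2]; split.
- apply (is_RInt_ext (fun v => Re (g v))); [intros v _; now rewrite E|exact H1].
- apply (is_RInt_ext (fun v => Im (g v))); [intros v _; now rewrite E|exact H2].
Qed.

Lemma is_CInt_plus g h a b l m : is_CInt g a b l -> is_CInt h a b m ->
  is_CInt (fun v => g v + h v)%C a b (l + m)%C.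
Proof. intros [G1 G2] [H1 H2]; split; now apply (is_RInt_plus (V := R_NormedModule)). Qed.

Lemma is_CInt_scal (c : C) h a b l : is_CInt h a b l ->
  is_CInt (fun v => c * h v)%C a b (c * l)%C.
Proof.
intros [H1 H2]; split.
- apply (is_RInt_minus (V := R_NormedModule) (fun v => Re c * Re (h v)) (fun v => Im c * Im (h v)));
    now apply (is_RInt_scal (V := R_NormedModule)).
- apply (is_RInt_plus (V := R_NormedModule) (fun v => Re c * Im (h v)) (fun v => Im c * Re (h v)));
    now apply (is_RInt_scal (V := R_NormedModule)).
Qed.

Lemma is_CInt_sum_n (F : nat -> R -> C) (I : nat -> C) a b N :
  (forall n, is_CInt (F n) a b (I n)) ->
  is_CInt (fun v => sum_n (fun n => F n v) N) a b (sum_n I N).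
Proof.
intros H. induction N as [|N IH].
- rewrite sum_O. eapply is_CInt_ext; [|apply (H 0%nat)]. intros v. now rewrite sum_O.
- rewrite sum_Sn. eapply is_CInt_ext; [|apply is_CInt_plus; [exact IH|apply (H (S N))]].
  intros v. now rewrite sum_Sn.
Qed.

Lemma is_CInt_exists h a b : a <= b -> (forall x, a <= x <= b -> ccont h x) ->
  exists l, is_CInt h a b l.
Proof.
intros Hab Hc.
exists (RInt (fun v => Re (h v)) a b, RInt (fun v => Im (h v)) a b).
split; apply (RInt_correct (V := R_CompleteNormedModule)), ex_RInt_cont; try exact Hab;
  intros; now apply Hc.
Qed.

Lemma is_CInt_bound h (g : R -> R) a b l lg : a <= b -> is_CInt h a b l -> is_RInt g a b lg ->
  (forall v, a <= v <= b -> Cmod (h v) <= g v) -> Cmod l <= lg.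
Proof.
intros Hab Hl Hg H. apply Cmod_le_rotations. intros th Hth.
destruct (is_CInt_scal th h a b l Hl) as [H1 _].
apply (is_RInt_le (fun v => Re (th * h v)%C) g a b); [exact Hab|exact H1|exact Hg|].
intros v Hv. eapply Rle_trans; [apply Rle_abs|]. eapply Rle_trans; [apply (Rabs_Re_le (th * h v)%C)|].
rewrite Cmod_mult, Hth, Rmult_1_l. apply H. lra.
Qed.

Lemma cis_Z k : cis (IZR k * / 2) = cis (IZR k * - / 2).
Proof.
unfold cis.
replace (2 * PI * (IZR k * / 2)) with (IZR k * PI) by field.
replace (2 * PI * (IZR k * - / 2)) with (- (IZR k * PI)) by field.
rewrite cos_neg, sin_neg. f_equal.
rewrite (sin_eq_0_1 (IZR k * PI)) by now exists k. ring.
Qed.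

Lemma is_CInt_cis (k : Z) :
  is_CInt (fun v => cis (IZR k * v)) (- / 2) (/ 2) (if Z.eq_dec k 0 then 1 else 0)%C.
Proof.
destruct (Z.eq_dec k 0) as [->|Hk].
- apply is_CInt_ext with (fun _ => 1%C); [intros v; now rewrite Rmult_0_l, cis_0|].
  assert (Hc : forall c : R, is_RInt (fun _ => c) (- / 2) (/ 2) c).
  { intros c. assert (E : (/ 2 - - / 2) * c = c) by field.
    exact (eq_ind _ (fun l : R => is_RInt (fun _ => c) (- / 2) (/ 2) l)
      (is_RInt_const (V := R_NormedModule) (- / 2) (/ 2) c) _ E). }
  split; apply Hc.
- assert (Hk' : IZR k <> 0) by now apply not_0_IZR.
  pose proof PI_neq0 as HPI.
  pose proof (cis_Z k) as E. unfold cis in E. injection E as Ec Es.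
  split; unfold cis; simpl.
  + replace 0 with (minus (sin (2 * PI * (IZR k * / 2)) / (2 * PI * IZR k)) (sin (2 * PI * (IZR k * - / 2)) / (2 * PI * IZR k)))
      by (rewrite Es; unfold minus, plus, opp; simpl; ring).
    apply (is_RInt_derive (V := R_CompleteNormedModule) (fun v => sin (2 * PI * (IZR k * v)) / (2 * PI * IZR k))).
    * intros x _. auto_derive; [trivial|]. field. split; assumption.
    * intros x _. apply (ex_derive_continuous (V := R_NormedModule)). now auto_derive.
  + replace 0 with (minus (- cos (2 * PI * (IZR k * / 2)) / (2 * PI * IZR k)) (- cos (2 * PI * (IZR k * - / 2)) / (2 * PI * IZR k)))
      by (rewrite Ec; unfold minus, plus, opp; simpl; ring).
    apply (is_RInt_derive (V := R_CompleteNormedModule) (fun v => - cos (2 * PI * (IZR k * v)) / (2 * PI * IZR k))).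
    * intros x _. auto_derive; [trivial|]. field. split; assumption.
    * intros x _. apply (ex_derive_continuous (V := R_NormedModule)). now auto_derive.
Qed.

Lemma continuous_Series (F : nat -> R -> R) M x : ex_series M ->
  (forall n v, Rabs (F n v) <= M n) -> (forall n, continuous (F n) x) ->
  continuous (fun v => Series (fun n => F n v)) x.
Proof.
intros HM HF Hc. apply filterlim_locally. intros eps.
pose proof (is_lim_seq_tail M HM) as Ht. apply is_lim_seq_spec in Ht.
destruct (Ht (mkposreal (eps / 3) ltac:(destruct eps; simpl; lra))) as [N HN].
specialize (HN N (le_n N)). simpl in HN. apply Rabs_def2 in HN.
pose proof (continuous_sum_n F N x Hc) as HcN.
assert (HcN' := proj1 (filterlim_locally _ _) HcN (mkposreal (eps / 3) ltac:(destruct eps; simpl; lra))).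
apply filter_imp with (2 := HcN'). intros v Hv.
change (Rabs (sum_n (fun n => F n v) N - sum_n (fun n => F n x) N) < eps / 3) in Hv.
change (Rabs (Series (fun n => F n v) - Series (fun n => F n x)) < eps).
pose proof (Series_tail_bound (fun n => F n v) M N (fun n => HF n v) HM) as H1.
pose proof (Series_tail_bound (fun n => F n x) M N (fun n => HF n x) HM) as H2.
apply Rabs_def2 in Hv. apply Rabs_le_between in H1. apply Rabs_le_between in H2.
apply Rabs_def1; lra.
Qed.

Lemma ccont_CSeries (F : nat -> R -> C) M x : ex_series M ->
  (forall n v, Cmod (F n v) <= M n) -> (forall n, ccont (F n) x) ->
  ccont (fun v => CSeries (fun n => F n v)) x.
Proof.
intros HM HF Hc. split.
- apply (continuous_Series (fun n v => Re (F n v)) M); [exact HM| |intros n; apply Hc].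
  intros n v. eapply Rle_trans; [apply Rabs_Re_le|apply HF].
- apply (continuous_Series (fun n v => Im (F n v)) M); [exact HM| |intros n; apply Hc].
  intros n v. eapply Rle_trans; [apply Rabs_Im_le|apply HF].
Qed.

Lemma is_CInt_CSeries (F : nat -> R -> C) (I : nat -> C) M a b : a <= b -> ex_series M ->
  (forall n v, Cmod (F n v) <= M n) -> (forall n v, ccont (F n) v) ->
  (forall n, is_CInt (F n) a b (I n)) -> (forall n, Cmod (I n) <= M n) ->
  is_CInt (fun v => CSeries (fun n => F n v)) a b (CSeries I).
Proof.
intros Hab HM HF Hc HI HIM.
destruct (is_CInt_exists (fun v => CSeries (fun n => F n v)) a b Hab) as [l Hl].
{ intros x _. now apply (ccont_CSeries F M). }
replace (CSeries I) with l; [exact Hl|].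
assert (H0 : Cmod (l - CSeries I)%C <= 0).
{ apply (is_lim_seq_le_lim (fun _ => Cmod (l - CSeries I)%C) (fun N => (b - a + 1) * tail M N)).
  - apply is_lim_seq_const.
  - replace (Finite 0) with (Rbar_mult (b - a + 1) 0) by (simpl; f_equal; ring).
    apply is_lim_seq_scal_l. now apply is_lim_seq_tail.
  - intros N. replace (l - CSeries I)%C with ((l - sum_n I N) - (CSeries I - sum_n I N))%C by ring.
    eapply Rle_trans; [apply Cmod_triangle|]. rewrite Cmod_opp.
    pose proof (CSeries_tail_bound I M N HIM HM) as H1.
    assert (H2 : Cmod (l - sum_n I N)%C <= (b - a) * tail M N).
    { apply (is_CInt_bound (fun v => CSeries (fun n => F n v) + (- (1)) * sum_n (fun n => F n v) N)%C
        (fun _ => tail M N) a b); [exact Hab| | |].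
      - replace (l - sum_n I N)%C with (l + (- (1)) * sum_n I N)%C by ring.
        apply is_CInt_plus; [exact Hl|]. apply is_CInt_scal. now apply is_CInt_sum_n.
      - apply (is_RInt_const (V := R_NormedModule)).
      - intros v _. replace (CSeries (fun n => F n v) + (- (1)) * sum_n (fun n => F n v) N)%C
          with (CSeries (fun n => F n v) - sum_n (fun n => F n v) N)%C by ring.
        apply CSeries_tail_bound; [intros n; apply HF|exact HM]. }
    lra. }
assert (E : (l - CSeries I)%C = (RtoC 0)).
{ apply Cmod_eq_0. pose proof (Cmod_ge_0 (l - CSeries I)%C). lra. }
replace l with ((l - CSeries I) + CSeries I)%C by ring. rewrite E. ring.
Qed.

Lemma sum_n_single (c : nat -> C) m N :
  sum_n (fun n => if Nat.eq_dec n m then c n else RtoC 0) N = if le_dec m N then c m else RtoC 0.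
Proof.
induction N as [|N IH].
- rewrite sum_O. destruct (Nat.eq_dec 0 m) as [E|E], (le_dec m 0); try lia; [now rewrite E|reflexivity].
- rewrite sum_Sn, IH. change (@plus C_AbelianMonoid) with Cplus.
  match goal with |- ?x = ?y => change (@eq C x y) end.
  destruct (Nat.eq_dec (S N) m) as [<-|Hne].
  + destruct (le_dec (S N) N), (le_dec (S N) (S N)); try lia. ring.
  + destruct (le_dec m N), (le_dec m (S N)); try lia; ring.
Qed.

Lemma CSeries_single (c : nat -> C) m :
  CSeries (fun n => if Nat.eq_dec n m then c n else (RtoC 0)) = c m.
Proof.
assert (H : forall (p : C -> R), p (RtoC 0) = 0 ->
  (forall (u : nat -> C) N, p (sum_n u N) = sum_n (fun n => p (u n)) N) ->
  Series (fun n => p (if Nat.eq_dec n m then c n else (RtoC 0))) = p (c m)).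
{ intros p Hp0 Hp. apply is_series_unique.
  change (is_lim_seq (sum_n (fun n => p (if Nat.eq_dec n m then c n else (RtoC 0)))) (p (c m))).
  apply is_lim_seq_ext_loc with (fun _ => p (c m)); [|apply is_lim_seq_const].
  exists m. intros N HN. rewrite <- Hp, sum_n_single. destruct (le_dec m N); [reflexivity|lia]. }
unfold CSeries. rewrite (H Re), (H Im); [now destruct (c m)|reflexivity|apply Im_sum_n|reflexivity|apply Re_sum_n].
Qed.

Lemma Fourier_coefficient (u : nat -> C) m : Csummable u ->
  is_CInt (fun v => CSeries (fun n => u n * cis (freq n * v)) * cis (- (freq m * v)))%C (- / 2) (/ 2) (u m).
Proof.
intros Hu.
apply is_CInt_ext with (fun v => CSeries (fun n => u n * cis (IZR (Z.of_nat n - Z.of_nat m) * v))%C).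
{ intros v. rewrite Cmult_comm, <- CSeries_scal.
  - apply CSeries_ext. intros n. rewrite minus_IZR, <- !INR_IZR_INZ.
    replace ((INR n - INR m) * v) with (- (freq m * v) + freq n * v)
      by (unfold freq; rewrite !S_INR; ring).
    rewrite cis_plus. ring.
  - apply Csummable_dom with (fun n => Cmod (u n)); [|exact Hu].
    intros n. rewrite Cmod_mult, Cmod_cis. lra. }
rewrite <- (CSeries_single u m) at 1.
apply (is_CInt_CSeries _ _ (fun n => Cmod (u n))).
- lra.
- exact Hu.
- intros n v. rewrite Cmod_mult, Cmod_cis. lra.
- intros n v. apply ccont_mult; [apply ccont_const|].
  apply ccont_cis.
- intros n. replace (if Nat.eq_dec n m then u n else (RtoC 0)) with
    (u n * (if Z.eq_dec (Z.of_nat n - Z.of_nat m) 0 then 1 else 0))%C.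
  + apply is_CInt_scal, is_CInt_cis.
  + destruct (Nat.eq_dec n m), (Z.eq_dec (Z.of_nat n - Z.of_nat m) 0); try lia; ring.
- intros n. destruct (Nat.eq_dec n m); [lra|rewrite Cmod_0; apply Cmod_ge_0].
Qed.

Lemma Fourier_coefficient_neg (u : nat -> C) m : Csummable u ->
  is_CInt (fun v => CSeries (fun n => u n * cis (- (freq n * v))) * cis (- (freq m * v)))%C (- / 2) (/ 2) (RtoC 0).
Proof.
intros Hu.
apply is_CInt_ext with (fun v => CSeries (fun n => u n * cis (IZR (- (Z.of_nat (S n) + Z.of_nat (S m))) * v))%C).
{ intros v. rewrite Cmult_comm, <- CSeries_scal.
  - apply CSeries_ext. intros n. rewrite opp_IZR, plus_IZR, <- !INR_IZR_INZ.
    replace (- (INR (S n) + INR (S m)) * v) with (- (freq m * v) + - (freq n * v))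
      by (unfold freq; ring).
    rewrite cis_plus. ring.
  - apply Csummable_dom with (fun n => Cmod (u n)); [|exact Hu].
    intros n. rewrite Cmod_mult, Cmod_cis. lra. }
replace (RtoC 0) with (CSeries (fun n => (RtoC 0))).
2:{ etransitivity; [|apply (CSeries_single (fun _ => RtoC 0) 0)]. apply CSeries_ext.
    intros n. now destruct (Nat.eq_dec n 0). }
apply (is_CInt_CSeries _ _ (fun n => Cmod (u n))).
- lra.
- exact Hu.
- intros n v. rewrite Cmod_mult, Cmod_cis. lra.
- intros n v. apply ccont_mult; [apply ccont_const|].
  apply ccont_cis.
- intros n. replace (RtoC 0) with
    (u n * (if Z.eq_dec (- (Z.of_nat (S n) + Z.of_nat (S m))) 0 then 1 else 0))%C.
  + apply is_CInt_scal, is_CInt_cis.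
  + destruct (Z.eq_dec (- (Z.of_nat (S n) + Z.of_nat (S m))) 0); [lia|ring].
- intros n. rewrite Cmod_0. apply Cmod_ge_0.
Qed.

(** ** Power series with polynomial coefficients *)

(** Degree at most k is expressed by constant k-th differences, the form in which summation
    by parts consumes it. *)
Fixpoint polyseq (k : nat) (p : nat -> R) : Prop :=
  match k with
  | O => forall n, p n = p 0%nat
  | S k' => polyseq k' (fun n => p (S n) - p n)
  end.

Lemma polyseq_ext k : forall p p', (forall n, p n = p' n) -> polyseq k p -> polyseq k p'.
Proof.
induction k as [|k IH]; simpl; intros p p' E H.
- intros n. rewrite <- !E. apply H.
- apply (IH (fun n => p (S n) - p n)); [|exact H]. intros n. now rewrite !E.
Qed.

Lemma polyseq_plus k : forall p p', polyseq k p -> polyseq k p' -> polyseq k (fun n => p n + p' n).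
Proof.
induction k as [|k IH]; simpl; intros p p' H H'.
- intros n. now rewrite H, H'.
- eapply polyseq_ext; [|apply (IH _ _ H H')]. intros n; simpl; ring.
Qed.

Lemma polyseq_shift k : forall p, polyseq k p -> polyseq k (fun n => p (S n)).
Proof.
induction k as [|k IH]; simpl; intros p H.
- intros n. now rewrite (H (S n)), (H 1%nat).
- apply (IH _ H).
Qed.

Lemma polyseq_S k : forall p, polyseq k p -> polyseq (S k) p.
Proof.
induction k as [|k IH]; intros p H.
- simpl in *. intros n. rewrite (H (S n)), (H n), (H 1%nat). ring.
- apply (IH _ H).
Qed.

Lemma polyseq_mult_n k : forall p, polyseq k p -> polyseq (S k) (fun n => INR n * p n).
Proof.
induction k as [|k IH]; intros p H.
- simpl in H. change (forall n, INR (S n) * p (S n) - INR n * p n = INR 1 * p 1%nat - INR 0 * p 0%nat).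
  intros n. rewrite (H (S n)), (H n), (H 1%nat), S_INR. simpl. ring.
- change (polyseq (S k) (fun n => INR (S n) * p (S n) - INR n * p n)).
  apply (polyseq_ext (S k)) with (p := fun n => INR n * (p (S n) - p n) + p (S n)).
  + intros n. rewrite S_INR. ring.
  + apply polyseq_plus; [apply IH, H|apply (polyseq_shift (S k)), H].
Qed.

Lemma polyseq_freq_pow k : polyseq k (fun n => freq n ^ k).
Proof.
induction k as [|k IH]; [simpl; reflexivity|].
eapply polyseq_ext with (p := fun n => INR n * freq n ^ k + freq n ^ k).
- intros n. unfold freq. rewrite S_INR. simpl. ring.
- apply polyseq_plus; [now apply polyseq_mult_n|now apply polyseq_S].
Qed.

Lemma polyseq_growth k : forall p, polyseq k p -> exists B, 0 <= B /\ forall n, Rabs (p n) <= B * freq n ^ k.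
Proof.
induction k as [|k IH]; intros p H.
- exists (Rabs (p 0%nat)). split; [apply Rabs_pos|]. intros n. rewrite (H n). simpl. lra.
- destruct (IH _ H) as [B [HB HBn]]. exists (Rabs (p 0%nat) + B).
  pose proof (Rabs_pos (p 0%nat)) as H0. split; [lra|].
  assert (Hn : forall n, Rabs (p n) <= Rabs (p 0%nat) + INR n * (B * freq n ^ k)).
  { induction n as [|n IHn]; [simpl; lra|].
    replace (p (S n)) with ((p (S n) - p n) + p n) by ring.
    eapply Rle_trans; [apply Rabs_triang|]. specialize (HBn n).
    assert (Hm : freq n ^ k <= freq (S n) ^ k).
    { apply pow_incr. unfold freq. rewrite !S_INR. pose proof (pos_INR n). lra. }
    assert (B * freq n ^ k <= B * freq (S n) ^ k) by now apply Rmult_le_compat_l.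
    rewrite S_INR. pose proof (pos_INR n).
    assert (INR n * (B * freq n ^ k) <= INR n * (B * freq (S n) ^ k)) by now apply Rmult_le_compat_l.
    lra. }
  intros n. eapply Rle_trans; [apply Hn|]. simpl.
  pose proof (freq_ge1 n) as Hf. pose proof (pos_INR n).
  assert (Hp1 : 1 <= freq n ^ k) by now apply pow_R1_Rle.
  assert (INR n = freq n - 1) by (unfold freq; rewrite S_INR; ring).
  assert (Hff : 1 <= freq n * freq n ^ k) by nra.
  assert (INR n * (B * freq n ^ k) <= B * (freq n * freq n ^ k)) by nra. nra.
Qed.

Lemma exp_INR_mult n a : exp (INR n * a) = exp a ^ n.
Proof.
induction n as [|n IH]; [simpl; now rewrite Rmult_0_l, exp_0|].
rewrite S_INR, Rmult_plus_distr_r, Rmult_1_l, exp_plus, IH. simpl. ring.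
Qed.

Lemma exp_neg_lt_1 a : 0 < a -> exp (- a) < 1.
Proof. intros. rewrite <- exp_0. apply exp_increasing. lra. Qed.

Lemma is_lim_seq_wgt g y : 0 < y -> is_lim_seq (wgt g y) 0.
Proof.
intros Hy. destruct (wgt_bounded g (y / 2)) as [B [HB H]]; [lra|].
set (q := exp (- (PI * y))).
assert (Hq : 0 < q < 1).
{ split; [apply exp_pos|]. apply exp_neg_lt_1. pose proof PI_RGT_0. nra. }
apply is_lim_seq_le_le with (u := fun _ => 0) (w := fun n => B * q ^ S n).
- intros n; split; [left; apply wgt_gt0|]. specialize (H n).
  unfold q. rewrite <- exp_INR_mult. fold (freq n).
  replace (wgt g y n) with (wgt g (y / 2) n * exp (freq n * - (PI * y))).
  + apply Rmult_le_compat_r; [left; apply exp_pos|exact H].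
  + unfold wgt. rewrite Rmult_assoc, <- exp_plus. f_equal. f_equal. field.
- apply is_lim_seq_const.
- replace (Finite 0) with (Rbar_mult B 0) by (simpl; f_equal; ring).
  apply is_lim_seq_scal_l. apply (is_lim_seq_incr_1 (fun n => q ^ n)).
  apply is_lim_seq_geom. rewrite Rabs_pos_eq; lra.
Qed.

(** The modulus of e(x + iy). *)
Definition qexp (y : R) : R := exp (- (2 * PI * y)).

Lemma polyseq_wgt_lim k p y : polyseq k p -> 0 < y ->
  is_lim_seq (fun n => Rabs (p n) * qexp y ^ S n) 0.
Proof.
intros Hp Hy. destruct (polyseq_growth k p Hp) as [B [HB H]].
apply is_lim_seq_le_le with (u := fun _ => 0) (w := fun n => B * wgt (INR k) y n).
- intros n. assert (Hq : 0 < qexp y ^ S n) by (apply pow_lt, exp_pos). split.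
  + apply Rmult_le_pos; [apply Rabs_pos|lra].
  + unfold wgt. rewrite <- Rmult_assoc, Rpower_pow by (pose proof (freq_ge1 n); lra).
    replace (exp (- (2 * PI * freq n * y))) with (qexp y ^ S n).
    * apply Rmult_le_compat_r; [lra|apply H].
    * unfold qexp. rewrite <- exp_INR_mult. f_equal. unfold freq. ring.
- apply is_lim_seq_const.
- replace (Finite 0) with (Rbar_mult B 0) by (simpl; f_equal; ring).
  apply is_lim_seq_scal_l. now apply is_lim_seq_wgt.
Qed.

Lemma qexp_range y : 0 < y -> 0 < qexp y < 1.
Proof.
intros Hy. split; [apply exp_pos|]. apply exp_neg_lt_1. pose proof PI_RGT_0. nra.
Qed.

(** Summation by parts, once for each unit of the degree.  The constant depends on
    neither y nor z; only the boundary terms, which vanish in the limit, depend on y. *)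
Lemma polyseq_kernel_bound k : forall p, polyseq k p ->
  exists K, 0 <= K /\ forall y, 0 < y -> exists ep : nat -> R, is_lim_seq ep 0 /\
    forall z, Cmod z = qexp y -> forall M,
      Cmod (1 - z)%C ^ S k * Cmod (sum_n (fun n => RtoC (p n) * z ^ S n)%C M) <= K + ep M.
Proof.
assert (Hz2 : forall y z, 0 < y -> Cmod z = qexp y -> Cmod (1 - z)%C <= 2).
{ intros y z Hy Hz. eapply Rle_trans; [apply Cmod_triangle|].
  rewrite Cmod_opp, Cmod_1, Hz. pose proof (qexp_range y Hy). lra. }
induction k as [|k IH]; intros p Hp.
- exists (2 * Rabs (p 0%nat)). pose proof (Rabs_pos (p 0%nat)) as H0. split; [lra|].
  intros y Hy. exists (fun _ => 0). split; [apply is_lim_seq_const|]. intros z Hz M.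
  rewrite pow_1, <- Cmod_mult.
  replace ((1 - z) * sum_n (fun n => RtoC (p n) * z ^ S n) M)%C with (RtoC (p 0%nat) * (z - z ^ S (S M)))%C.
  + rewrite Cmod_mult, Cmod_R, Rplus_0_r, Rmult_comm. apply Rmult_le_compat_r; [exact H0|].
    eapply Rle_trans; [apply Cmod_triangle|]. rewrite Cmod_opp, Cmod_pow, Hz.
    pose proof (qexp_range y Hy).
    assert (qexp y ^ S (S M) <= 1) by (rewrite <- (pow1 (S (S M))); apply pow_incr; lra). lra.
  + induction M as [|M IHM].
    * rewrite sum_O. simpl. ring.
    * rewrite sum_Sn. unfold plus; simpl AbelianMonoid.plus.
      change (RtoC (p 0%nat) * (z - z ^ S (S (S M))) = (1 - z) * (sum_n (fun n => RtoC (p n) * z ^ S n) M + RtoC (p (S M)) * z ^ S (S M)))%C.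
      rewrite Cmult_plus_distr_l, <- IHM, (Hp (S M)). simpl. ring.
- destruct (IH _ Hp) as [K [HK HKy]].
  exists (2 ^ S k * Rabs (p 0%nat) + K). pose proof (Rabs_pos (p 0%nat)) as H0.
  assert (H2k : 0 < 2 ^ S k) by (apply pow_lt; lra).
  split; [nra|]. intros y Hy. destruct (HKy y Hy) as [ep [Hep HKe]].
  exists (fun M => ep M + 2 ^ S k * (Rabs (p (S M)) * qexp y ^ S (S M))). split.
  { replace (Finite 0) with (Finite (0 + 0)) by (f_equal; ring).
    apply is_lim_seq_plus'; [exact Hep|].
    replace (Finite 0) with (Rbar_mult (2 ^ S k) 0) by (simpl; f_equal; ring).
    apply is_lim_seq_scal_l. apply (is_lim_seq_incr_1 (fun n => Rabs (p n) * qexp y ^ S n)).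
    now apply (polyseq_wgt_lim (S k)). }
  intros z Hz M. specialize (HKe z Hz M). pose proof (qexp_range y Hy) as Hq.
  set (D := sum_n (fun n => RtoC (p (S n) - p n) * z ^ S n)%C M) in *.
  assert (E : ((1 - z) * sum_n (fun n => RtoC (p n) * z ^ S n) M =
     z * (RtoC (p 0%nat) + D) - RtoC (p (S M)) * z ^ S (S M))%C).
  { unfold D. clear. induction M as [|M IHM].
    - rewrite !sum_O, RtoC_minus. simpl. ring.
    - rewrite !sum_Sn.
      change (((1 - z) * (sum_n (fun n => RtoC (p n) * z ^ S n) M + RtoC (p (S M)) * z ^ S (S M)))%C =
        (z * (RtoC (p 0%nat) + (sum_n (fun n => RtoC (p (S n) - p n) * z ^ S n) M + RtoC (p (S (S M)) - p (S M)) * z ^ S (S M))) - RtoC (p (S (S M))) * z ^ S (S (S M)))%C).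
      rewrite Cmult_plus_distr_l, IHM, RtoC_minus. simpl. ring. }
  set (X := Cmod (1 - z)%C) in *. pose proof (Cmod_ge_0 (1 - z)%C) as HX0. fold X in HX0.
  pose proof (Hz2 y z Hy Hz) as HX2. fold X in HX2.
  replace (X ^ S (S k) * Cmod (sum_n (fun n => RtoC (p n) * z ^ S n)%C M))
    with (X ^ S k * Cmod ((1 - z) * sum_n (fun n => RtoC (p n) * z ^ S n) M)%C)
    by (rewrite Cmod_mult; fold X; simpl; ring).
  rewrite E.
  assert (HXk : 0 <= X ^ S k <= 2 ^ S k) by (split; [now apply pow_le|apply pow_incr; lra]).
  set (W := Rabs (p (S M)) * qexp y ^ S (S M)).
  assert (HW : 0 <= W) by (apply Rmult_le_pos; [apply Rabs_pos|apply pow_le; lra]).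
  assert (Hb : Cmod (z * (RtoC (p 0%nat) + D) - RtoC (p (S M)) * z ^ S (S M))%C <= (Rabs (p 0%nat) + Cmod D) + W).
  { eapply Rle_trans; [apply Cmod_triangle|]. rewrite Cmod_opp. apply Rplus_le_compat.
    - rewrite Cmod_mult, Hz. pose proof (Cmod_triangle (RtoC (p 0%nat)) D) as Ht. rewrite Cmod_R in Ht.
      pose proof (Cmod_ge_0 (RtoC (p 0%nat) + D)%C). nra.
    - rewrite Cmod_mult, Cmod_R, Cmod_pow, Hz. unfold W. lra. }
  apply (Rmult_le_compat_l (X ^ S k)) in Hb; [|lra].
  eapply Rle_trans; [exact Hb|]. rewrite !Rmult_plus_distr_l.
  assert (X ^ S k * Rabs (p 0%nat) <= 2 ^ S k * Rabs (p 0%nat)) by (apply Rmult_le_compat_r; lra).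
  assert (X ^ S k * W <= 2 ^ S k * W) by (apply Rmult_le_compat_r; lra). lra.
Qed.

(** ** Distance to the singularity of the kernel *)

Lemma sin_ge_third x : 0 <= x <= PI / 2 -> x / 3 <= sin x.
Proof.
intros Hx. pose proof PI_RGT_0 as HP. pose proof PI_4 as HP4.
destruct (Rle_dec x (PI / 3)) as [H|H].
- destruct (MVT_gen sin 0 x cos) as [c [Hc E]].
  + intros t _. auto_derive; [trivial|ring].
  + intros t _. apply continuity_pt_filterlim, (ex_derive_continuous (V := R_NormedModule)). now auto_derive.
  + rewrite Rmin_left, Rmax_right in Hc by lra. rewrite sin_0 in E.
    assert (/ 2 <= cos c).
    { replace (/ 2) with (cos (PI / 3)) by (rewrite cos_PI3; field). apply cos_decr_1; lra. }
    nra.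
- apply Rle_trans with (sin (PI / 3)).
  + rewrite sin_PI3.
    assert (4 / 3 <= sqrt 3).
    { apply Rsqr_incr_0_var; [|apply sqrt_pos]. rewrite Rsqr_sqrt by lra. unfold Rsqr. lra. }
    lra.
  + apply sin_incr_1; lra.
Qed.

Lemma Cmod_1_minus_cis v : Cmod (1 - cis v)%C = 2 * Rabs (sin (PI * v)).
Proof.
apply Rsqr_inj; [apply Cmod_ge_0|pose proof (Rabs_pos (sin (PI * v))); lra|].
rewrite !Rsqr_pow2, Cmod2_alt.
replace ((2 * Rabs (sin (PI * v))) ^ 2) with (4 * Rabs (sin (PI * v)) ^ 2) by ring.
rewrite pow2_abs. unfold cis. simpl.
replace (2 * PI * v) with (2 * (PI * v)) by ring.
rewrite sin_2a, cos_2a_sin.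
pose proof (sin2_cos2 (PI * v)) as H. unfold Rsqr in H.
assert (Hc : cos (PI * v) * cos (PI * v) = 1 - sin (PI * v) * sin (PI * v)) by lra.
replace ((0 + - (2 * sin (PI * v) * cos (PI * v))) * ((0 + - (2 * sin (PI * v) * cos (PI * v))) * 1))
  with (4 * (sin (PI * v) * sin (PI * v)) * (cos (PI * v) * cos (PI * v))) by ring.
rewrite Hc. ring.
Qed.

Lemma Cmod_1_minus_cis_lower v : Rabs v <= / 2 -> 2 * Rabs v <= Cmod (1 - cis v)%C.
Proof.
intros Hv. rewrite Cmod_1_minus_cis. pose proof PI_RGT_0 as HP. pose proof PI2_3_2.
assert (E : Rabs (sin (PI * v)) = Rabs (sin (PI * Rabs v))).
{ unfold Rabs at 3. destruct (Rcase_abs v); [|reflexivity].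
  replace (PI * - v) with (- (PI * v)) by ring. now rewrite sin_neg, Rabs_Ropp. }
rewrite E. pose proof (Rabs_pos v).
assert (PI * Rabs v / 3 <= sin (PI * Rabs v)) by (apply sin_ge_third; split; nra).
pose proof (Rle_abs (sin (PI * Rabs v))). nra.
Qed.

Lemma Cmod_1_minus_cis_upper v : Cmod (1 - cis v)%C <= 2 * PI * Rabs v.
Proof.
rewrite Cmod_1_minus_cis. pose proof PI_RGT_0.
assert (H1 : Rabs (sin (PI * v)) <= Rabs (PI * v)).
{ destruct (MVT_gen sin 0 (PI * v) cos) as [c [_ E]].
  - intros t _. auto_derive; [trivial|ring].
  - intros t _. apply continuity_pt_filterlim, (ex_derive_continuous (V := R_NormedModule)). now auto_derive.
  - rewrite sin_0, !Rminus_0_r in E. rewrite E, Rabs_mult.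
    rewrite <- (Rmult_1_l (Rabs (PI * v))) at 2. apply Rmult_le_compat_r; [apply Rabs_pos|].
    apply Rabs_le, COS_bound. }
rewrite Rabs_mult, (Rabs_pos_eq PI) in H1 by lra. lra.
Qed.

(** The distance is at least 1 - q, which is of order y; up to a rotation it differs from
    |1 - cis v|, which is of order |v|, by O(y). *)
Lemma kernel_distance D : 0 <= D -> exists K, 0 < K /\ forall y eta v,
  0 < y <= 1 -> Rabs eta <= D * y -> Rabs v <= / 2 ->
  y + Rabs v <= K * Cmod (1 - RtoC (qexp y) * cis (eta - v))%C.
Proof.
intros HD. pose proof PI_ge_1 as HP.
exists (2 + (1 + 4 * PI * (1 + D)) / 2). split; [nra|].
intros y eta v Hy Heta Hv.
set (X := Cmod (1 - RtoC (qexp y) * cis (eta - v))%C).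
pose proof (qexp_range y (proj1 Hy)) as Hq.
assert (Hexp : 1 + 2 * PI * y <= / qexp y).
{ unfold qexp. rewrite exp_Ropp, Rinv_inv. apply exp_ineq1_le. }
assert (Hq1 : qexp y * (1 + 2 * PI * y) <= 1).
{ apply (Rmult_le_compat_l (qexp y)) in Hexp; [|lra]. rewrite Rinv_r in Hexp by lra. exact Hexp. }
assert (Hq2 : 1 - qexp y <= 2 * PI * y).
{ pose proof (exp_ineq1_le (- (2 * PI * y))) as H. fold (qexp y) in H. lra. }
assert (HX1 : y / 2 <= X).
{ assert (H1 : 1 - qexp y <= X).
  { assert (Ht := Cmod_triangle (1 - RtoC (qexp y) * cis (eta - v)) (RtoC (qexp y) * cis (eta - v))).
    replace (1 - RtoC (qexp y) * cis (eta - v) + RtoC (qexp y) * cis (eta - v))%C with (RtoC 1) in Ht by ring.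
    rewrite Cmod_1, Cmod_mult, Cmod_cis, Cmod_R, Rabs_pos_eq in Ht by lra. fold X in Ht. lra. }
  assert (y / 2 <= 1 - qexp y).
  { assert (0 <= y * PI) by nra.
    apply Rnot_lt_le. intros Hlt. assert (1 - y / 2 < qexp y) by lra.
    assert ((1 - y / 2) * (1 + 2 * PI * y) < 1) by nra. nra. }
  lra. }
assert (HX2 : 2 * Rabs v <= X + 2 * PI * (1 + D) * y).
{ eapply Rle_trans; [apply (Cmod_1_minus_cis_lower v Hv)|].
  assert (E : X = Cmod (cis v - RtoC (qexp y) * cis eta)%C).
  { transitivity (Cmod (cis v * (1 - RtoC (qexp y) * cis (eta - v)))%C);
      [rewrite Cmod_mult, Cmod_cis; fold X; ring|f_equal].
    replace (cis eta) with (cis v * cis (eta - v))%C by (rewrite <- cis_plus; f_equal; ring). ring. }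
  assert (Ht := Cmod_triangle (1 - RtoC (qexp y) * cis eta) (- (cis v - RtoC (qexp y) * cis eta))).
  replace (1 - RtoC (qexp y) * cis eta + - (cis v - RtoC (qexp y) * cis eta))%C with (1 - cis v)%C in Ht by ring.
  rewrite Cmod_opp, <- E in Ht.
  assert (H2 : Cmod (1 - RtoC (qexp y) * cis eta)%C <= 2 * PI * y + 2 * PI * Rabs eta).
  { replace (1 - RtoC (qexp y) * cis eta)%C with (RtoC (1 - qexp y) + RtoC (qexp y) * (1 - cis eta))%C
      by (rewrite RtoC_minus; ring).
    eapply Rle_trans; [apply Cmod_triangle|]. rewrite Cmod_mult, !Cmod_R, !Rabs_pos_eq by lra.
    pose proof (Cmod_1_minus_cis_upper eta) as H. pose proof (Cmod_ge_0 (1 - cis eta)%C). nra. }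
  assert (2 * PI * Rabs eta <= 2 * PI * (D * y)) by (apply Rmult_le_compat_l; lra). nra. }
assert (0 <= 2 * PI * (1 + D)) by nra.
assert (2 * PI * (1 + D) * y <= 2 * PI * (1 + D) * (2 * X)) by (apply Rmult_le_compat_l; lra). lra.
Qed.

(** The kernel with coefficients m^k q^m contains positive frequencies only: it projects h
    to its positive part and differentiates k times.  In the cone it is
    O((y + |v|)^(-k-1)); the factor (y + |v|)^t leaves y^(t-k+1) times the kernel
    1/(y^2 + v^2), whose integral is at most PI/y. *)
Lemma analytic_kernel_bound D k t : 0 <= D -> 0 <= t -> t + 1 <= INR k ->
  exists K, 0 < K /\ forall (h : R -> C) (d : nat -> C) H y eta,
    (forall v, ccont h v) -> Csummable d ->
    (forall m, is_CInt (fun v => h v * cis (- (freq m * v)))%C (- / 2) (/ 2) (d m)) ->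
    0 <= H -> 0 < y <= 1 -> Rabs eta <= D * y ->
    (forall v, Rabs v <= / 2 -> Cmod (h v) <= H * Rpower (y + Rabs v) t) ->
    Cmod (CSeries (fun m => d m * RtoC (wgt (INR k) y m) * cis (freq m * eta))%C)
      <= K * H * Rpower y (t - INR k).
Proof.
intros HD Ht Htk.
destruct (kernel_distance D HD) as [K1 [HK1 Hdist]].
destruct (polyseq_kernel_bound k _ (polyseq_freq_pow k)) as [K2 [HK2 Hker]].
pose proof PI_ge_1 as HPI.
assert (HA : 0 < K1 ^ S k) by now apply pow_lt.
exists (K1 ^ S k * (K2 + 1) * PI). split.
{ apply Rmult_lt_0_compat; [apply Rmult_lt_0_compat|]; lra. }
intros h d H y eta Hh Hd HF HH Hy Heta Hb.
destruct (Hker y (proj1 Hy)) as [ep [Hep HkerM]].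
set (Y := Rpower y (t - INR k)). assert (HY : 0 < Y) by apply Rpower_gt0.
apply Rle_trans with (K1 ^ S k * K2 * PI * H * Y).
2:{ assert (0 <= K1 ^ S k * PI * H * Y).
    { apply Rmult_le_pos; [|lra]. apply Rmult_le_pos; [|lra]. apply Rmult_le_pos; lra. } lra. }
apply (Cmod_CSeries_le_partial _ (fun M => K1 ^ S k * PI * H * Y * ep M)).
- destruct (wgt_bounded (INR k) y (proj1 Hy)) as [B [HB HBn]].
  apply Csummable_dom with (fun n => Cmod (d n) * B); [|now apply ex_series_scal_r].
  intros n. rewrite !Cmod_mult, Cmod_cis, Cmod_R, Rmult_1_r, Rabs_pos_eq by (left; apply wgt_gt0).
  apply Rmult_le_compat_l; [apply Cmod_ge_0|apply HBn].
- replace (Finite 0) with (Rbar_mult (K1 ^ S k * PI * H * Y) 0) by (simpl; f_equal; ring).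
  now apply is_lim_seq_scal_l.
- intros M.
  set (z := fun v => (RtoC (qexp y) * cis (eta - v))%C).
  set (SM := fun v => sum_n (fun n => RtoC (freq n ^ k) * z v ^ S n)%C M).
  assert (Hz : forall v, Cmod (z v) = qexp y).
  { intros v. unfold z. rewrite Cmod_mult, Cmod_cis, Cmod_R, Rmult_1_r. apply Rabs_pos_eq.
    left; apply exp_pos. }
  assert (Hint : is_CInt (fun v => h v * SM v)%C (- / 2) (/ 2)
    (sum_n (fun m => d m * RtoC (wgt (INR k) y m) * cis (freq m * eta))%C M)).
  { apply is_CInt_ext with (fun v => sum_n (fun m => (RtoC (wgt (INR k) y m) * cis (freq m * eta)) * (h v * cis (- (freq m * v))))%C M).
    - intros v. unfold SM. rewrite <- Csum_n_scal. apply Csum_n_ext. intros n.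
      unfold z. rewrite Cpow_mult_l, cis_pow, <- RtoC_pow. fold (freq n).
      replace (freq n * (eta - v)) with (freq n * eta + - (freq n * v)) by ring.
      rewrite cis_plus. unfold wgt, qexp. rewrite <- exp_INR_mult. fold (freq n).
      rewrite Rpower_pow by (pose proof (freq_ge1 n); lra).
      replace (freq n * - (2 * PI * y)) with (- (2 * PI * freq n * y)) by ring.
      rewrite RtoC_mult. ring.
    - replace (sum_n (fun m => d m * RtoC (wgt (INR k) y m) * cis (freq m * eta))%C M)
        with (sum_n (fun m => (RtoC (wgt (INR k) y m) * cis (freq m * eta)) * d m)%C M)
        by (apply Csum_n_ext; intros; ring).
      apply (is_CInt_sum_n (fun m v => (RtoC (wgt (INR k) y m) * cis (freq m * eta)) * (h v * cis (- (freq m * v))))%C).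
      intros m. apply is_CInt_scal, HF. }
  assert (HeM : 0 <= K2 + ep M).
  { eapply Rle_trans; [|apply (HkerM (z 0) (Hz 0) M)].
    apply Rmult_le_pos; [apply pow_le|]; apply Cmod_ge_0. }
  set (c0 := K1 ^ S k * (K2 + ep M) * H * Rpower y (t - INR k + 1)).
  assert (Hc0 : 0 <= c0).
  { unfold c0. apply Rmult_le_pos; [|left; apply Rpower_gt0].
    apply Rmult_le_pos; [|lra]. apply Rmult_le_pos; lra. }
  assert (HatanI : is_RInt (fun v => c0 * / (y ^ 2 + v ^ 2)) (- / 2) (/ 2)
     (c0 * (atan (/ 2 / y) / y - atan (- / 2 / y) / y))).
  { apply (is_RInt_scal (V := R_NormedModule)).
    apply (is_RInt_derive (V := R_CompleteNormedModule) (fun v => atan (v / y) / y)).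
    - intros x _. auto_derive; [lra|]. field. split; [|lra].
      assert (0 < y ^ 2 + x ^ 2) by (pose proof (pow2_ge_0 x); assert (0 < y ^ 2) by (apply pow_lt; lra); lra). lra.
    - intros x _. apply (ex_derive_continuous (V := R_NormedModule)). auto_derive.
      assert (0 < y ^ 2 + x ^ 2) by (pose proof (pow2_ge_0 x); assert (0 < y ^ 2) by (apply pow_lt; lra); lra).
      simpl in *. lra. }
  assert (H12 : - / 2 <= / 2) by lra.
  eapply Rle_trans; [apply (is_CInt_bound _ _ _ _ _ _ H12 Hint HatanI)|].
  + intros v Hv. assert (Hv' : Rabs v <= / 2) by (apply Rabs_le; lra).
    pose proof (Rabs_pos v) as Hv0.
    specialize (Hb v Hv'). specialize (Hdist y eta v Hy Heta Hv'). fold (z v) in Hdist.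
    specialize (HkerM (z v) (Hz v) M). fold (SM v) in HkerM.
    rewrite Cmod_mult.
    set (X := Cmod (1 - z v)%C) in *.
    set (s := y + Rabs v) in *. assert (Hs : 0 < s) by (unfold s; lra).
    assert (HS : s ^ S k * Cmod (SM v) <= K1 ^ S k * (K2 + ep M)).
    { apply Rle_trans with ((K1 * X) ^ S k * Cmod (SM v)).
      - apply Rmult_le_compat_r; [apply Cmod_ge_0|]. apply pow_incr; lra.
      - rewrite Rpow_mult_distr, Rmult_assoc. apply Rmult_le_compat_l; lra. }
    assert (Hsk : 0 < s ^ S k) by now apply pow_lt.
    assert (HS' : Cmod (SM v) <= K1 ^ S k * (K2 + ep M) * / s ^ S k).
    { apply (Rmult_le_reg_l (s ^ S k)); [exact Hsk|].
      replace (s ^ S k * (K1 ^ S k * (K2 + ep M) * / s ^ S k)) with (K1 ^ S k * (K2 + ep M)) by (field; lra).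
      exact HS. }
    eapply Rle_trans; [apply Rmult_le_compat; [apply Cmod_ge_0|apply Cmod_ge_0|exact Hb|exact HS']|].
    unfold c0.
    replace (H * Rpower s t * (K1 ^ S k * (K2 + ep M) * / s ^ S k))
      with (K1 ^ S k * (K2 + ep M) * H * (Rpower s t * / s ^ S k)) by ring.
    rewrite (Rmult_assoc (K1 ^ S k * (K2 + ep M) * H)).
    apply Rmult_le_compat_l; [apply Rmult_le_pos; [|lra]; apply Rmult_le_pos; lra|].
    rewrite <- (Rpower_pow (S k) s Hs), <- Rpower_Ropp, <- Rpower_plus, S_INR.
    replace (t + - (INR k + 1)) with ((t - INR k + 1) + - (INR 2)) by (simpl; ring).
    rewrite Rpower_plus, (Rpower_Ropp s (INR 2)), Rpower_pow by exact Hs.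
    apply Rmult_le_compat; [left; apply Rpower_gt0|left; apply Rinv_0_lt_compat; now apply pow_lt| |].
    * replace (t - INR k + 1) with (- (INR k - t - 1)) by ring. rewrite !Rpower_Ropp.
      apply Rinv_le_contravar; [apply Rpower_gt0|]. apply Rle_Rpower_l; [lra|]. unfold s; lra.
    * apply Rinv_le_contravar.
      -- assert (0 < y ^ 2) by (apply pow_lt; lra). pose proof (pow2_ge_0 v). lra.
      -- unfold s. rewrite <- (pow2_abs v). nra.
  + pose proof (atan_bound (/ 2 / y)) as [_ A1]. pose proof (atan_bound (- / 2 / y)) as [A2 _].
    assert (Hiy : 0 < / y) by (apply Rinv_0_lt_compat; lra).
    assert (Hpy : atan (/ 2 / y) / y - atan (- / 2 / y) / y <= PI * / y) by (unfold Rdiv in *; nra).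
    apply Rle_trans with (c0 * (PI * / y)); [now apply Rmult_le_compat_l|].
    right. unfold c0, Y.
    rewrite Rpower_plus, Rpower_1 by lra. field. lra.
Qed.

(** * Boundary values of harmonic series *)

Definition trig (p q : nat -> R) (x : R) (n : nat) : R :=
  p n * cos (2 * PI * (freq n * x)) + q n * sin (2 * PI * (freq n * x)).

Lemma Rabs_trig_le p q x n : Rabs (trig p q x n) <= Rabs (p n) + Rabs (q n).
Proof.
unfold trig. eapply Rle_trans; [apply Rabs_triang|]. rewrite !Rabs_mult.
assert (Hc : Rabs (cos (2 * PI * (freq n * x))) <= 1) by apply Rabs_le, COS_bound.
assert (Hs : Rabs (sin (2 * PI * (freq n * x))) <= 1) by apply Rabs_le, SIN_bound.
apply Rplus_le_compat.
- rewrite <- (Rmult_1_r (Rabs (p n))) at 2. apply Rmult_le_compat_l; [apply Rabs_pos|exact Hc].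
- rewrite <- (Rmult_1_r (Rabs (q n))) at 2. apply Rmult_le_compat_l; [apply Rabs_pos|exact Hs].
Qed.

Definition abs_summable2 (p q : nat -> R) : Prop := ex_series (fun n => Rabs (p n) + Rabs (q n)).

Lemma trig_summable p q x : abs_summable2 p q -> ex_series (fun n => Rabs (trig p q x n)).
Proof.
intros H. apply ex_series_dom with (2 := H). intros n. rewrite Rabs_Rabsolu. apply Rabs_trig_le.
Qed.

Lemma abs_summable2_rot p q : abs_summable2 p q -> abs_summable2 q (fun n => - p n).
Proof.
intros H. apply ex_series_ext with (2 := H). intros n. rewrite Rabs_Ropp. apply Rplus_comm.
Qed.

Lemma sin_cos_small b : Rabs (sin b) <= Rabs b /\ Rabs (cos b - 1) <= b ^ 2 /\ Rabs (sin b - b) <= b ^ 2.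
Proof.
assert (Hs : forall b, Rabs (sin b) <= Rabs b).
{ intros t. destruct (MVT_gen sin 0 t cos) as [c [_ E]].
  - intros u _. auto_derive; [trivial|ring].
  - intros u _. apply continuity_pt_filterlim, (ex_derive_continuous (V := R_NormedModule)). now auto_derive.
  - rewrite sin_0, !Rminus_0_r in E. rewrite E, Rabs_mult.
    rewrite <- (Rmult_1_l (Rabs t)) at 2. apply Rmult_le_compat_r; [apply Rabs_pos|].
    apply Rabs_le, COS_bound. }
assert (Hbt : forall c t, Rmin 0 t <= c <= Rmax 0 t -> Rabs c <= Rabs t).
{ intros c t. unfold Rmin, Rmax. destruct (Rle_dec 0 t); unfold Rabs; repeat destruct Rcase_abs; lra. }
assert (Hc : forall t, Rabs (cos t - 1) <= t ^ 2).
{ intros t. destruct (MVT_gen cos 0 t (fun u => - sin u)) as [c [Hct E]].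
  - intros u _. auto_derive; [trivial|ring].
  - intros u _. apply continuity_pt_filterlim, (ex_derive_continuous (V := R_NormedModule)). now auto_derive.
  - rewrite cos_0, Rminus_0_r in E. rewrite E, Rabs_mult, Rabs_Ropp.
    replace (t ^ 2) with (Rabs t * Rabs t) by (rewrite <- pow2_abs; ring).
    apply Rmult_le_compat_r; [apply Rabs_pos|]. eapply Rle_trans; [apply Hs|]. now apply Hbt. }
assert (Hc1 : forall t, Rabs (cos t - 1) <= Rabs t).
{ intros t. destruct (MVT_gen cos 0 t (fun u => - sin u)) as [c [Hct E]].
  - intros u _. auto_derive; [trivial|ring].
  - intros u _. apply continuity_pt_filterlim, (ex_derive_continuous (V := R_NormedModule)). now auto_derive.
  - rewrite cos_0, Rminus_0_r in E. rewrite E, Rabs_mult, Rabs_Ropp.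
    rewrite <- (Rmult_1_l (Rabs t)) at 2. apply Rmult_le_compat_r; [apply Rabs_pos|].
    apply Rabs_le, SIN_bound. }
split; [apply Hs|]. split; [apply Hc|].
destruct (MVT_gen (fun u => sin u - u) 0 b (fun u => cos u - 1)) as [c [Hct E]].
- intros u _. auto_derive; [trivial|ring].
- intros u _. apply continuity_pt_filterlim, (ex_derive_continuous (V := R_NormedModule) (fun u => sin u - u)). now auto_derive.
- rewrite sin_0, !Rminus_0_r in E. rewrite E, Rabs_mult.
  replace (b ^ 2) with (Rabs b * Rabs b) by (rewrite <- pow2_abs; ring).
  apply Rmult_le_compat_r; [apply Rabs_pos|]. eapply Rle_trans; [apply Hc1|]. now apply Hbt.
Qed.

Lemma Rabs_lin2 a b u v m : Rabs a <= 1 -> Rabs b <= 1 -> Rabs u <= m -> Rabs v <= m ->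
  Rabs (a * u + b * v) <= 2 * m.
Proof.
intros Ha Hb Hu Hv. eapply Rle_trans; [apply Rabs_triang|]. rewrite !Rabs_mult.
pose proof (Rabs_pos a). pose proof (Rabs_pos b). pose proof (Rabs_pos u). pose proof (Rabs_pos v).
assert (Rabs a * Rabs u <= 1 * m) by (apply Rmult_le_compat; lra).
assert (Rabs b * Rabs v <= 1 * m) by (apply Rmult_le_compat; lra). lra.
Qed.

Lemma trig_second_order p q x h n :
  Rabs (trig p q (x + h) n - trig p q x n - h * (2 * PI * freq n * trig q (fun n => - p n) x n))
    <= (Rabs (p n) + Rabs (q n)) * (2 * (2 * PI * freq n * h) ^ 2).
Proof.
unfold trig. set (a := 2 * PI * (freq n * x)). set (b := 2 * PI * freq n * h).
replace (2 * PI * (freq n * (x + h))) with (a + b) by (unfold a, b; ring).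
rewrite cos_plus, sin_plus.
replace (_ - _ - _) with (p n * (cos a * (cos b - 1) + - sin a * (sin b - b))
  + q n * (sin a * (cos b - 1) + cos a * (sin b - b))) by (unfold b; ring).
destruct (sin_cos_small b) as [_ [H1 H2]].
assert (Hc : Rabs (cos a) <= 1) by apply Rabs_le, COS_bound.
assert (Hs : Rabs (sin a) <= 1) by apply Rabs_le, SIN_bound.
eapply Rle_trans; [apply Rabs_triang|]. rewrite !Rabs_mult, Rmult_plus_distr_r.
apply Rplus_le_compat; apply Rmult_le_compat_l; try apply Rabs_pos; apply Rabs_lin2;
  rewrite ?Rabs_Ropp; assumption.
Qed.

(** Quadratic remainders can be summed term by term, which differentiates the series without
    uniform convergence of the difference quotients. *)
Lemma is_derive_Series_second_order (u : nat -> R -> R) (du M : nat -> R) x :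
  (forall t, ex_series (fun n => u n t)) -> ex_series du -> ex_series M ->
  (forall n h, Rabs (u n (x + h) - u n x - h * du n) <= M n * h ^ 2) ->
  is_derive (fun t => Series (fun n => u n t)) x (Series du).
Proof.
intros Hu Hdu HM H. apply is_derive_Reals. intros eps Heps.
assert (HM0 : 0 <= Series M).
{ assert (HMn : forall n, 0 <= M n).
  { intros n. specialize (H n 1). pose proof (Rabs_pos (u n (x + 1) - u n x - 1 * du n)). lra. }
  eapply Rle_trans; [apply (HMn 0%nat)|].
  pose proof (sum_n_le_Series M 0 HMn HM) as H0. rewrite sum_O in H0. exact H0. }
assert (Hd : 0 < eps / (Series M + 1)) by (apply Rdiv_lt_0_compat; lra).
exists (mkposreal _ Hd). intros h Hh0 Hh. simpl in Hh.
assert (E : Series (fun n => u n (x + h)) - Series (fun n => u n x) - h * Series du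
  = Series (fun n => u n (x + h) - u n x - h * du n)).
{ rewrite <- Series_scal_l, <- !Series_minus; auto.
  - apply (ex_series_minus (V := R_NormedModule)); auto.
  - now apply (ex_series_scal (V := R_NormedModule) h du). }
assert (Hb : Rabs (Series (fun n => u n (x + h)) - Series (fun n => u n x) - h * Series du) <= Series M * h ^ 2).
{ rewrite E, <- Series_scal_r. apply Series_abs_le; [intros n; apply H|]. now apply ex_series_scal_r. }
assert (Hh1 : 0 < Rabs h) by now apply Rabs_pos_lt.
replace ((Series (fun n => u n (x + h)) - Series (fun n => u n x)) / h - Series du)
  with ((Series (fun n => u n (x + h)) - Series (fun n => u n x) - h * Series du) / h) by (field; exact Hh0).
unfold Rdiv. rewrite Rabs_mult, Rabs_inv.
apply (Rmult_lt_reg_r (Rabs h)); [exact Hh1|]. rewrite Rmult_assoc, Rinv_l, Rmult_1_r by lra.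
eapply Rle_lt_trans; [exact Hb|].
replace (h ^ 2) with (Rabs h * Rabs h) by (rewrite <- pow2_abs; ring).
rewrite <- Rmult_assoc. apply Rmult_lt_compat_r; [exact Hh1|].
apply (Rmult_lt_compat_r (Series M + 1)) in Hh; [|lra].
unfold Rdiv in Hh. rewrite Rmult_assoc, Rinv_l, Rmult_1_r in Hh by lra. nra.
Qed.

Lemma wgt_S g y n : wgt (g + 1) y n = freq n * wgt g y n.
Proof.
unfold wgt. rewrite Rpower_plus, Rpower_1 by (pose proof (freq_ge1 n); lra). ring.
Qed.

Lemma is_derive_Lap_trig p q g y x : abs_summable2 p q -> 0 < y ->
  is_derive (fun x => Lap (trig p q x) g y) x (2 * PI * Lap (trig q (fun n => - p n) x) (g + 1) y).
Proof.
intros Hpq Hy. unfold Lap. rewrite <- Series_scal_l.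
apply (is_derive_Series_second_order (fun n t => trig p q t n * wgt g y n) _
  (fun n => 8 * PI ^ 2 * ((Rabs (p n) + Rabs (q n)) * wgt (g + 1 + 1) y n))).
- intros t. apply ex_series_Rabs. eapply ex_series_ext; [intros n; symmetry; apply Rabs_wgt_mult|].
  apply ex_series_wgt; [now apply trig_summable|exact Hy].
- apply (ex_series_scal (V := R_NormedModule) (2 * PI) (fun n => trig q (fun n => - p n) x n * wgt (g + 1) y n)).
  apply ex_series_Rabs. eapply ex_series_ext; [intros n; symmetry; apply Rabs_wgt_mult|].
  apply ex_series_wgt; [|exact Hy]. now apply trig_summable, abs_summable2_rot.
- apply (ex_series_scal (V := R_NormedModule) (8 * PI ^ 2)).
  assert (E : forall n, Rabs (Rabs (p n) + Rabs (q n)) = Rabs (p n) + Rabs (q n)).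
  { intros n. apply Rabs_pos_eq. pose proof (Rabs_pos (p n)); pose proof (Rabs_pos (q n)); lra. }
  apply (ex_series_ext (fun n => Rabs (Rabs (p n) + Rabs (q n)) * wgt (g + 1 + 1) y n)).
  + intros n. now rewrite E.
  + apply (ex_series_wgt (fun n => Rabs (p n) + Rabs (q n))); [|exact Hy].
    apply (ex_series_ext (fun n => Rabs (p n) + Rabs (q n))); [intros n; now rewrite E|exact Hpq].
- intros n h. rewrite !wgt_S.
  replace (trig p q (x + h) n * wgt g y n - trig p q x n * wgt g y n
    - h * (2 * PI * (trig q (fun n0 => - p n0) x n * (freq n * wgt g y n))))
    with ((trig p q (x + h) n - trig p q x n - h * (2 * PI * freq n * trig q (fun n => - p n) x n)) * wgt g y n) by ring.
  rewrite Rabs_wgt_mult.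
  replace (8 * PI ^ 2 * ((Rabs (p n) + Rabs (q n)) * (freq n * (freq n * wgt g y n))) * h ^ 2)
    with ((Rabs (p n) + Rabs (q n)) * (2 * (2 * PI * freq n * h) ^ 2) * wgt g y n) by ring.
  apply Rmult_le_compat_r; [left; apply wgt_gt0|]. apply trig_second_order.
Qed.

(** A bound v^(s-1) for the derivative in y integrates to a Hoelder bound in y. *)
Lemma Lap_vertical_increment b g y1 y2 s C0 : ex_series (fun n => Rabs (b n)) ->
  0 < y1 <= y2 -> 0 < s ->
  (forall v, 0 < v -> Rabs (Lap b (g + 1) v) <= C0 * Rpower v (s - 1)) ->
  Rabs (Lap b g y1 - Lap b g y2) <= 2 * PI * C0 / s * (Rpower y2 s - Rpower y1 s).
Proof.
intros Hb Hy Hs H. pose proof PI_RGT_0 as HPI.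
assert (Hsum : forall y, 0 < y -> ex_series (fun n => b n * wgt g y n)).
{ intros y Hy'. apply ex_series_Rabs. eapply ex_series_ext; [intros n; symmetry; apply Rabs_wgt_mult|].
  now apply ex_series_wgt. }
pose proof (Lap_weighted_integral b (g + 1) y1 y2 (fun _ => 1) (fun v => C0 * Rpower v (s - 1)) Hb Hy) as HL.
assert (Hc : forall v, 0 < v -> continuous (fun v => C0 * Rpower v (s - 1)) v).
{ intros v Hv. apply (continuous_scal_r (K := R_AbsRing) (V := R_NormedModule)). now apply continuous_Rpower. }
replace (Lap b g y1 - Lap b g y2) with (2 * PI * Series (fun n => b n * Rpower (freq n) (g + 1) *
          RInt (fun v => 1 * exp (- (2 * PI * freq n * v))) y1 y2)).
- rewrite Rabs_mult, (Rabs_pos_eq (2 * PI)) by lra.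
  replace (2 * PI * C0 / s * (Rpower y2 s - Rpower y1 s)) with
    (2 * PI * RInt (fun v => 1 * (C0 * Rpower v (s - 1))) y1 y2).
  + apply Rmult_le_compat_l; [lra|]. apply HL.
    * intros; apply continuous_const.
    * intros; apply Hc; lra.
    * intros; lra.
    * intros; apply H; lra.
  + rewrite (RInt_ext _ (fun v => C0 * Rpower v (s - 1))) by (intros; apply Rmult_1_l).
    change (RInt (fun v => C0 * Rpower v (s - 1)) y1 y2) with
      (RInt (fun v => scal C0 (Rpower v (s - 1))) y1 y2).
    rewrite (RInt_scal (V := R_CompleteNormedModule)).
    * rewrite RInt_Rpower by lra. unfold scal; simpl; unfold mult; simpl. field. lra.
    * apply ex_RInt_cont; [lra|]. intros; apply continuous_Rpower; lra.
- unfold Lap. rewrite <- Series_minus by (apply Hsum; lra). rewrite <- Series_scal_l.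
  apply Series_ext. intros n. pose proof (freq_ge1 n) as Hf.
  assert (Hw : 0 < 2 * PI * freq n) by nra.
  replace (RInt _ y1 y2) with ((exp (- (2 * PI * freq n * y1)) - exp (- (2 * PI * freq n * y2))) / (2 * PI * freq n)).
  + unfold wgt. rewrite Rpower_plus, Rpower_1 by lra. field. split; lra.
  + symmetry. apply is_RInt_unique.
    replace (_ / _) with (minus (- exp (- (2 * PI * freq n * y2)) / (2 * PI * freq n)) (- exp (- (2 * PI * freq n * y1)) / (2 * PI * freq n)))
      by (unfold minus, plus, opp; simpl; field; split; lra).
    apply (is_RInt_derive (V := R_CompleteNormedModule) (fun v => - exp (- (2 * PI * freq n * v)) / (2 * PI * freq n))).
    * intros x _. auto_derive; [trivial|]. field. split; lra.
    * intros x _. apply (ex_derive_continuous (V := R_NormedModule)). now auto_derive.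
Qed.

Definition yseq (m : nat) : R := / INR (S m).

Lemma yseq_gt0 m : 0 < yseq m.
Proof. apply Rinv_0_lt_compat, lt_0_INR. lia. Qed.

Lemma is_lim_yseq : is_lim_seq yseq 0.
Proof.
assert (H : is_lim_seq (fun p => INR (S p)) p_infty) by (apply (is_lim_seq_incr_1 INR); apply is_lim_seq_INR).
apply (is_lim_seq_inv _ p_infty H). easy.
Qed.

Lemma is_lim_Rpower_0 u s : (forall n, 0 < u n) -> is_lim_seq u 0 -> 0 < s ->
  is_lim_seq (fun n => Rpower (u n) s) 0.
Proof.
intros Hu Hl Hs. apply is_lim_seq_spec. intros eps. apply is_lim_seq_spec in Hl.
destruct (Hl (mkposreal (Rpower eps (/ s)) (Rpower_gt0 _ _))) as [N HN].
exists N. intros n Hn. specialize (HN n Hn). simpl in HN.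
rewrite Rminus_0_r, Rabs_pos_eq in HN |- * by (left; first [apply Hu|apply Rpower_gt0]).
replace (pos eps) with (Rpower (Rpower eps (/ s)) s).
- apply Rlt_Rpower_l; [exact Hs|]. now split.
- rewrite Rpower_mult, Rinv_l, Rpower_1; [reflexivity|apply cond_pos|lra].
Qed.

(** For g > 0 the series need not converge at y = 0; its boundary value is the limit along the
    heights 1/(m + 1). *)
Definition bdry (b : nat -> R) (g : R) : R := real (Lim_seq (fun m => Lap b g (yseq m))).

Lemma Lap_bdry b g s A : 0 < s -> 0 <= A ->
  (forall y1 y2, 0 < y1 <= y2 -> Rabs (Lap b g y1 - Lap b g y2) <= A * (Rpower y2 s - Rpower y1 s)) ->
  is_lim_seq (fun m => Lap b g (yseq m)) (bdry b g) /\
  forall y, 0 < y -> Rabs (Lap b g y - bdry b g) <= A * Rpower y s.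
Proof.
intros Hs HA H.
pose proof (is_lim_Rpower_0 yseq s yseq_gt0 is_lim_yseq Hs) as Hy0.
assert (Hdec : forall m n, (m <= n)%nat -> yseq n <= yseq m).
{ intros m n Hmn. apply Rinv_le_contravar; [apply lt_0_INR; lia|]. apply le_INR. lia. }
assert (Hcv : ex_finite_lim_seq (fun m => Lap b g (yseq m))).
{ apply ex_lim_seq_cauchy_corr. intros eps.
  apply is_lim_seq_spec in Hy0.
  destruct (Hy0 (mkposreal (eps / (A + 1)) ltac:(apply Rdiv_lt_0_compat; [apply cond_pos|lra]))) as [N HN].
  simpl in HN.
  assert (Hh : forall m n, (N <= m)%nat -> (m <= n)%nat -> Rabs (Lap b g (yseq n) - Lap b g (yseq m)) < eps).
  { intros m n Hm Hmn. eapply Rle_lt_trans; [apply H; split; [apply yseq_gt0|now apply Hdec]|].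
    specialize (HN m Hm). rewrite Rminus_0_r, Rabs_pos_eq in HN by (left; apply Rpower_gt0).
    pose proof (Rpower_gt0 (yseq n) s). pose proof (Rpower_gt0 (yseq m) s).
    apply (Rmult_lt_compat_r (A + 1)) in HN; [|lra].
    unfold Rdiv in HN. rewrite Rmult_assoc, Rinv_l, Rmult_1_r in HN by lra. nra. }
  exists N. intros n m Hn Hm. destruct (Nat.le_ge_cases n m) as [Hle|Hle].
  - rewrite Rabs_minus_sym. now apply Hh.
  - now apply Hh. }
assert (Hlim : is_lim_seq (fun m => Lap b g (yseq m)) (bdry b g)).
{ destruct Hcv as [l Hl]. unfold bdry. now rewrite (is_lim_seq_unique _ _ Hl). }
split; [exact Hlim|]. intros y Hy.
apply (is_lim_seq_le_lim (fun m => Rabs (Lap b g y - Lap b g (yseq m))) (fun m => A * Rpower (yseq m) s)).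
- change (Finite (Rabs (Lap b g y - bdry b g))) with (Rbar_abs (Finite (Lap b g y - bdry b g))).
  apply is_lim_seq_abs. apply is_lim_seq_minus'; [apply is_lim_seq_const|exact Hlim].
- replace (Finite 0) with (Rbar_mult A 0) by (simpl; f_equal; ring). now apply is_lim_seq_scal_l.
- intros m. pose proof (yseq_gt0 m). pose proof (Rpower_gt0 (yseq m) s). pose proof (Rpower_gt0 y s).
  destruct (Rle_dec (yseq m) y).
  + rewrite Rabs_minus_sym. eapply Rle_trans; [apply H; lra|]. nra.
  + eapply Rle_trans; [apply H; lra|]. nra.
Qed.

Lemma bdry_0 b : ex_series (fun n => Rabs (b n)) ->
  is_lim_seq (fun m => Lap b 0 (yseq m)) (Series b).
Proof.
intros Hb. apply (Series_dominated (fun m n => b n * wgt 0 (yseq m) n) b (fun n => Rabs (b n))).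
- intros m n. rewrite Rabs_wgt_mult. rewrite <- (Rmult_1_r (Rabs (b n))) at 2.
  apply Rmult_le_compat_l; [apply Rabs_pos|]. pose proof (yseq_gt0 m). pose proof (freq_ge1 n). pose proof PI_RGT_0.
  unfold wgt. rewrite Rpower_O, Rmult_1_l by lra. left. rewrite <- exp_0; apply exp_increasing. assert (0 < 2 * PI * freq n) by nra. nra.
- exact Hb.
- intros n. pose proof (freq_ge1 n) as Hf.
  replace (Finite (b n)) with (Rbar_mult (b n) 1) by (simpl; f_equal; ring).
  apply is_lim_seq_scal_l. unfold wgt.
  apply is_lim_seq_ext with (fun m => exp (- (2 * PI * freq n * yseq m))).
  { intros m. rewrite Rpower_O by lra. ring. }
  replace 1 with (exp (- (2 * PI * freq n * 0))) by (rewrite Rmult_0_r, Ropp_0; apply exp_0).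
  apply (is_lim_seq_continuous (fun t => exp (- (2 * PI * freq n * t)))).
  + apply continuity_pt_filterlim.
    apply (ex_derive_continuous (V := R_NormedModule) (fun t => exp (- (2 * PI * freq n * t)))). now auto_derive.
  + apply is_lim_yseq.
Qed.

Definition Lap_bound (C0 s : R) (k : nat) (p q : nat -> R) : Prop :=
  forall j x y, (j <= k)%nat -> 0 < y ->
    Rabs (Lap (trig p q x) (INR j + 1) y) <= C0 * Rpower y (s - 1).

Lemma Lap_trig_opp p q x g y :
  Lap (trig (fun n => - p n) (fun n => - q n) x) g y = - Lap (trig p q x) g y.
Proof.
unfold Lap. rewrite <- Series_opp. apply Series_ext. intros n. unfold trig. ring.
Qed.

Lemma Lap_bound_opp C0 s k p q : Lap_bound C0 s k p q ->
  Lap_bound C0 s k (fun n => - p n) (fun n => - q n).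
Proof. intros H j x y Hj Hy. rewrite Lap_trig_opp, Rabs_Ropp. now apply H. Qed.

(** Differentiation in x rotates the coefficients (p, q) to (q, -p), besides multiplying by
    2 PI times the frequency. *)
Fixpoint rot (j : nat) (p q : nat -> R) : (nat -> R) * (nat -> R) :=
  match j with
  | O => (p, q)
  | S j' => (snd (rot j' p q), fun n => - fst (rot j' p q) n)
  end.

(** Points at distance y are compared through height y: two vertical increments and a
    horizontal one, each of order y^s. *)
Lemma bdry_estimates C0 s k p q : 0 < s -> 0 <= C0 -> abs_summable2 p q ->
  Lap_bound C0 s k p q -> Lap_bound C0 s k q (fun n => - p n) ->
  forall j, (j <= k)%nat ->
  (forall x, is_lim_seq (fun m => Lap (trig p q x) (INR j) (yseq m)) (bdry (trig p q x) (INR j))) /\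
  (forall x y, 0 < y -> Rabs (Lap (trig p q x) (INR j) y - bdry (trig p q x) (INR j))
      <= 2 * PI * C0 / s * Rpower y s) /\
  (forall x x', x <> x' -> Rabs (bdry (trig p q x) (INR j) - bdry (trig p q x') (INR j))
      <= (2 * (2 * PI * C0 / s) + 2 * PI * C0) * Rpower (Rabs (x - x')) s).
Proof.
intros Hs HC Hpq G1 G2 j Hj. pose proof PI_RGT_0 as HPI.
set (A := 2 * PI * C0 / s).
assert (HA : 0 <= A).
{ unfold A. apply Rmult_le_pos; [nra|left; now apply Rinv_0_lt_compat]. }
assert (H : forall x, is_lim_seq (fun m => Lap (trig p q x) (INR j) (yseq m)) (bdry (trig p q x) (INR j)) /\
   forall y, 0 < y -> Rabs (Lap (trig p q x) (INR j) y - bdry (trig p q x) (INR j)) <= A * Rpower y s).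
{ intros x. apply Lap_bdry; [exact Hs|exact HA|]. intros y1 y2 Hy.
  apply Lap_vertical_increment; [now apply trig_summable|exact Hy|exact Hs|].
  intros v Hv. now apply G1. }
split; [intros x; apply H|]. split; [intros x y Hy; now apply H|].
intros x x' Hx. set (y := Rabs (x - x')). assert (Hy : 0 < y) by (apply Rabs_pos_lt; lra).
destruct (H x) as [_ H1]. destruct (H x') as [_ H2]. specialize (H1 y Hy). specialize (H2 y Hy).
assert (H3 : Rabs (Lap (trig p q x) (INR j) y - Lap (trig p q x') (INR j) y) <= 2 * PI * C0 * Rpower y s).
{ destruct (MVT_gen (fun x => Lap (trig p q x) (INR j) y) x' x
    (fun x => 2 * PI * Lap (trig q (fun n => - p n) x) (INR j + 1) y)) as [c [_ E]].
  - intros t _. now apply is_derive_Lap_trig.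
  - intros t _. apply continuity_pt_filterlim.
    apply (ex_derive_continuous (V := R_NormedModule) (fun x => Lap (trig p q x) (INR j) y)).
    eexists. now apply is_derive_Lap_trig.
  - rewrite E, !Rabs_mult. fold y. rewrite (Rabs_pos_eq 2), (Rabs_pos_eq PI) by lra.
    replace (Rpower y s) with (Rpower y (s - 1) * y).
    + rewrite <- Rmult_assoc. apply Rmult_le_compat_r; [lra|]. rewrite Rmult_assoc.
      rewrite (Rmult_assoc (2 * PI)), (Rmult_assoc 2 PI). apply Rmult_le_compat_l; [lra|].
      apply Rmult_le_compat_l; [lra|]. now apply G2.
    + rewrite <- (Rpower_1 y) at 2 by exact Hy. rewrite <- Rpower_plus. f_equal. ring. }
replace ((2 * A + 2 * PI * C0) * Rpower y s) with (A * Rpower y s + 2 * PI * C0 * Rpower y s + A * Rpower y s) by ring.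
apply Rabs_le_between in H1. apply Rabs_le_between in H2. apply Rabs_le_between in H3.
apply Rabs_le. lra.
Qed.

Lemma Holder_continuous (f : R -> R) B s t : 0 < s ->
  (exists delta, 0 < delta /\ forall u, u <> t -> Rabs (u - t) < delta ->
     Rabs (f u - f t) <= B * Rpower (Rabs (u - t)) s) -> continuous f t.
Proof.
intros Hs [delta [Hdelta H]]. apply filterlim_locally. intros eps.
set (B' := Rabs B). assert (HB : 0 <= B') by apply Rabs_pos. pose proof (Rle_abs B) as HBB.
assert (He : 0 < eps / (B' + 1)) by (apply Rdiv_lt_0_compat; [apply cond_pos|lra]).
assert (Hd : 0 < Rmin delta (Rpower (eps / (B' + 1)) (/ s))) by (apply Rmin_glb_lt; [exact Hdelta|apply Rpower_gt0]).
exists (mkposreal _ Hd). intros u Hu.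
change (Rabs (u - t) < Rmin delta (Rpower (eps / (B' + 1)) (/ s))) in Hu.
change (Rabs (f u - f t) < eps).
destruct (Req_dec u t) as [->|Hut]; [rewrite Rminus_diag, Rabs_R0; apply cond_pos|].
assert (Hu1 : Rabs (u - t) < delta) by (eapply Rlt_le_trans; [exact Hu|apply Rmin_l]).
assert (Hu2 : Rabs (u - t) < Rpower (eps / (B' + 1)) (/ s)) by (eapply Rlt_le_trans; [exact Hu|apply Rmin_r]).
eapply Rle_lt_trans; [now apply H|].
assert (Hlt : Rpower (Rabs (u - t)) s < eps / (B' + 1)).
{ replace (eps / (B' + 1)) with (Rpower (Rpower (eps / (B' + 1)) (/ s)) s).
  - apply Rlt_Rpower_l; [exact Hs|]. split; [apply Rabs_pos_lt; lra|exact Hu2].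
  - rewrite Rpower_mult, Rinv_l, Rpower_1; [reflexivity|exact He|lra]. }
apply (Rmult_lt_compat_r (B' + 1)) in Hlt; [|lra].
unfold Rdiv in Hlt. rewrite (Rmult_assoc (pos eps)), Rinv_l, Rmult_1_r in Hlt by lra.
pose proof (Rpower_gt0 (Rabs (u - t)) s). fold B' in HBB. nra.
Qed.

(** Uniform convergence of the derivatives as y -> 0. *)
Lemma is_derive_bdry C0 s k p q : 0 < s -> 0 <= C0 -> abs_summable2 p q ->
  Lap_bound C0 s k p q -> Lap_bound C0 s k q (fun n => - p n) ->
  forall j x, (j < k)%nat ->
  is_derive (fun x => bdry (trig p q x) (INR j)) x
    (2 * PI * bdry (trig q (fun n => - p n) x) (INR (S j))).
Proof.
intros Hs HC Hpq G1 G2 j x Hj. pose proof PI_RGT_0 as HPI.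
destruct (bdry_estimates C0 s k p q Hs HC Hpq G1 G2 j ltac:(lia)) as [E1 _].
assert (Hpq' := abs_summable2_rot p q Hpq).
destruct (bdry_estimates C0 s k q (fun n => - p n) Hs HC Hpq' G2 (Lap_bound_opp _ _ _ _ _ G1) (S j) ltac:(lia))
  as [F1 [F2 F3]].
set (A := 2 * PI * C0 / s) in *.
set (B := 2 * A + 2 * PI * C0) in *.
assert (HA : 0 <= A).
{ unfold A. apply Rmult_le_pos; [nra|left; now apply Rinv_0_lt_compat]. }
assert (HB : 0 <= B) by (unfold B; nra).
apply is_derive_Reals.
apply (derivable_pt_lim_CVU (fun m t => Lap (trig p q t) (INR j) (yseq m))
  (fun m t => 2 * PI * Lap (trig q (fun n => - p n) t) (INR (S j)) (yseq m))
  (fun t => bdry (trig p q t) (INR j))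
  (fun t => 2 * PI * bdry (trig q (fun n => - p n) t) (INR (S j))) x x (mkposreal 1 Rlt_0_1)).
- unfold Boule. simpl. rewrite Rminus_diag, Rabs_R0. lra.
- intros t m _. apply is_derive_Reals. rewrite S_INR. apply is_derive_Lap_trig; [exact Hpq|apply yseq_gt0].
- intros t _. apply is_lim_seq_Reals. apply E1.
- intros eps Heps.
  pose proof (is_lim_Rpower_0 yseq s yseq_gt0 is_lim_yseq Hs) as Hy0. apply is_lim_seq_spec in Hy0.
  destruct (Hy0 (mkposreal (eps / (2 * PI * A + 1)) ltac:(apply Rdiv_lt_0_compat; [exact Heps|nra]))) as [N HN].
  simpl in HN. exists N. intros m t Hm _. specialize (HN m Hm).
  rewrite Rminus_0_r, Rabs_pos_eq in HN by (left; apply Rpower_gt0).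
  rewrite <- Rmult_minus_distr_l, Rabs_mult, (Rabs_pos_eq (2 * PI)) by lra.
  rewrite Rabs_minus_sym. specialize (F2 t (yseq m) (yseq_gt0 m)).
  apply (Rmult_lt_compat_r (2 * PI * A + 1)) in HN; [|nra].
  unfold Rdiv in HN. rewrite (Rmult_assoc eps), Rinv_l, Rmult_1_r in HN by nra.
  pose proof (Rpower_gt0 (yseq m) s).
  apply (Rmult_le_compat_l (2 * PI)) in F2; [|lra]. nra.
- intros t _. apply continuity_pt_filterlim.
  apply (continuous_scal_r (K := R_AbsRing) (V := R_NormedModule) (2 * PI)
    (fun t => bdry (trig q (fun n => - p n) t) (INR (S j)))).
  apply (Holder_continuous _ B s); [exact Hs|].
  exists 1. split; [lra|]. intros u Hu _. now apply F3.
Qed.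

(** The derivatives of order up to k are the boundary values of the rotated series. *)
Lemma trig_series_regularity C0 s k p q : 0 < s -> 0 <= C0 -> abs_summable2 p q ->
  Lap_bound C0 s k p q -> Lap_bound C0 s k q (fun n => - p n) ->
  let phi := fun x => Series (trig p q x) in
  (forall j x, (j <= k)%nat -> ex_derive_n phi j x) /\
  exists K, 0 <= K /\ forall x x', x <> x' ->
    Rabs (Derive_n phi k x - Derive_n phi k x') <= K * Rpower (Rabs (x - x')) s.
Proof.
intros Hs HC Hpq G1 G2 phi. pose proof PI_RGT_0 as HPI.
assert (Hrot : forall j, abs_summable2 (fst (rot j p q)) (snd (rot j p q)) /\
  Lap_bound C0 s k (fst (rot j p q)) (snd (rot j p q)) /\
  Lap_bound C0 s k (snd (rot j p q)) (fun n => - fst (rot j p q) n)).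
{ induction j as [|j [I1 [I2 I3]]]; [now split|]. simpl. split; [now apply abs_summable2_rot|].
  split; [exact I3|]. now apply Lap_bound_opp. }
assert (HD : forall j, (j <= k)%nat -> forall x, Derive_n phi j x =
   (2 * PI) ^ j * bdry (trig (fst (rot j p q)) (snd (rot j p q)) x) (INR j)).
{ induction j as [|j IH]; intros Hj x.
  - simpl. rewrite Rmult_1_l. unfold phi.
    pose proof (bdry_0 (trig p q x) (trig_summable p q x Hpq)) as H.
    unfold bdry. now rewrite (is_lim_seq_unique _ _ H).
  - simpl Derive_n. rewrite (Derive_ext _ _ x (IH ltac:(lia))).
    destruct (Hrot j) as [I1 [I2 I3]].
    apply is_derive_unique.
    replace ((2 * PI) ^ S j * bdry (trig (fst (rot (S j) p q)) (snd (rot (S j) p q)) x) (INR (S j)))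
      with ((2 * PI) ^ j * (2 * PI * bdry (trig (snd (rot j p q)) (fun n => - fst (rot j p q) n) x) (INR (S j))))
      by (cbn [rot fst snd]; change ((2 * PI) ^ S j) with (2 * PI * (2 * PI) ^ j); ring).
    apply is_derive_scal. apply (is_derive_bdry C0 s k); try assumption; lia. }
split.
- intros j x Hj. destruct j as [|j]; [exact I|]. simpl.
  destruct (Hrot j) as [I1 [I2 I3]].
  eapply ex_derive_ext; [intros t; symmetry; apply (HD j ltac:(lia))|].
  apply ex_derive_scal. eexists. apply (is_derive_bdry C0 s k); try assumption; lia.
- destruct (Hrot k) as [I1 [I2 I3]].
  destruct (bdry_estimates C0 s k _ _ Hs HC I1 I2 I3 k (le_n k)) as [_ [_ F]].
  assert (HA : 0 <= 2 * PI * C0 / s).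
  { apply Rmult_le_pos; [nra|left; now apply Rinv_0_lt_compat]. }
  assert (Hk : 0 < (2 * PI) ^ k) by (apply pow_lt; lra).
  exists ((2 * PI) ^ k * (2 * (2 * PI * C0 / s) + 2 * PI * C0)). split.
  + apply Rmult_le_pos; nra.
  + intros x x' Hx. rewrite !HD by lia. rewrite <- Rmult_minus_distr_l, Rabs_mult, (Rabs_pos_eq ((2 * PI) ^ k)) by lra.
    rewrite Rmult_assoc. apply Rmult_le_compat_l; [lra|]. now apply F.
Qed.

(** * Comparison of the Hoelder classes *)

Lemma continuous_of_ccont (g : R -> C) x : ccont g x -> continuous g x.
Proof.
intros [H1 H2]. apply (filterlim_locally (U := C_UniformSpace)). intros eps.
assert (F1 := proj1 (filterlim_locally _ _) H1 eps).
assert (F2 := proj1 (filterlim_locally _ _) H2 eps).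
apply filter_imp with (2 := filter_and _ _ F1 F2). intros u [Hu1 Hu2]. now split.
Qed.

Lemma ccont_of_continuous (g : R -> C) x : continuous g x -> ccont g x.
Proof.
intros H. assert (F := proj1 (filterlim_locally (U := C_UniformSpace) _ _) H).
split; apply filterlim_locally; intros eps; apply filter_imp with (2 := F eps); intros u [Hu1 Hu2]; assumption.
Qed.

Lemma is_derive_poly (a : nat -> R) x0 x k :
  is_derive (fun x => sum_n (fun i => a i * (x - x0) ^ i) (S k)) x
    (sum_n (fun i => INR (S i) * a (S i) * (x - x0) ^ i) k).
Proof.
induction k as [|k IH].
- apply (is_derive_ext (fun x => a 0%nat + a 1%nat * (x - x0))).
  + intros t. rewrite sum_Sn, sum_O. unfold plus; simpl. ring.
  + rewrite sum_O. auto_derive; [trivial|]. simpl. ring.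
- apply (is_derive_ext (fun x => sum_n (fun i => a i * (x - x0) ^ i) (S k) + a (S (S k)) * (x - x0) ^ (S (S k)))).
  + intros t. now rewrite (sum_Sn _ (S k)).
  + rewrite sum_Sn. apply (is_derive_plus (V := R_NormedModule)); [exact IH|].
    replace (INR (S (S k)) * a (S (S k)) * (x - x0) ^ S k) with
      (a (S (S k)) * (INR (S (S k)) * 1 * (x - x0) ^ pred (S (S k)))) by (simpl pred; ring).
    apply (is_derive_scal (fun t => (t - x0) ^ S (S k))). apply (is_derive_pow (fun t => t - x0)). auto_derive; [trivial|ring].
Qed.

(** Integrating the expansion of the derivative raises the order by one.  Only the constant
    coefficient has to be named: it makes the remainder of the derivative vanish at x0. *)
Lemma Taylor_Holder (lo hi x0 s K : R) : lo < x0 < hi -> 0 <= s -> 0 <= K ->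
  forall k (f : R -> R),
  (forall j x, (j <= k)%nat -> lo < x < hi -> ex_derive_n f j x) ->
  (exists delta, 0 < delta /\ forall x, x <> x0 -> Rabs (x - x0) < delta ->
     Rabs (Derive_n f k x - Derive_n f k x0) <= K * Rpower (Rabs (x - x0)) s) ->
  exists a : nat -> R, a 0%nat = f x0 /\ exists delta, 0 < delta /\
    forall x, x <> x0 -> Rabs (x - x0) < delta ->
      Rabs (f x - sum_n (fun i => a i * (x - x0) ^ i) k) <= K * Rpower (Rabs (x - x0)) (INR k + s).
Proof.
intros Hx0 Hs HK. induction k as [|k IH]; intros f Hd [delta [Hdelta HL]].
- exists (fun _ => f x0). split; [reflexivity|]. exists delta. split; [exact Hdelta|].
  intros x Hx Hxd. rewrite sum_O. simpl. rewrite Rplus_0_l, Rmult_1_r. now apply HL.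
- assert (Hcomp : forall j x, Derive_n (Derive f) j x = Derive_n f (S j) x).
  { intros j x. rewrite <- (Nat.add_1_r j). symmetry.
    rewrite <- (Derive_n_comp f j 1 x). reflexivity. }
  destruct (IH (Derive f)) as [a' [Ha0 [delta' [Hdelta' HT]]]].
  + intros j x Hj Hx. destruct j as [|j]; [exact I|]. simpl.
    eapply ex_derive_ext; [intros t; symmetry; apply Hcomp|]. apply (Hd (S (S j)) x); [lia|exact Hx].
  + exists delta. split; [exact Hdelta|]. intros x Hx Hxd. rewrite !Hcomp. now apply HL.
  + set (a := fun i => match i with O => f x0 | S i' => a' i' / INR (S i') end). exists a.
    split; [reflexivity|].
    set (d := Rmin delta' (Rmin (x0 - lo) (hi - x0))).
    assert (Hdp : 0 < d) by (repeat apply Rmin_glb_lt; lra).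
    assert (Hd1 : d <= delta') by apply Rmin_l.
    assert (Hd2 : d <= x0 - lo) by (eapply Rle_trans; [apply Rmin_r|apply Rmin_l]).
    assert (Hd3 : d <= hi - x0) by (eapply Rle_trans; [apply Rmin_r|apply Rmin_r]).
    exists d. split; [exact Hdp|]. intros x Hx Hxd.
    assert (Hder : forall t, Rabs (t - x0) < d ->
      is_derive (fun t => f t - sum_n (fun i => a i * (t - x0) ^ i) (S k)) t
        (Derive f t - sum_n (fun i => a' i * (t - x0) ^ i) k)).
    { intros t Ht. apply Rabs_def2 in Ht.
      apply (is_derive_minus (V := R_NormedModule)).
      - apply Derive_correct. apply (Hd 1%nat t); [lia|lra].
      - replace (sum_n (fun i => a' i * (t - x0) ^ i) k)
          with (sum_n (fun i => INR (S i) * a (S i) * (t - x0) ^ i) k).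
        + apply is_derive_poly.
        + apply sum_n_ext_R. intros i. unfold a. field. apply not_0_INR. lia. }
    assert (Hbt : forall c, Rmin x0 x <= c <= Rmax x0 x -> Rabs (c - x0) <= Rabs (x - x0)).
    { intros c. unfold Rmin, Rmax. destruct (Rle_dec x0 x); unfold Rabs; repeat destruct Rcase_abs; lra. }
    destruct (MVT_gen (fun t => f t - sum_n (fun i => a i * (t - x0) ^ i) (S k)) x0 x
      (fun t => Derive f t - sum_n (fun i => a' i * (t - x0) ^ i) k)) as [c [Hc E]].
    * intros t Ht. apply Hder. eapply Rle_lt_trans; [apply Hbt; lra|exact Hxd].
    * intros t Ht. apply continuity_pt_filterlim.
      apply (ex_derive_continuous (V := R_NormedModule) (fun t => f t - sum_n (fun i => a i * (t - x0) ^ i) (S k))).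
      eexists. apply Hder. eapply Rle_lt_trans; [now apply Hbt|exact Hxd].
    * assert (Hsum0 : forall (b : nat -> R) n, sum_n (fun i => b i * (x0 - x0) ^ i) n = b 0%nat).
      { intros b. induction n as [|n IHn]; [rewrite sum_O; simpl; ring|].
        rewrite sum_Sn, IHn. unfold plus; simpl. ring. }
      cbv beta in E. rewrite Hsum0 in E. change (a 0%nat) with (f x0) in E.
      rewrite Rminus_diag, Rminus_0_r in E. rewrite E, Rabs_mult.
      assert (Hxp : 0 < Rabs (x - x0)) by (apply Rabs_pos_lt; lra).
      replace (Rpower (Rabs (x - x0)) (INR (S k) + s)) with (Rpower (Rabs (x - x0)) (INR k + s) * Rabs (x - x0)).
      2:{ rewrite <- (Rpower_1 (Rabs (x - x0))) at 2 by exact Hxp. rewrite <- Rpower_plus, S_INR. f_equal. ring. }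
      rewrite <- Rmult_assoc. apply Rmult_le_compat_r; [lra|].
      specialize (Hbt c Hc). pose proof (pos_INR k) as Hk.
      destruct (Req_dec c x0) as [->|Hcx].
      -- rewrite Hsum0, Ha0, Rminus_diag, Rabs_R0. apply Rmult_le_pos; [exact HK|left; apply Rpower_gt0].
      -- eapply Rle_trans; [apply HT; [exact Hcx|lra]|].
         apply Rmult_le_compat_l; [exact HK|]. apply Rle_Rpower_l; [lra|].
         split; [apply Rabs_pos_lt; lra|exact Hbt].
Qed.

Lemma pointwise_of_derivatives (g : R -> C) k s x0 lo hi : 0 <= s -> lo < x0 < hi ->
  Ccontinuous g -> k_differentiable_on (open_interval lo hi) k g ->
  Lambda_C s x0 (CDerive_n g k) -> pointwise_C (INR k + s) x0 g.
Proof.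
intros Hs Hx0 Hg Hd [K [delta [Hdelta HL]]].
split; [exact Hg|].
set (K' := Rabs K). assert (HK' : 0 <= K') by apply Rabs_pos.
assert (HL' : forall x, x <> x0 -> Rabs (x - x0) < delta ->
  Cmod (CDerive_n g k x - CDerive_n g k x0)%C <= K' * Rpower (Rabs (x - x0)) s).
{ intros x Hx Hxd. eapply Rle_trans; [now apply HL|]. apply Rmult_le_compat_r; [left; apply Rpower_gt0|apply Rle_abs]. }
destruct (Taylor_Holder lo hi x0 s K' Hx0 Hs HK' k (fun t => Re (g t))) as [a [_ [d1 [Hd1 Ha]]]].
- intros j x Hj Hx. now apply Hd.
- exists delta. split; [exact Hdelta|]. intros x Hx Hxd. eapply Rle_trans; [|now apply HL'].
  apply (Rabs_Re_le (CDerive_n g k x - CDerive_n g k x0)%C).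
- destruct (Taylor_Holder lo hi x0 s K' Hx0 Hs HK' k (fun t => Im (g t))) as [b [_ [d2 [Hd2 Hb]]]].
  + intros j x Hj Hx. now apply Hd.
  + exists delta. split; [exact Hdelta|]. intros x Hx Hxd. eapply Rle_trans; [|now apply HL'].
    apply (Rabs_Im_le (CDerive_n g k x - CDerive_n g k x0)%C).
  + exists k, (fun i => (a i, b i)). split; [lra|].
    exists (2 * K'), (Rmin d1 d2). split; [now apply Rmin_glb_lt|].
    intros x Hx Hxd.
    assert (H1 := Ha x Hx (Rlt_le_trans _ _ _ Hxd (Rmin_l _ _))).
    assert (H2 := Hb x Hx (Rlt_le_trans _ _ _ Hxd (Rmin_r _ _))).
    eapply Rle_trans; [apply Cmod_le_Re_Im|].
    rewrite Re_minus, Im_minus, Re_sum_n, Im_sum_n.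
    rewrite (sum_n_ext_R (fun n => Re ((a n, b n) * RtoC ((x - x0) ^ n))%C) (fun i => a i * (x - x0) ^ i))
      by (intros; simpl; ring).
    rewrite (sum_n_ext_R (fun n => Im ((a n, b n) * RtoC ((x - x0) ^ n))%C) (fun i => b i * (x - x0) ^ i))
      by (intros; simpl; ring).
    lra.
Qed.

Lemma restricted_pointwise g k s x0 : 0 < s -> restricted_C k s x0 g -> pointwise_C (INR k + s) x0 g.
Proof.
intros Hs [Hg [[lo [hi [Hx0 [Hd _]]]] HL]].
apply (pointwise_of_derivatives g k s x0 lo hi); try assumption; lra.
Qed.

Lemma CDerive_n_continuous_of_Holder g k s K lo hi x : 0 < s -> lo < x < hi ->
  (forall x y, lo < x < hi -> lo < y < hi -> x <> y ->
     Cmod (CDerive_n g k x - CDerive_n g k y)%C <= K * Rpower (Rabs (x - y)) s) ->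
  continuous (CDerive_n g k) x.
Proof.
intros Hs Hx H. apply continuous_of_ccont.
assert (Hd : 0 < Rmin (x - lo) (hi - x)) by (apply Rmin_glb_lt; lra).
split; apply (Holder_continuous _ K s x Hs); exists (Rmin (x - lo) (hi - x)); (split; [exact Hd|]);
  intros u Hu Hux; (eapply Rle_trans; [|apply (H u x); [|exact Hx|exact Hu]]).
- apply (Rabs_Re_le (CDerive_n g k u - CDerive_n g k x)%C).
- pose proof (Rmin_l (x - lo) (hi - x)). pose proof (Rmin_r (x - lo) (hi - x)). apply Rabs_def2 in Hux. lra.
- apply (Rabs_Im_le (CDerive_n g k u - CDerive_n g k x)%C).
- pose proof (Rmin_l (x - lo) (hi - x)). pose proof (Rmin_r (x - lo) (hi - x)). apply Rabs_def2 in Hux. lra.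
Qed.

Lemma uniform_restricted g k s x0 lo hi : 0 < s -> lo < x0 < hi -> Ccontinuous g ->
  uniform_C k s (open_interval lo hi) g -> restricted_C k s x0 g.
Proof.
intros Hs Hx0 Hg [Hd [[_ [K HK]]|[H0 _]]]; [|lra].
split; [exact Hg|]. split.
- exists lo, hi. split; [exact Hx0|]. split; [exact Hd|].
  intros x Hx. now apply (CDerive_n_continuous_of_Holder g k s K lo hi).
- exists K, (Rmin (x0 - lo) (hi - x0)). split; [apply Rmin_glb_lt; lra|].
  intros x Hx Hxd. apply HK; [|exact Hx0|exact Hx].
  pose proof (Rmin_l (x0 - lo) (hi - x0)). pose proof (Rmin_r (x0 - lo) (hi - x0)).
  apply Rabs_def2 in Hxd. unfold open_interval. lra.
Qed.

Lemma uniform_pointwise g k s x0 lo hi : 0 <= s -> lo < x0 < hi -> Ccontinuous g ->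
  uniform_C k s (open_interval lo hi) g -> pointwise_C (INR k + s) x0 g.
Proof.
intros Hs Hx0 Hg H. destruct (Rle_lt_or_eq_dec 0 s Hs) as [Hs'|Hs'].
- apply restricted_pointwise; [exact Hs'|]. now apply (uniform_restricted g k s x0 lo hi).
- destruct H as [Hd [[H0 _]|[_ Hc]]]; [lra|].
  apply (pointwise_of_derivatives g k s x0 lo hi); try assumption.
  (* near x0 a continuous function varies by at most 2, and the exponent is 0 *)
  destruct (ccont_of_continuous _ _ (Hc k x0 (le_n k) Hx0)) as [C1 C2].
  assert (F1 := proj1 (filterlim_locally _ _) C1 (mkposreal 1 Rlt_0_1)).
  assert (F2 := proj1 (filterlim_locally _ _) C2 (mkposreal 1 Rlt_0_1)).
  destruct (filter_and _ _ F1 F2) as [eps He].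
  exists 2, eps. split; [apply cond_pos|]. intros x Hx Hxd.
  destruct (He x Hxd) as [B1 B2].
  change (Rabs (Re (CDerive_n g k x) - Re (CDerive_n g k x0)) < 1) in B1.
  change (Rabs (Im (CDerive_n g k x) - Im (CDerive_n g k x0)) < 1) in B2.
  rewrite <- Hs', Rpower_O by (apply Rabs_pos_lt; lra).
  eapply Rle_trans; [apply Cmod_le_Re_Im|]. rewrite Re_minus, Im_minus. lra.
Qed.

Lemma uniform_C_subset (U V : R -> Prop) k s g : (forall x, V x -> U x) -> uniform_C k s U g -> uniform_C k s V g.
Proof.
intros HVU [Hd H]. split.
- intros j x Hj Hx. apply Hd; auto.
- destruct H as [[Hs [K HK]]|[Hs Hc]]; [left|right].
  + split; [exact Hs|]. exists K. auto.
  + split; [exact Hs|]. auto.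
Qed.

Lemma Lub_Rbar_eq (E : R -> Prop) v : 0 < v -> (forall t, E t -> t <= v) ->
  (forall t, 0 <= t < v -> exists t', E t' /\ t < t') -> Lub_Rbar E = Finite v.
Proof.
intros Hv Hub Hlb. apply is_lub_Rbar_unique. split.
- intros t Ht. simpl. now apply Hub.
- intros b Hb. destruct b as [b| |]; simpl; [|exact I|].
  + apply Rnot_lt_le. intros Hlt.
    destruct (Hlb (Rmax b 0)) as [t' [Ht' Hlt']].
    * split; [apply Rmax_r|]. now apply Rmax_lub_lt.
    * specialize (Hb t' Ht'). simpl in Hb. pose proof (Rmax_l b 0). lra.
  + destruct (Hlb 0) as [t' [Ht' _]]; [lra|]. exact (Hb t' Ht').
Qed.

(** All three exponents are squeezed between global regularity from below and the
    pointwise exponent from above. *)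
Lemma all_holder_exponents_criterion g x0 v : 0 < v -> Ccontinuous g ->
  (forall t, 0 <= t -> pointwise_C t x0 g -> t <= v) ->
  (forall t, 0 <= t < v -> exists k s, 0 < s <= 1 /\ t < INR k + s /\ uniform_C k s (fun _ => True) g) ->
  all_holder_exponents_eq g x0 v.
Proof.
intros Hv Hg Hub Hlb. split; [|split].
- apply Lub_Rbar_eq; [exact Hv| |].
  + intros t [Ht HP]. now apply Hub.
  + intros t Ht. destruct (Hlb t Ht) as (k & s & Hs & Hts & HU).
    exists (INR k + s). split; [|exact Hts]. split; [pose proof (pos_INR k); lra|].
    apply (uniform_pointwise g k s x0 (x0 - 1) (x0 + 1)); [lra|lra|exact Hg|].
    now apply (uniform_C_subset (fun _ => True)).
- apply Lub_Rbar_eq; [exact Hv| |].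
  + intros t (k & s & Hs & -> & HR). apply Hub; [pose proof (pos_INR k); lra|].
    apply restricted_pointwise; [lra|exact HR].
  + intros t Ht. destruct (Hlb t Ht) as (k & s & Hs & Hts & HU).
    exists (INR k + s). split; [|exact Hts]. exists k, s. split; [exact Hs|]. split; [reflexivity|].
    apply (uniform_restricted g k s x0 (x0 - 1) (x0 + 1)); [lra|lra|exact Hg|].
    now apply (uniform_C_subset (fun _ => True)).
- intros lo hi [_ Hint].
  assert (E : forall n, local_sup g (open_interval (lo n) (hi n)) = Finite v).
  { intros n. assert (Hx0 : lo n < x0 < hi n) by (apply (proj2 (Hint x0) eq_refl n)).
    apply Lub_Rbar_eq; [exact Hv| |].
    - intros t (k & s & Hs & -> & HR). apply Hub; [pose proof (pos_INR k); lra|].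
      apply (uniform_pointwise g k s x0 (lo n) (hi n)); [lra|exact Hx0|exact Hg|exact HR].
    - intros t Ht. destruct (Hlb t Ht) as (k & s & Hs & Hts & HU).
      exists (INR k + s). split; [|exact Hts]. exists k, s. split; [lra|]. split; [reflexivity|].
      now apply (uniform_C_subset (fun _ => True)). }
  split; intros y Hy; exists 0%nat; intros n _; now rewrite E.
Qed.

(** * Size of the fractional derivatives and integrals of the form *)

(** With c the coefficients of the series on the real line, g = alpha gives the modular form
    at x + iy. *)
Definition Elap (c : nat -> C) (g x y : R) : C :=
  CSeries (fun n => c n * RtoC (wgt g y n) * cis (freq n * x))%C.

Lemma Elap_term_mod c g x y n :
  Cmod (c n * RtoC (wgt g y n) * cis (freq n * x))%C = Cmod (c n) * wgt g y n.
Proof.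
rewrite !Cmod_mult, Cmod_cis, Cmod_R, Rmult_1_r, Rabs_pos_eq; [reflexivity|left; apply wgt_gt0].
Qed.

Lemma ex_series_Cmod_wgt c g y : Csummable c -> 0 < y -> ex_series (fun n => Cmod (c n) * wgt g y n).
Proof.
intros Hc Hy. destruct (wgt_bounded g y Hy) as [B [HB H]].
apply ex_series_dom with (b := fun n => Cmod (c n) * B); [|now apply ex_series_scal_r].
intros n. rewrite Rabs_mult, (Rabs_pos_eq (Cmod _)), (Rabs_pos_eq (wgt _ _ _))
  by (first [apply Cmod_ge_0|left; apply wgt_gt0]).
apply Rmult_le_compat_l; [apply Cmod_ge_0|apply H].
Qed.

Lemma Elap_summable c g x y : Csummable c -> 0 < y ->
  Csummable (fun n => c n * RtoC (wgt g y n) * cis (freq n * x))%C.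
Proof.
intros Hc Hy. apply Csummable_dom with (fun n => Cmod (c n) * wgt g y n).
- intros n. rewrite Elap_term_mod. lra.
- now apply ex_series_Cmod_wgt.
Qed.

Lemma Re_Elap c g x y :
  Re (Elap c g x y) = Lap (trig (fun n => Re (c n)) (fun n => - Im (c n)) x) g y.
Proof. apply Series_ext. intros n. unfold trig, cis, Cmult, RtoC, Re, Im. cbn [fst snd]. ring. Qed.

Lemma Im_Elap c g x y :
  Im (Elap c g x y) = Lap (trig (fun n => Im (c n)) (fun n => Re (c n)) x) g y.
Proof. apply Series_ext. intros n. unfold trig, cis, Cmult, RtoC, Re, Im. cbn [fst snd]. ring. Qed.

Lemma abs_summable2_Csummable c (p q : nat -> R) K : Csummable c ->
  (forall n, Rabs (p n) <= K * Cmod (c n)) -> (forall n, Rabs (q n) <= K * Cmod (c n)) -> abs_summable2 p q.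
Proof.
intros Hc Hp Hq. apply ex_series_dom with (b := fun n => (2 * K) * Cmod (c n)).
- intros n. specialize (Hp n). specialize (Hq n). pose proof (Rabs_pos (p n)). pose proof (Rabs_pos (q n)).
  rewrite Rabs_pos_eq; lra.
- now apply (ex_series_scal (V := R_NormedModule) (2 * K) (fun n => Cmod (c n))).
Qed.

Lemma Elap_fractional_integral d rho : 0 < d < rho -> exists K, 0 < K /\
  forall c g x y C0, Csummable c -> 0 < y -> 0 <= C0 ->
    (forall v, y <= v -> Cmod (Elap c g x v) <= C0 * Rpower v (- rho)) ->
    Cmod (Elap c (g - d) x y) <= K * C0 * Rpower y (d - rho).
Proof.
intros Hd. destruct (Lap_fractional_integral d rho Hd) as [K [HK H]].
exists (2 * K). split; [lra|]. intros c g x y C0 Hc Hy HC HE.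
eapply Rle_trans; [apply Cmod_le_Re_Im|]. rewrite Re_Elap, Im_Elap.
replace (2 * K * C0 * Rpower y (d - rho)) with (K * C0 * Rpower y (d - rho) + K * C0 * Rpower y (d - rho)) by ring.
apply Rplus_le_compat; (apply H; [|exact Hy|exact HC|]).
- apply trig_summable, (abs_summable2_Csummable c _ _ 1 Hc); intros n; rewrite ?Rabs_Ropp, Rmult_1_l;
    [apply Rabs_Re_le|apply Rabs_Im_le].
- intros v Hv. rewrite <- Re_Elap. eapply Rle_trans; [apply Rabs_Re_le|now apply HE].
- apply trig_summable, (abs_summable2_Csummable c _ _ 1 Hc); intros n; rewrite ?Rabs_Ropp, Rmult_1_l;
    [apply Rabs_Im_le|apply Rabs_Re_le].
- intros v Hv. rewrite <- Im_Elap. eapply Rle_trans; [apply Rabs_Im_le|now apply HE].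
Qed.

(** Exponential decay at the cusp, in the polynomial form used for the integrals. *)
Lemma Elap_decay c g rho : Csummable c -> exists K, 0 < K /\
  forall x y, 1 <= y -> Cmod (Elap c g x y) <= K * Rpower y (- rho).
Proof.
intros Hc. pose proof PI_ge_1 as HPI.
destruct (Rpower_exp_bounded rho PI) as [B [HB HBx]]; [lra|].
set (S0 := Series (fun n => Cmod (c n) * wgt g (/ 2) n)).
assert (Hser : ex_series (fun n => Cmod (c n) * wgt g (/ 2) n)) by (apply ex_series_Cmod_wgt; [exact Hc|lra]).
assert (HS0 : 0 <= S0).
{ assert (Hn : forall n, 0 <= Cmod (c n) * wgt g (/ 2) n).
  { intros n. apply Rmult_le_pos; [apply Cmod_ge_0|left; apply wgt_gt0]. }
  pose proof (sum_n_le_Series _ 0 Hn Hser) as H. rewrite sum_O in H. specialize (Hn 0%nat). unfold S0. lra. }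
exists (S0 * B + 1). split; [nra|]. intros x y Hy.
assert (H1 : Cmod (Elap c g x y) <= S0 * exp (- (PI * y))).
{ unfold S0. rewrite <- Series_scal_r. apply Cmod_CSeries_le; [|now apply ex_series_scal_r].
  intros n. rewrite Elap_term_mod, Rmult_assoc. apply Rmult_le_compat_l; [apply Cmod_ge_0|].
  unfold wgt. rewrite (Rmult_assoc (Rpower _ _)). apply Rmult_le_compat_l; [left; apply exp_pos|].
  rewrite <- exp_plus. pose proof (freq_ge1 n) as Hf.
  destruct (Req_dec (- (2 * PI * freq n * y)) (- (2 * PI * freq n * / 2) + - (PI * y))) as [->|Hne]; [lra|].
  left. apply exp_increasing.
  assert (0 <= PI * (freq n - 1) * (2 * y - 1)) by (apply Rmult_le_pos; [apply Rmult_le_pos|]; lra).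
  assert (0 <= PI * (y - 1)) by (apply Rmult_le_pos; lra). lra. }
eapply Rle_trans; [exact H1|]. specialize (HBx y Hy).
rewrite Rpower_Ropp. pose proof (Rpower_gt0 y rho) as Hp.
apply (Rmult_le_reg_r (Rpower y rho)); [exact Hp|].
rewrite (Rmult_assoc (S0 * B + 1)), Rinv_l, Rmult_1_r by lra.
rewrite Rmult_assoc, (Rmult_comm (exp _)).
apply (Rmult_le_compat_l S0) in HBx; [lra|exact HS0].
Qed.

Lemma Rpower_le_of_le1 y a b : 0 < y <= 1 -> a <= b -> Rpower y b <= Rpower y a.
Proof.
intros Hy Hab. unfold Rpower.
assert (ln y <= 0) by (rewrite <- ln_1; apply ln_le; lra).
destruct (Req_dec (b * ln y) (a * ln y)) as [->|]; [lra|]. left; apply exp_increasing. nra.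
Qed.


Definition size_bound (c : nat -> C) (g rho : R) : Prop :=
  exists K, 0 < K /\ forall x y, 0 < y -> Cmod (Elap c g x y) <= K * Rpower y (- rho).

Lemma size_bound_weaken c g rho rho' : Csummable c -> rho <= rho' ->
  size_bound c g rho -> size_bound c g rho'.
Proof.
intros Hc Hr [K [HK H]]. destruct (Elap_decay c g rho' Hc) as [K' [HK' H']].
exists (K + K'). split; [lra|]. intros x y Hy. pose proof (Rpower_gt0 y (- rho')).
destruct (Rle_dec y 1) as [H1|H1].
- eapply Rle_trans; [now apply H|].
  assert (Rpower y (- rho) <= Rpower y (- rho')) by (apply Rpower_le_of_le1; lra). nra.
- eapply Rle_trans; [apply H'; lra|]. nra.
Qed.

(** The derivative is recovered from the values on the line of half the height by an
    analytic kernel; the integral of its modulus is of the order of 1/y. *)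
Lemma size_bound_derivative c g rho : Csummable c -> size_bound c g rho -> size_bound c (g + 1) (rho + 1).
Proof.
intros Hc [K [HK H]].
destruct (analytic_kernel_bound 0 1 0) as [K1 [HK1 Hker]]; [lra|lra|simpl; lra|].
destruct (Elap_decay c (g + 1) (rho + 1) Hc) as [K2 [HK2 Hdec]].
set (A := K1 * K * Rpower (/ 2) (- rho - 1)).
assert (HA : 0 < A) by (unfold A; repeat apply Rmult_lt_0_compat; first [assumption|apply Rpower_gt0]).
exists (A + K2). split; [lra|]. intros x y Hy. pose proof (Rpower_gt0 y (- (rho + 1))).
destruct (Rle_dec 1 y) as [H1|H1]; [eapply Rle_trans; [now apply Hdec|]; nra|].
set (d := fun n => (c n * RtoC (wgt g (y / 2) n) * cis (freq n * x))%C).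
assert (Hd : Csummable d) by (apply Elap_summable; [exact Hc|lra]).
assert (E : Elap c (g + 1) x y = CSeries (fun m => d m * RtoC (wgt (INR 1) (y / 2) m) * cis (freq m * 0))%C).
{ apply CSeries_ext. intros n. unfold d. rewrite Rmult_0_r, cis_0.
  replace (wgt (g + 1) y n) with (wgt g (y / 2) n * wgt (INR 1) (y / 2) n).
  - rewrite RtoC_mult. ring.
  - unfold wgt. simpl INR. rewrite Rpower_plus.
    replace (- (2 * PI * freq n * y)) with (- (2 * PI * freq n * (y / 2)) + - (2 * PI * freq n * (y / 2))) by field.
    rewrite exp_plus. ring. }
rewrite E.
assert (Hh : forall v, Elap c g (x + v) (y / 2) = CSeries (fun n => d n * cis (freq n * v))%C).
{ intros v. apply CSeries_ext. intros n. unfold d.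
  replace (freq n * (x + v)) with (freq n * x + freq n * v) by ring. rewrite cis_plus. ring. }
eapply Rle_trans; [apply (Hker (fun v => CSeries (fun n => d n * cis (freq n * v))%C) d (K * Rpower (y / 2) (- rho)))|].
- intros v. apply (ccont_CSeries (fun n v => d n * cis (freq n * v))%C (fun n => Cmod (d n))).
  + exact Hd.
  + intros n w. rewrite Cmod_mult, Cmod_cis. lra.
  + intros n. apply ccont_mult; [apply ccont_const|apply ccont_cis].
- exact Hd.
- intros m. now apply Fourier_coefficient.
- apply Rmult_le_pos; [lra|left; apply Rpower_gt0].
- lra.
- rewrite Rabs_R0. lra.
- intros v _. rewrite Rpower_O by (pose proof (Rabs_pos v); lra). rewrite Rmult_1_r, <- Hh. apply H. lra.
- simpl INR.
  assert (Hy2 : Rpower (y / 2) (- rho) * Rpower (y / 2) (0 - 1) = Rpower y (- (rho + 1)) * Rpower (/ 2) (- rho - 1)).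
  { rewrite <- Rpower_plus. replace (- rho + (0 - 1)) with (- rho - 1) by ring.
    replace (- (rho + 1)) with (- rho - 1) by ring. unfold Rdiv. symmetry. apply Rpower_mult_distr; lra. }
  replace (K1 * (K * Rpower (y / 2) (- rho)) * Rpower (y / 2) (0 - 1))
    with (A * Rpower y (- (rho + 1))).
  + nra.
  + unfold A. rewrite !Rmult_assoc, Hy2. ring.
Qed.

Lemma size_bound_fractional c g rho d : Csummable c -> 0 < d < rho -> size_bound c g rho ->
  size_bound c (g - d) (rho - d).
Proof.
intros Hc Hd [K [HK H]]. destruct (Elap_fractional_integral d rho Hd) as [K1 [HK1 H1]].
exists (K1 * K). split; [now apply Rmult_lt_0_compat|]. intros x y Hy.
replace (- (rho - d)) with (d - rho) by ring.
apply (H1 c g x y K Hc Hy); [lra|]. intros v Hv. apply H. lra.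
Qed.

(** * Regularity of the series on the real line *)

(** The exponential, cosine and sine series are the cases (1, 0), (1/2, 1/2) and (-i/2, i/2)
    of (la, mu). *)
Definition twosided (c : nat -> C) (la mu : C) (x : R) : C :=
  (la * CSeries (fun n => c n * cis (freq n * x)) + mu * CSeries (fun n => c n * cis (- (freq n * x))))%C.

Definition cos_coef (c : nat -> C) (la mu : C) (n : nat) : R := Re (la * c n)%C + Re (mu * c n)%C.
Definition sin_coef (c : nat -> C) (la mu : C) (n : nat) : R := Im (mu * c n)%C - Im (la * c n)%C.

Lemma cis_opp u : cis (- u) = (cos (2 * PI * u), - sin (2 * PI * u)).
Proof. unfold cis. rewrite <- cos_neg, <- sin_neg. f_equal; f_equal; ring. Qed.

Lemma Csummable_cis c (k : nat -> R) : Csummable c -> Csummable (fun n => c n * cis (k n))%C.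
Proof.
intros Hc. apply Csummable_dom with (fun n => Cmod (c n)); [|exact Hc].
intros n. rewrite Cmod_mult, Cmod_cis. lra.
Qed.

Lemma Re_twosided c la mu x : Csummable c ->
  Re (twosided c la mu x) = Series (trig (cos_coef c la mu) (sin_coef c la mu) x).
Proof.
intros Hc. unfold twosided.
pose proof (Csummable_cis c (fun n => freq n * x) Hc) as H1.
pose proof (Csummable_cis c (fun n => - (freq n * x)) Hc) as H2.
rewrite <- !CSeries_scal by assumption. rewrite Re_plus, !Re_CSeries.
rewrite <- Series_plus.
- apply Series_ext. intros n. rewrite cis_opp. unfold trig, cos_coef, sin_coef, cis, Cmult, Re, Im. cbn [fst snd]. ring.
- apply Csummable_Re, Csummable_dom with (fun n => Cmod la * Cmod (c n * cis (freq n * x))%C);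
    [intros n; rewrite Cmod_mult; lra|]. now apply (ex_series_scal (V := R_NormedModule) (Cmod la)).
- apply Csummable_Re, Csummable_dom with (fun n => Cmod mu * Cmod (c n * cis (- (freq n * x)))%C);
    [intros n; rewrite Cmod_mult; lra|]. now apply (ex_series_scal (V := R_NormedModule) (Cmod mu)).
Qed.

Lemma Lap_twosided c la mu g x y : Csummable c -> 0 < y ->
  Lap (trig (cos_coef c la mu) (sin_coef c la mu) x) g y = Re (la * Elap c g x y + mu * Elap c g (- x) y)%C.
Proof.
intros Hc Hy. unfold Elap.
pose proof (Elap_summable c g x y Hc Hy) as H1.
pose proof (Elap_summable c g (- x) y Hc Hy) as H2.
rewrite <- !CSeries_scal by assumption. rewrite Re_plus, !Re_CSeries.
rewrite <- Series_plus.
- apply Series_ext. intros n. replace (freq n * - x) with (- (freq n * x)) by ring. rewrite cis_opp.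
  unfold trig, cos_coef, sin_coef, cis, Cmult, RtoC, Re, Im. cbn [fst snd]. ring.
- apply Csummable_Re, Csummable_dom with (fun n => Cmod la * Cmod (c n * RtoC (wgt g y n) * cis (freq n * x))%C);
    [intros n; rewrite Cmod_mult; lra|]. now apply (ex_series_scal (V := R_NormedModule) (Cmod la)).
- apply Csummable_Re, Csummable_dom with (fun n => Cmod mu * Cmod (c n * RtoC (wgt g y n) * cis (freq n * - x))%C);
    [intros n; rewrite Cmod_mult; lra|]. now apply (ex_series_scal (V := R_NormedModule) (Cmod mu)).
Qed.

Lemma coef_abs_summable c la mu : Csummable c -> abs_summable2 (cos_coef c la mu) (sin_coef c la mu).
Proof.
intros Hc. apply (abs_summable2_Csummable c _ _ (Cmod la + Cmod mu) Hc); intros n;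
  rewrite Rmult_plus_distr_r, <- !Cmod_mult.
- unfold cos_coef. eapply Rle_trans; [apply Rabs_triang|]. apply Rplus_le_compat; apply Rabs_Re_le.
- unfold sin_coef, Rminus. eapply Rle_trans; [apply Rabs_triang|]. rewrite Rabs_Ropp, Rplus_comm.
  apply Rplus_le_compat; apply Rabs_Im_le.
Qed.

Definition real_regular (k : nat) (s : R) (phi : R -> R) : Prop :=
  (forall j x, (j <= k)%nat -> ex_derive_n phi j x) /\
  exists K, 0 <= K /\ forall x x', x <> x' ->
    Rabs (Derive_n phi k x - Derive_n phi k x') <= K * Rpower (Rabs (x - x')) s.

Lemma real_regular_ext k s phi psi : (forall x, phi x = psi x) -> real_regular k s phi -> real_regular k s psi.
Proof.
intros E [H1 [K [HK H2]]]. split.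
- intros j x Hj. apply (ex_derive_n_ext phi psi j x E). now apply H1.
- exists K. split; [exact HK|]. intros x x' Hx.
  rewrite <- !(Derive_n_ext phi psi k _ E). now apply H2.
Qed.

Lemma Re_twosided_regular c la mu alpha rho k s : Csummable c -> size_bound c alpha rho ->
  0 < rho -> 0 < s < 1 -> INR k + s = alpha - rho ->
  real_regular k s (fun x => Re (twosided c la mu x)).
Proof.
intros Hc Hsize Hrho Hs Hks.
destruct (finite_uniform_bound (fun j K => (j <= k)%nat -> forall x y, 0 < y ->
   Cmod (Elap c (INR j + 1) x y) <= K * Rpower y (s - 1))) with (n := S k) as [K0 HK0].
- intros j B B' HB HBB Hj x y Hy. eapply Rle_trans; [now apply HB|].
  apply Rmult_le_compat_r; [left; apply Rpower_gt0|exact HBB].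
- intros j. destruct (le_dec j k) as [Hj|Hj]; [|exists 0; intros; contradiction].
  apply le_INR in Hj as HjR.
  destruct (size_bound_fractional c (alpha + 1) ((alpha - INR j - s) + 1) (alpha - INR j)) as [K [HK H]].
  + exact Hc.
  + lra.
  + apply size_bound_derivative; [exact Hc|]. apply (size_bound_weaken c alpha rho); [exact Hc|lra|exact Hsize].
  + exists K. intros _ x y Hy. specialize (H x y Hy).
    replace (alpha + 1 - (alpha - INR j)) with (INR j + 1) in H by ring.
    replace (- (alpha - INR j - s + 1 - (alpha - INR j))) with (s - 1) in H by ring. exact H.
- assert (HK0' : 0 <= K0).
  { specialize (HK0 0%nat ltac:(lia) ltac:(lia) 0 1 Rlt_0_1).
    pose proof (Cmod_ge_0 (Elap c (INR 0 + 1) 0 1)). pose proof (Rpower_gt0 1 (s - 1)). nra. }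
  assert (HB : forall la mu, Lap_bound ((Cmod la + Cmod mu) * K0) s k (cos_coef c la mu) (sin_coef c la mu)).
  { intros l m j x y Hj Hy. rewrite Lap_twosided by assumption.
    eapply Rle_trans; [apply Rabs_Re_le|]. eapply Rle_trans; [apply Cmod_triangle|].
    rewrite !Cmod_mult, !Rmult_plus_distr_r, !(Rmult_assoc (Cmod _)).
    apply Rplus_le_compat; (apply Rmult_le_compat_l; [apply Cmod_ge_0|]); (apply HK0; [lia|exact Hj|exact Hy]). }
  apply (real_regular_ext k s (fun x => Series (trig (cos_coef c la mu) (sin_coef c la mu) x))).
  { intros x. symmetry. now apply Re_twosided. }
  apply (trig_series_regularity ((Cmod la + Cmod mu) * K0)).
  + lra.
  + pose proof (Cmod_ge_0 la). pose proof (Cmod_ge_0 mu). nra.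
  + now apply coef_abs_summable.
  + apply HB.
  + (* the rotated series is the same series with la, mu multiplied by i and -i *)
    pose proof (HB (Ci * la)%C (- Ci * mu)%C) as H.
    rewrite !Cmod_mult, Cmod_opp, Cmod_Ci, !Rmult_1_l in H.
    intros j x y Hj Hy. specialize (H j x y Hj Hy).
    replace (Lap (trig (sin_coef c la mu) (fun n => - cos_coef c la mu n) x) (INR j + 1) y)
      with (Lap (trig (cos_coef c (Ci * la) (- Ci * mu)) (sin_coef c (Ci * la) (- Ci * mu)) x) (INR j + 1) y); [exact H|].
    apply Series_ext. intros n. unfold trig, cos_coef, sin_coef, Cmult, Copp, Ci, Re, Im. cbn [fst snd]. ring.
Qed.

Lemma twosided_scal c la mu t x : (t * twosided c la mu x)%C = twosided c (t * la) (t * mu) x.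
Proof. unfold twosided. ring. Qed.

Lemma twosided_regular c la mu alpha rho k s : Csummable c -> size_bound c alpha rho ->
  0 < rho -> 0 < s < 1 -> INR k + s = alpha - rho ->
  uniform_C k s (fun _ => True) (twosided c la mu).
Proof.
intros Hc Hsize Hrho Hs Hks.
destruct (Re_twosided_regular c la mu alpha rho k s Hc Hsize Hrho Hs Hks) as [A1 [K1 [HK1 A2]]].
assert (HI : real_regular k s (fun x => Im (twosided c la mu x))).
{ apply (real_regular_ext k s (fun x => Re (twosided c (- Ci * la) (- Ci * mu) x))).
  - intros x. rewrite <- twosided_scal. unfold Cmult at 1, Copp, Ci, Re, Im. cbn [fst snd]. ring.
  - now apply (Re_twosided_regular c _ _ alpha rho). }
destruct HI as [B1 [K2 [HK2 B2]]].
split.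
- intros j x Hj _. split; [now apply A1|now apply B1].
- left. split; [lra|]. exists (K1 + K2). intros x y _ _ Hxy.
  eapply Rle_trans; [apply Cmod_le_Re_Im|]. rewrite Re_minus, Im_minus, Rmult_plus_distr_r.
  apply Rplus_le_compat; [now apply A2|now apply B2].
Qed.

Lemma twosided_ccont c la mu x : Csummable c -> ccont (twosided c la mu) x.
Proof.
intros Hc.
apply (ccont_plus (fun x => la * CSeries (fun n => c n * cis (freq n * x)))%C
  (fun x => mu * CSeries (fun n => c n * cis (- (freq n * x))))%C);
  (apply ccont_mult; [apply ccont_const|]).
- apply (ccont_CSeries (fun n v => c n * cis (freq n * v))%C (fun n => Cmod (c n))); [exact Hc| |].
  + intros n v. rewrite Cmod_mult, Cmod_cis. lra.
  + intros n. apply ccont_mult; [apply ccont_const|apply ccont_cis].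
- apply (ccont_CSeries (fun n v => c n * cis (- (freq n * v)))%C (fun n => Cmod (c n))); [exact Hc| |].
  + intros n v. rewrite Cmod_mult, Cmod_cis. lra.
  + intros n. apply ccont_mult; [apply ccont_const|].
    apply (ccont_ext (fun v => cis (- freq n * v))); [intros v; f_equal; ring|apply ccont_cis].
Qed.

(** The Hoelder part of the exponent is kept strictly between 0 and 1: then the order
    alpha - j of each fractional integral stays below the size exponent alpha - j - s + 1 of
    the derivative. *)
Lemma twosided_lower_exponents c la mu alpha rho0 t : Csummable c -> size_bound c alpha rho0 ->
  0 < rho0 -> 0 <= t < alpha - rho0 ->
  exists k s, 0 < s <= 1 /\ t < INR k + s /\ uniform_C k s (fun _ => True) (twosided c la mu).
Proof.
intros Hc Hsize Hrho Ht. set (v := alpha - rho0) in *.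
assert (Hk : exists k : nat, INR k < v <= INR k + 1).
{ destruct (nfloor_ex v) as [n [H1 H2]]; [lra|].
  destruct (Req_dec v (INR n)) as [E|E].
  - destruct n as [|n]; [simpl in E; lra|]. exists n. rewrite S_INR in *. lra.
  - exists n. lra. }
destruct Hk as [k Hk].
pose proof (Rmax_l (INR k) t). pose proof (Rmax_r (INR k) t).
assert (Hmax : Rmax (INR k) t < v) by (apply Rmax_lub_lt; lra).
set (u := (Rmax (INR k) t + v) / 2).
assert (Hu : Rmax (INR k) t < u < v) by (unfold u; lra).
exists k, (u - INR k). split; [lra|]. split; [lra|].
apply (twosided_regular c la mu alpha (alpha - u)); try assumption; try lra.
- apply (size_bound_weaken c alpha rho0); [exact Hc|unfold v in *; lra|exact Hsize].
- unfold v in *; lra.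
Qed.

(** * Upper bound for the pointwise exponent *)

(** ** Polynomials as trigonometric polynomials without positive frequencies *)

(** Frequencies at most 0 only.  These functions form an algebra, and kernels with positive
    frequencies annihilate them. *)
Inductive negtrig : (R -> C) -> Prop :=
| negtrig_zero : negtrig (fun _ => RtoC 0)
| negtrig_add f (t : C) (j : nat) : negtrig f -> negtrig (fun u => f u + t * cis (- (INR j * u)))%C
| negtrig_ext f g : (forall u, f u = g u) -> negtrig f -> negtrig g.

Lemma negtrig_plus f g : negtrig f -> negtrig g -> negtrig (fun u => f u + g u)%C.
Proof.
intros Hf Hg. induction Hg as [|g t j Hg IH|g h E Hg IH].
- apply (negtrig_ext f); [intros u; ring|exact Hf].
- apply (negtrig_ext (fun u => (f u + g u) + t * cis (- (INR j * u)))%C); [intros u; ring|].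
  now apply negtrig_add.
- apply (negtrig_ext (fun u => f u + g u)%C); [intros u; now rewrite E|exact IH].
Qed.

Lemma negtrig_mult_monomial f t j : negtrig f -> negtrig (fun u => f u * (t * cis (- (INR j * u))))%C.
Proof.
intros Hf. induction Hf as [|f t' j' Hf IH|f h E Hf IH].
- apply (negtrig_ext (fun _ => RtoC 0)); [intros u; ring|constructor].
- apply (negtrig_ext (fun u => f u * (t * cis (- (INR j * u))) + (t' * t) * cis (- (INR (j' + j) * u)))%C).
  + intros u. rewrite plus_INR.
    replace (- ((INR j' + INR j) * u)) with (- (INR j' * u) + - (INR j * u)) by ring.
    rewrite cis_plus. ring.
  + now apply negtrig_add.
- apply (negtrig_ext (fun u => f u * (t * cis (- (INR j * u))))%C); [intros u; now rewrite E|exact IH].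
Qed.

Lemma negtrig_mult f g : negtrig f -> negtrig g -> negtrig (fun u => f u * g u)%C.
Proof.
intros Hf Hg. induction Hg as [|g t j Hg IH|g h E Hg IH].
- apply (negtrig_ext (fun _ => RtoC 0)); [intros u; ring|constructor].
- apply (negtrig_ext (fun u => f u * g u + f u * (t * cis (- (INR j * u))))%C); [intros u; ring|].
  apply negtrig_plus; [exact IH|now apply negtrig_mult_monomial].
- apply (negtrig_ext (fun u => f u * g u)%C); [intros u; now rewrite E|exact IH].
Qed.

Lemma negtrig_monomial t j : negtrig (fun u => t * cis (- (INR j * u)))%C.
Proof.
apply (negtrig_ext (fun u => RtoC 0 + t * cis (- (INR j * u)))%C); [intros u; ring|].
apply negtrig_add. constructor.
Qed.

Lemma negtrig_const t : negtrig (fun _ => t).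
Proof.
apply (negtrig_ext (fun u => t * cis (- (INR 0 * u)))%C); [|apply negtrig_monomial].
intros u. simpl. rewrite Rmult_0_l, Ropp_0, cis_0. ring.
Qed.

Lemma negtrig_pow f n : negtrig f -> negtrig (fun u => f u ^ n)%C.
Proof.
intros Hf. induction n as [|n IH]; [apply (negtrig_ext (fun _ => RtoC 1)); [reflexivity|apply negtrig_const]|].
apply (negtrig_ext (fun u => f u * f u ^ n)%C); [reflexivity|now apply negtrig_mult].
Qed.

Lemma negtrig_sum_n (F : nat -> R -> C) N : (forall n, negtrig (F n)) ->
  negtrig (fun u => sum_n (fun n => F n u) N).
Proof.
intros H. induction N as [|N IH].
- apply (negtrig_ext (F 0%nat)); [intros u; now rewrite sum_O|apply H].
- apply (negtrig_ext (fun u => sum_n (fun n => F n u) N + F (S N) u)%C); [intros u; now rewrite sum_Sn|].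
  now apply negtrig_plus.
Qed.

Lemma negtrig_properties T : negtrig T -> (forall u, ccont T u) /\
  (exists B, 0 <= B /\ forall u, Cmod (T u) <= B) /\
  forall m, is_CInt (fun v => T v * cis (- (freq m * v)))%C (- / 2) (/ 2) (RtoC 0).
Proof.
intros HT. induction HT as [|f t j Hf [I1 [[B [HB I2]] I3]]|f g E Hf [I1 [[B [HB I2]] I3]]].
- split; [intros u; apply ccont_const|]. split.
  + exists 0. split; [lra|]. intros u. rewrite Cmod_0. lra.
  + intros m. replace (RtoC 0) with (RtoC 0 * RtoC 0)%C by ring.
    apply (is_CInt_ext (fun v => RtoC 0 * cis (IZR (Z.of_nat (S m)) * v))%C); [intros v; ring|].
    apply is_CInt_scal.
    pose proof (is_CInt_cis (Z.of_nat (S m))) as H.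
    destruct (Z.eq_dec (Z.of_nat (S m)) 0); [lia|exact H].
- split; [|split].
  + intros u. apply (ccont_plus f (fun u => t * cis (- (INR j * u)))%C); [apply I1|].
    apply ccont_mult; [apply ccont_const|].
    apply (ccont_ext (fun v => cis (- INR j * v))); [intros v; f_equal; ring|apply ccont_cis].
  + exists (B + Cmod t). split; [pose proof (Cmod_ge_0 t); lra|]. intros u.
    eapply Rle_trans; [apply Cmod_triangle|]. rewrite Cmod_mult, Cmod_cis. specialize (I2 u). lra.
  + intros m. replace (RtoC 0) with (RtoC 0 + t * RtoC 0)%C by ring.
    apply (is_CInt_ext (fun v => f v * cis (- (freq m * v)) + t * cis (IZR (- (Z.of_nat j + Z.of_nat (S m))) * v))%C).
    * intros v. rewrite opp_IZR, plus_IZR, <- !INR_IZR_INZ.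
      replace (- (INR j + INR (S m)) * v) with (- (INR j * v) + - (freq m * v)) by (unfold freq; ring).
      rewrite cis_plus. ring.
    * apply is_CInt_plus; [apply I3|]. apply is_CInt_scal.
      pose proof (is_CInt_cis (- (Z.of_nat j + Z.of_nat (S m)))) as H.
      destruct (Z.eq_dec (- (Z.of_nat j + Z.of_nat (S m))) 0); [lia|exact H].
- split; [|split].
  + intros u. now apply (ccont_ext f).
  + exists B. split; [exact HB|]. intros u. rewrite <- E. apply I2.
  + intros m. apply (is_CInt_ext (fun v => f v * cis (- (freq m * v)))%C); [intros v; now rewrite E|apply I3].
Qed.

Definition is_Cderive (h : R -> C) (x : R) (l : C) : Prop :=
  is_derive (fun v => Re (h v)) x (Re l) /\ is_derive (fun v => Im (h v)) x (Im l).

Lemma is_Cderive_plus f g x l m : is_Cderive f x l -> is_Cderive g x m ->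
  is_Cderive (fun v => f v + g v)%C x (l + m)%C.
Proof. intros [F1 F2] [G1 G2]; split; now apply (is_derive_plus (V := R_NormedModule)). Qed.

Lemma is_derive_Rmult (f g : R -> R) x df dg : is_derive f x df -> is_derive g x dg ->
  is_derive (fun v => f v * g v) x (df * g x + f x * dg).
Proof. intros Hf Hg. apply (is_derive_mult f g x df dg Hf Hg). intros; apply Rmult_comm. Qed.

Lemma is_Cderive_mult f g x l m : is_Cderive f x l -> is_Cderive g x m ->
  is_Cderive (fun v => f v * g v)%C x (l * g x + f x * m)%C.
Proof.
intros [F1 F2] [G1 G2]; split.
- apply (is_derive_ext (fun v => Re (f v) * Re (g v) - Im (f v) * Im (g v))); [reflexivity|].
  replace (Re (l * g x + f x * m)%C) with
    ((Re l * Re (g x) + Re (f x) * Re m) - (Im l * Im (g x) + Im (f x) * Im m))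
    by (unfold Cmult, Cplus, Re, Im; cbn [fst snd]; ring).
  apply (is_derive_minus (V := R_NormedModule) (fun v => Re (f v) * Re (g v)) (fun v => Im (f v) * Im (g v))).
  + now apply (is_derive_Rmult (fun v => Re (f v)) (fun v => Re (g v))).
  + now apply (is_derive_Rmult (fun v => Im (f v)) (fun v => Im (g v))).
- apply (is_derive_ext (fun v => Re (f v) * Im (g v) + Im (f v) * Re (g v))); [reflexivity|].
  replace (Im (l * g x + f x * m)%C) with
    ((Re l * Im (g x) + Re (f x) * Im m) + (Im l * Re (g x) + Im (f x) * Re m))
    by (unfold Cmult, Cplus, Re, Im; cbn [fst snd]; ring).
  apply (is_derive_plus (V := R_NormedModule) (fun v => Re (f v) * Im (g v)) (fun v => Im (f v) * Re (g v))).
  + now apply (is_derive_Rmult (fun v => Re (f v)) (fun v => Im (g v))).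
  + now apply (is_derive_Rmult (fun v => Im (f v)) (fun v => Re (g v))).
Qed.

Lemma is_Cderive_const t x : is_Cderive (fun _ => t) x (RtoC 0).
Proof. split; apply (is_derive_const (V := R_NormedModule)). Qed.

Lemma is_Cderive_ext f g x l : (forall u, f u = g u) -> is_Cderive f x l -> is_Cderive g x l.
Proof.
intros E [H1 H2]; split.
- apply (is_derive_ext (fun v => Re (f v))); [intros; now rewrite E|exact H1].
- apply (is_derive_ext (fun v => Im (f v))); [intros; now rewrite E|exact H2].
Qed.

Lemma is_Cderive_pow f x l n : is_Cderive f x l ->
  is_Cderive (fun v => f v ^ S n)%C x (RtoC (INR (S n)) * f x ^ n * l)%C.
Proof.
intros H. induction n as [|n IH].
- apply (is_Cderive_ext f); [intros u; simpl; ring|].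
  replace (RtoC (INR 1) * f x ^ 0 * l)%C with l by (simpl; ring). exact H.
- apply (is_Cderive_ext (fun v => f v * f v ^ S n)%C); [reflexivity|].
  replace (RtoC (INR (S (S n))) * f x ^ S n * l)%C with (l * f x ^ S n + f x * (RtoC (INR (S n)) * f x ^ n * l))%C.
  + now apply is_Cderive_mult.
  + rewrite (S_INR (S n)), RtoC_plus, Cpow_S. ring.
Qed.

Lemma complex_mean_value h dh x B : (forall u, is_Cderive h u (dh u)) ->
  (forall u, Rabs u <= Rabs x -> Cmod (dh u) <= B) -> Cmod (h x - h 0)%C <= B * Rabs x.
Proof.
intros Hd HB. apply Cmod_le_rotations. intros th Hth.
assert (HF : forall u, is_derive (fun u => Re (th * h u)%C) u (Re (th * dh u)%C)).
{ intros u. destruct (is_Cderive_mult (fun _ => th) h u _ _ (is_Cderive_const th u) (Hd u)) as [H _].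
  replace (Re (th * dh u)%C) with (Re (RtoC 0 * h u + th * dh u)%C)
    by (unfold Cmult, Cplus, RtoC, Re, Im; cbn [fst snd]; ring). exact H. }
destruct (MVT_gen (fun u => Re (th * h u)%C) 0 x (fun u => Re (th * dh u)%C)) as [c [Hc E]].
- intros; apply HF.
- intros u _. apply continuity_pt_filterlim.
  apply (ex_derive_continuous (V := R_NormedModule) (fun u => Re (th * h u)%C)). eexists; apply HF.
- replace (Re (th * (h x - h 0))%C) with (Re (th * h x)%C - Re (th * h 0)%C)
    by (unfold Cmult, Cminus, Cplus, Copp, Re, Im; cbn [fst snd]; ring).
  rewrite E, Rminus_0_r. eapply Rle_trans; [apply Rle_abs|]. rewrite Rabs_mult.
  apply Rmult_le_compat_r; [apply Rabs_pos|]. eapply Rle_trans; [apply (Rabs_Re_le (th * dh c)%C)|].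
  rewrite Cmod_mult, Hth, Rmult_1_l. apply HB.
  revert Hc. unfold Rmin, Rmax. destruct (Rle_dec 0 x); unfold Rabs; repeat destruct Rcase_abs; lra.
Qed.

(** u is the logarithm of cis(-u) up to the factor -2 PI i; its power series in
    W = 1 - cis(-u), truncated, is a trigonometric polynomial whose derivative misses 1 by
    a power of W only. *)
Definition logpoly (N : nat) (u : R) : C :=
  (/ (RtoC (2 * PI) * Ci) * sum_n (fun m => RtoC (/ INR (S m)) * (1 - cis (- u)) ^ S m) N)%C.

Lemma two_pi_i_neq_0 : (RtoC (2 * PI) * Ci)%C <> RtoC 0.
Proof.
intros E. apply (f_equal snd) in E. simpl in E. pose proof PI_RGT_0. lra.
Qed.

Lemma negtrig_logpoly N : negtrig (logpoly N).
Proof.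
apply negtrig_mult; [apply negtrig_const|].
apply (negtrig_sum_n (fun m u => RtoC (/ INR (S m)) * (1 - cis (- u)) ^ S m)%C). intros m.
apply negtrig_mult; [apply negtrig_const|]. apply negtrig_pow.
apply (negtrig_ext (fun u => RtoC 1 + (- (1)) * cis (- (INR 1 * u)))%C).
- intros u. simpl. rewrite Rmult_1_l. ring.
- apply negtrig_plus; [apply negtrig_const|apply negtrig_monomial].
Qed.

Lemma is_Cderive_one_minus_cis u :
  is_Cderive (fun u => 1 - cis (- u))%C u (RtoC (2 * PI) * Ci * (1 - (1 - cis (- u))))%C.
Proof.
split; unfold cis, Cminus, Cplus, Cmult, Copp, Ci, RtoC, Re, Im; cbn [fst snd]; auto_derive; try trivial; ring.
Qed.

Lemma logpoly_derive N u :
  is_Cderive (fun u => RtoC u - logpoly N u)%C u ((1 - cis (- u)) ^ S N)%C.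
Proof.
assert (H : is_Cderive (logpoly N) u (1 - (1 - cis (- u)) ^ S N)%C).
{ unfold logpoly. set (k := (RtoC (2 * PI) * Ci)%C).
  assert (Hk : k <> RtoC 0) by apply two_pi_i_neq_0.
  set (W := fun u => (1 - cis (- u))%C).
  assert (HS : is_Cderive (fun u => sum_n (fun m => RtoC (/ INR (S m)) * W u ^ S m) N)%C u
    (k * (1 - W u ^ S N))%C).
  { assert (Hm : forall m, is_Cderive (fun u => RtoC (/ INR (S m)) * W u ^ S m)%C u (k * (W u ^ m - W u ^ S m))%C).
    { intros m. pose proof (is_Cderive_mult _ _ _ _ _ (is_Cderive_const (RtoC (/ INR (S m))) u)
        (is_Cderive_pow _ _ _ m (is_Cderive_one_minus_cis u))) as H. fold k in H.
      match type of H with is_Cderive _ _ ?l => replace (k * (W u ^ m - W u ^ S m))%C with l end; [exact H|].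
      rewrite RtoC_inv by (apply not_0_INR; lia). unfold W. rewrite Cpow_S. field.
      intros E. apply RtoC_inj in E. revert E. apply not_0_INR. lia. }
    clear Hk. induction N as [|N IH].
    - apply (is_Cderive_ext (fun u => RtoC (/ INR 1) * W u ^ 1)%C); [intros; now rewrite sum_O|].
      replace (k * (1 - W u ^ 1))%C with (k * (W u ^ 0 - W u ^ 1))%C by (simpl; ring). apply Hm.
    - apply (is_Cderive_ext (fun u => sum_n (fun m => RtoC (/ INR (S m)) * W u ^ S m) N + RtoC (/ INR (S (S N))) * W u ^ S (S N))%C);
        [intros; now rewrite sum_Sn|].
      replace (k * (1 - W u ^ S (S N)))%C with (k * (1 - W u ^ S N) + k * (W u ^ S N - W u ^ S (S N)))%C by ring.
      apply is_Cderive_plus; [exact IH|apply Hm]. }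
  pose proof (is_Cderive_mult _ _ _ _ _ (is_Cderive_const (/ k)%C u) HS) as H.
  change (is_Cderive (fun u => / k * sum_n (fun m => RtoC (/ INR (S m)) * W u ^ S m) N)%C u (1 - W u ^ S N)%C).
  match type of H with is_Cderive _ _ ?l => replace (1 - W u ^ S N)%C with l end; [exact H|].
  field. exact Hk. }
apply (is_Cderive_ext (fun u => RtoC u + (- (1)) * logpoly N u)%C); [intros; ring|].
pose proof (is_Cderive_mult _ _ _ _ _ (is_Cderive_const (- (1))%C u) H) as H'.
assert (Hid : is_Cderive (fun u => RtoC u) u (RtoC 1)).
{ split; simpl; auto_derive; trivial. }
pose proof (is_Cderive_plus _ _ _ _ _ Hid H') as H''.
match type of H'' with is_Cderive _ _ ?l => replace ((1 - cis (- u)) ^ S N)%C with l end; [exact H''|ring].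
Qed.

Lemma logpoly_approx N u : Cmod (RtoC u - logpoly N u)%C <= (2 * PI) ^ S N * Rabs u ^ S (S N).
Proof.
pose proof PI_RGT_0 as HPI.
assert (H0 : (RtoC 0 - logpoly N 0)%C = RtoC 0).
{ unfold logpoly. replace (sum_n _ N) with (RtoC 0); [ring|].
  rewrite Ropp_0, cis_0. induction N as [|N IH].
  - rewrite sum_O. simpl. ring.
  - rewrite sum_Sn, <- IH. change (@plus C_AbelianMonoid) with Cplus.
    rewrite Cpow_S. match goal with |- ?x = ?y => change (@eq C x y) end. ring. }
replace (RtoC u - logpoly N u)%C with ((RtoC u - logpoly N u) - (RtoC 0 - logpoly N 0))%C by (rewrite H0; ring).
replace ((2 * PI) ^ S N * Rabs u ^ S (S N)) with ((2 * PI * Rabs u) ^ S N * Rabs u)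
  by (rewrite Rpow_mult_distr; simpl; ring).
apply (complex_mean_value (fun u => RtoC u - logpoly N u)%C (fun u => (1 - cis (- u)) ^ S N)%C).
- intros v. apply logpoly_derive.
- intros v Hv. rewrite Cmod_pow. apply pow_incr. split; [apply Cmod_ge_0|].
  eapply Rle_trans; [apply Cmod_1_minus_cis_upper|]. rewrite Rabs_Ropp. apply Rmult_le_compat_l; lra.
Qed.

(** The variable is replaced by its approximation [logpoly]. *)
Lemma polynomial_approx (p : nat -> C) d N : exists T K, negtrig T /\ 0 <= K /\
  forall u, Rabs u <= 1 -> Cmod (sum_n (fun i => p i * RtoC (u ^ i))%C d - T u)%C <= K * Rabs u ^ S (S N).
Proof.
pose proof PI_RGT_0 as HPI.
set (K1 := (2 * PI) ^ S N). assert (HK1 : 0 < K1) by (apply pow_lt; lra).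
assert (HL : forall u, Rabs u <= 1 -> Cmod (logpoly N u) <= 1 + K1).
{ intros u Hu. replace (logpoly N u) with (RtoC u - (RtoC u - logpoly N u))%C by ring.
  eapply Rle_trans; [apply Cmod_triangle|]. rewrite Cmod_opp, Cmod_R.
  pose proof (logpoly_approx N u) as H. fold K1 in H.
  assert (Rabs u ^ S (S N) <= 1).
  { rewrite <- (pow1 (S (S N))). apply pow_incr. split; [apply Rabs_pos|exact Hu]. } nra. }
assert (Hi : forall i, exists K, 0 <= K /\ forall u, Rabs u <= 1 ->
  Cmod (RtoC (u ^ i) - logpoly N u ^ i)%C <= K * Rabs u ^ S (S N)).
{ induction i as [|i [K [HK IH]]].
  - exists 0. split; [lra|]. intros u _. replace (RtoC (u ^ 0) - logpoly N u ^ 0)%C with (RtoC 0) by (simpl; ring).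
    rewrite Cmod_0. lra.
  - assert (HLi : 0 <= (1 + K1) ^ i) by (apply pow_le; lra).
    exists (K + (1 + K1) ^ i * K1). split; [nra|]. intros u Hu.
    replace (RtoC (u ^ S i) - logpoly N u ^ S i)%C with
      (RtoC u * (RtoC (u ^ i) - logpoly N u ^ i) + logpoly N u ^ i * (RtoC u - logpoly N u))%C
      by (rewrite Cpow_S; simpl pow; rewrite RtoC_mult; ring).
    eapply Rle_trans; [apply Cmod_triangle|]. rewrite !Cmod_mult, Cmod_R, Cmod_pow.
    rewrite Rmult_plus_distr_r. apply Rplus_le_compat.
    + rewrite <- (Rmult_1_l (K * _)). apply Rmult_le_compat; [apply Rabs_pos|apply Cmod_ge_0|exact Hu|now apply IH].
    + rewrite Rmult_assoc. apply Rmult_le_compat; [apply pow_le, Cmod_ge_0|apply Cmod_ge_0| |apply logpoly_approx].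
      apply pow_incr. split; [apply Cmod_ge_0|now apply HL]. }
induction d as [|d [T [K [HT [HK IH]]]]].
- exists (fun _ => p 0%nat), 0. split; [apply negtrig_const|]. split; [lra|]. intros u _.
  rewrite sum_O. replace (p 0%nat * RtoC (u ^ 0) - p 0%nat)%C with (RtoC 0) by (simpl; ring).
  rewrite Cmod_0. lra.
- destruct (Hi (S d)) as [K' [HK' H']].
  exists (fun u => T u + p (S d) * logpoly N u ^ S d)%C, (K + Cmod (p (S d)) * K').
  pose proof (Cmod_ge_0 (p (S d))) as Hp.
  split; [|split; [nra|]].
  + apply negtrig_plus; [exact HT|]. apply negtrig_mult; [apply negtrig_const|]. apply negtrig_pow, negtrig_logpoly.
  + intros u Hu. rewrite sum_Sn. change (@plus C_AbelianMonoid) with Cplus.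
    set (Sm := sum_n (fun i => p i * RtoC (u ^ i))%C d) in *.
    replace (Sm + p (S d) * RtoC (u ^ S d) - (T u + p (S d) * logpoly N u ^ S d))%C
      with ((Sm - T u) + p (S d) * (RtoC (u ^ S d) - logpoly N u ^ S d))%C by ring.
    eapply Rle_trans; [apply Cmod_triangle|]. rewrite Cmod_mult, Rmult_plus_distr_r, Rmult_assoc.
    apply Rplus_le_compat; [now apply IH|]. apply Rmult_le_compat_l; [exact Hp|now apply H'].
Qed.

(** ** From pointwise regularity to the size of the form in a cone *)

(** The Hoelder condition says nothing at the point itself; continuity does. *)
Lemma vanishing_at_0 (h : R -> C) H t : 0 < t -> ccont h 0 ->
  (forall v, v <> 0 -> Rabs v <= / 2 -> Cmod (h v) <= H * Rpower (Rabs v) t) -> h 0 = RtoC 0.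
Proof.
intros Ht [C1 C2] Hh.
set (v := fun m => / 2 * yseq m).
assert (Hv : forall m, 0 < v m <= / 2).
{ intros m. unfold v. pose proof (yseq_gt0 m). assert (yseq m <= 1).
  { unfold yseq. rewrite <- Rinv_1. apply Rinv_le_contravar; [lra|]. rewrite S_INR. pose proof (pos_INR m). lra. }
  lra. }
assert (Hl : is_lim_seq v 0).
{ replace (Finite 0) with (Rbar_mult (/ 2) 0) by (simpl; f_equal; ring). apply is_lim_seq_scal_l, is_lim_yseq. }
assert (Hz : is_lim_seq (fun m => H * Rpower (v m) t) 0).
{ replace (Finite 0) with (Rbar_mult H 0) by (simpl; f_equal; ring). apply is_lim_seq_scal_l.
  apply is_lim_Rpower_0; [apply Hv|exact Hl|exact Ht]. }
assert (Hb : forall m, Cmod (h (v m)) <= H * Rpower (v m) t).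
{ intros m. specialize (Hv m). rewrite <- (Rabs_pos_eq (v m)) at 2 by lra. apply Hh; [lra|].
  rewrite Rabs_pos_eq; lra. }
assert (key : forall phi : R -> R, continuous phi 0 -> (forall m, Rabs (phi (v m)) <= Cmod (h (v m))) -> phi 0 = 0).
{ intros phi Hc Hphi.
  assert (L1 : is_lim_seq (fun m => phi (v m)) (phi 0)).
  { apply (is_lim_seq_continuous phi v 0); [now apply continuity_pt_filterlim|exact Hl]. }
  assert (L2 : is_lim_seq (fun m => phi (v m)) 0).
  { apply is_lim_seq_abs_0. apply is_lim_seq_le_le with (u := fun _ => 0) (w := fun m => H * Rpower (v m) t).
    - intros m. split; [apply Rabs_pos|]. eapply Rle_trans; [apply Hphi|apply Hb].
    - apply is_lim_seq_const.
    - exact Hz. }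
  apply is_lim_seq_unique in L1. apply is_lim_seq_unique in L2. rewrite L1 in L2. now injection L2. }
apply C_ext.
- apply (key (fun v => Re (h v)) C1). intros m. apply Rabs_Re_le.
- apply (key (fun v => Im (h v)) C2). intros m. apply Rabs_Im_le.
Qed.

Lemma twosided_bounded c la mu : Csummable c -> exists B, 0 <= B /\ forall x, Cmod (twosided c la mu x) <= B.
Proof.
intros Hc. set (S0 := Series (fun n => Cmod (c n))).
assert (HS : forall k : nat -> R, Cmod (CSeries (fun n => c n * cis (k n))%C) <= S0).
{ intros k. apply Cmod_CSeries_le; [|exact Hc]. intros n. rewrite Cmod_mult, Cmod_cis. lra. }
assert (H0 : 0 <= S0) by (eapply Rle_trans; [apply Cmod_ge_0|apply (HS (fun _ => 0))]).
pose proof (Cmod_ge_0 la). pose proof (Cmod_ge_0 mu).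
exists (Cmod la * S0 + Cmod mu * S0). split; [nra|]. intros x.
unfold twosided. eapply Rle_trans; [apply Cmod_triangle|]. rewrite !Cmod_mult.
apply Rplus_le_compat; (apply Rmult_le_compat_l; [assumption|]).
- apply (HS (fun n => freq n * x)).
- apply (HS (fun n => - (freq n * x))).
Qed.

(** Subtracting a trigonometric polynomial without positive frequencies replaces the
    Taylor polynomial, and leaves the positive frequencies of g untouched. *)
Lemma pointwise_remainder c la mu x0 t0 t k : Csummable c -> 0 < t < t0 -> t <= INR k ->
  pointwise_C t0 x0 (twosided c la mu) ->
  exists h H, 0 <= H /\ (forall v, ccont h v) /\
    (forall m, is_CInt (fun v => h v * cis (- (freq m * v)))%C (- / 2) (/ 2)
       (la * (c m * cis (freq m * x0)))%C) /\
    forall v, v <> 0 -> Rabs v <= / 2 -> Cmod (h v) <= H * Rpower (Rabs v) t.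
Proof.
intros Hc Ht Htk [_ [d [p [_ [K [delta [Hdelta HP]]]]]]].
destruct (polynomial_approx p d k) as [T [K1 [HT [HK1 HT1]]]].
destruct (negtrig_properties T HT) as [T1 [[B [HB T2]] T3]].
destruct (twosided_bounded c la mu Hc) as [B' [HB' HG]].
set (h := fun v => (twosided c la mu (x0 + v) + (- (1)) * T v)%C).
set (d0 := Rmin delta 1). assert (Hd0 : 0 < d0) by (apply Rmin_glb_lt; lra).
pose proof (Rabs_pos K) as HKa.
pose proof (Rpower_gt0 d0 t) as Hd0t.
exists h, ((Rabs K + K1) + (B + B') / Rpower d0 t). split; [|split; [|split]].
- assert (0 <= (B + B') / Rpower d0 t) by (apply Rmult_le_pos; [lra|left; now apply Rinv_0_lt_compat]). lra.
- intros v. apply (ccont_plus (fun v => twosided c la mu (x0 + v)) (fun v => (- (1)) * T v)%C).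
  + apply (ccont_ext (fun v => twosided c la mu (1 * v + x0))); [intros u; f_equal; ring|].
    apply ccont_comp_aff. now apply twosided_ccont.
  + apply ccont_mult; [apply ccont_const|apply T1].
- intros m.
  set (u1 := fun n => (c n * cis (freq n * x0))%C). set (u2 := fun n => (c n * cis (- (freq n * x0)))%C).
  assert (Hu1 : Csummable u1) by now apply Csummable_cis.
  assert (Hu2 : Csummable u2) by (apply (Csummable_cis c (fun n => - (freq n * x0))); exact Hc).
  apply (is_CInt_ext (fun v => (la * (CSeries (fun n => u1 n * cis (freq n * v)) * cis (- (freq m * v)))
     + mu * (CSeries (fun n => u2 n * cis (- (freq n * v))) * cis (- (freq m * v))))
     + (- (1)) * (T v * cis (- (freq m * v))))%C).
  + intros v. unfold h, twosided.
    rewrite (CSeries_ext (fun n => c n * cis (freq n * (x0 + v)))%C (fun n => u1 n * cis (freq n * v))%C).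
    * rewrite (CSeries_ext (fun n => c n * cis (- (freq n * (x0 + v))))%C (fun n => u2 n * cis (- (freq n * v)))%C).
      -- ring.
      -- intros n. unfold u2. replace (- (freq n * (x0 + v))) with (- (freq n * x0) + - (freq n * v)) by ring.
         rewrite cis_plus. ring.
    * intros n. unfold u1. replace (freq n * (x0 + v)) with (freq n * x0 + freq n * v) by ring.
      rewrite cis_plus. ring.
  + change (c m * cis (freq m * x0))%C with (u1 m).
    replace (la * u1 m)%C with ((la * u1 m + mu * RtoC 0) + (- (1)) * RtoC 0)%C by ring.
    apply is_CInt_plus; [apply is_CInt_plus|]; apply is_CInt_scal.
    * now apply Fourier_coefficient.
    * now apply Fourier_coefficient_neg.
    * apply T3.
- intros v Hv Hv2. assert (Hvp : 0 < Rabs v) by now apply Rabs_pos_lt.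
  pose proof (Rpower_gt0 (Rabs v) t) as Hvt.
  replace (h v) with (twosided c la mu (x0 + v) - T v)%C by (unfold h; ring).
  rewrite Rmult_plus_distr_r.
  assert (Hq : 0 <= (B + B') / Rpower d0 t) by (apply Rmult_le_pos; [lra|left; now apply Rinv_0_lt_compat]).
  destruct (Rlt_le_dec (Rabs v) d0) as [Hsmall|Hlarge].
  + assert (Hvd : Rabs v < delta) by (eapply Rlt_le_trans; [exact Hsmall|apply Rmin_l]).
    specialize (HP (x0 + v) ltac:(lra)). replace (x0 + v - x0) with v in HP by ring.
    specialize (HP Hvd). specialize (HT1 v ltac:(lra)).
    set (Sm := sum_n (fun i => p i * RtoC (v ^ i))%C d) in *.
    replace (twosided c la mu (x0 + v) - T v)%C with ((twosided c la mu (x0 + v) - Sm) + (Sm - T v))%C by ring.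
    eapply Rle_trans; [apply Cmod_triangle|].
    apply Rle_trans with (Rabs K * Rpower (Rabs v) t + K1 * Rpower (Rabs v) t).
    2:{ nra. }
    apply Rplus_le_compat.
    * eapply Rle_trans; [exact HP|].
      apply Rle_trans with (Rabs K * Rpower (Rabs v) t0).
      -- apply Rmult_le_compat_r; [left; apply Rpower_gt0|apply Rle_abs].
      -- apply Rmult_le_compat_l; [exact HKa|]. apply Rpower_le_of_le1; lra.
    * eapply Rle_trans; [exact HT1|]. apply Rmult_le_compat_l; [exact HK1|].
      rewrite <- Rpower_pow by exact Hvp. apply Rpower_le_of_le1; [lra|]. rewrite !S_INR. lra.
  + eapply Rle_trans; [apply Cmod_triangle|]. rewrite Cmod_opp.
    specialize (HG (x0 + v)). specialize (T2 v).
    apply Rle_trans with (B + B'); [lra|].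
    assert (Hmono : Rpower d0 t <= Rpower (Rabs v) t) by (apply Rle_Rpower_l; lra).
    assert (H1 : B + B' <= (B + B') / Rpower d0 t * Rpower (Rabs v) t).
    { replace (B + B') with ((B + B') / Rpower d0 t * Rpower d0 t) at 1 by (field; lra).
      apply Rmult_le_compat_l; assumption. }
    assert (0 <= (Rabs K + K1) * Rpower (Rabs v) t) by (apply Rmult_le_pos; lra). lra.
Qed.

(** The kernel bound controls the derivative of order k > alpha + 1 of the series up to height
    1, exponential decay controls it above; fractional integration of order k - alpha along
    the vertical line, which stays in the cone, leads back to the form. *)
Lemma cone_bound c la mu x0 t0 t alpha D : Csummable c -> la <> RtoC 0 -> 0 <= D ->
  0 < t < t0 -> t < alpha -> pointwise_C t0 x0 (twosided c la mu) ->
  exists K, 0 < K /\ forall x y, 0 < y <= 1 -> Rabs (x - x0) <= D * y ->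
    Cmod (Elap c alpha x y) <= K * Rpower y (t - alpha).
Proof.
intros Hc Hla HD Ht Hta HP.
destruct (nfloor_ex (alpha + 1)) as [k0 [_ Hk0]]; [lra|].
set (k := S k0). assert (Hk : alpha + 1 < INR k) by (unfold k; rewrite S_INR; exact Hk0).
destruct (pointwise_remainder c la mu x0 t0 t k Hc Ht ltac:(lra) HP) as [h [H [HH [Hh [HF Hb]]]]].
pose proof (vanishing_at_0 h H t (proj1 Ht) (Hh 0) Hb) as Hh0.
destruct (analytic_kernel_bound D k t HD) as [K1 [HK1 Hker]]; [lra|lra|].
destruct (Elap_decay c (INR k) (INR k - t) Hc) as [K2 [HK2 Hdec]].
destruct (Elap_fractional_integral (INR k - alpha) (INR k - t)) as [K3 [HK3 Hfrac]]; [lra|].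
assert (Hlap : 0 < Cmod la) by now apply Cmod_gt_0.
set (A := K1 * H / Cmod la).
assert (HA : 0 <= A) by (apply Rmult_le_pos; [nra|left; now apply Rinv_0_lt_compat]).
assert (Hnear : forall x y, 0 < y <= 1 -> Rabs (x - x0) <= D * y ->
  Cmod (Elap c (INR k) x y) <= A * Rpower y (t - INR k)).
{ intros x y Hy Hx.
  set (d := fun m => (la * (c m * cis (freq m * x0)))%C).
  assert (Hcs : Csummable (fun m => c m * cis (freq m * x0))%C) by now apply Csummable_cis.
  assert (Hd : Csummable d).
  { apply Csummable_dom with (fun n => Cmod la * Cmod (c n * cis (freq n * x0))%C);
      [intros n; unfold d; rewrite Cmod_mult; lra|].
    now apply (ex_series_scal (V := R_NormedModule) (Cmod la)). }
  assert (HE : CSeries (fun m => d m * RtoC (wgt (INR k) y m) * cis (freq m * (x - x0)))%C = (la * Elap c (INR k) x y)%C).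
  { unfold Elap. rewrite <- CSeries_scal by (apply Elap_summable; [exact Hc|lra]).
    apply CSeries_ext. intros n. unfold d.
    replace (cis (freq n * x)) with (cis (freq n * x0) * cis (freq n * (x - x0)))%C
      by (rewrite <- cis_plus; f_equal; ring). ring. }
  assert (Hhb : forall v, Rabs v <= / 2 -> Cmod (h v) <= H * Rpower (y + Rabs v) t).
  { intros v Hv. destruct (Req_dec v 0) as [->|Hv0].
    - rewrite Hh0, Cmod_0. apply Rmult_le_pos; [exact HH|left; apply Rpower_gt0].
    - eapply Rle_trans; [now apply Hb|]. apply Rmult_le_compat_l; [exact HH|].
      apply Rle_Rpower_l; [lra|]. pose proof (Rabs_pos_lt v Hv0). lra. }
  pose proof (Hker h d H y (x - x0) Hh Hd HF HH Hy Hx Hhb) as Hres.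
  rewrite HE, Cmod_mult in Hres.
  apply (Rmult_le_reg_l (Cmod la)); [exact Hlap|]. eapply Rle_trans; [exact Hres|].
  right. unfold A. field. lra. }
exists (K3 * (A + K2)). split; [apply Rmult_lt_0_compat; lra|]. intros x y Hy Hx.
replace alpha with (INR k - (INR k - alpha)) at 1 by ring.
replace (t - alpha) with ((INR k - alpha) - (INR k - t)) by ring.
apply (Hfrac c (INR k) x y (A + K2) Hc); [lra|lra|].
intros v Hv. replace (- (INR k - t)) with (t - INR k) in * by ring.
pose proof (Rpower_gt0 v (t - INR k)).
destruct (Rle_dec v 1) as [Hv1|Hv1].
- eapply Rle_trans; [apply Hnear; [lra|]|nra].
  eapply Rle_trans; [exact Hx|]. apply Rmult_le_compat_l; lra.
- assert (Hv1' : 1 <= v) by lra. specialize (Hdec x v Hv1').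
  replace (- (INR k - t)) with (t - INR k) in Hdec by ring.
  eapply Rle_trans; [exact Hdec|]. nra.
Qed.

(** An exponent t > alpha - rho would make the form o(y^(-rho)) at points where it has that
    order. *)
Lemma twosided_upper_exponent c la mu x0 alpha rho t0 c0 D : Csummable c -> la <> RtoC 0 ->
  0 < rho < alpha -> 0 < c0 -> 0 < D ->
  (forall eps, 0 < eps -> exists x y, 0 < y < eps /\ Rabs (x - x0) <= D * y /\
      c0 * Rpower y (- rho) <= Cmod (Elap c alpha x y)) ->
  pointwise_C t0 x0 (twosided c la mu) -> t0 <= alpha - rho.
Proof.
intros Hc Hla Hrho Hc0 HD Hlow HP. apply Rnot_lt_le. intros Hlt.
set (v := alpha - rho) in *.
set (t := (v + Rmin t0 alpha) / 2).
pose proof (Rmin_l t0 alpha). pose proof (Rmin_r t0 alpha).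
assert (Hmin : v < Rmin t0 alpha) by (apply Rmin_glb_lt; unfold v in *; lra).
assert (Hv : 0 < v) by (unfold v; lra).
assert (Ht : v < t < Rmin t0 alpha) by (unfold t; lra).
destruct (cone_bound c la mu x0 t0 t alpha D Hc Hla) as [K [HK HKb]]; [lra|lra|lra|exact HP|].
set (e1 := Rpower (c0 / (2 * K)) (/ (t - v))).
assert (He1 : 0 < e1) by apply Rpower_gt0.
destruct (Hlow (Rmin 1 e1)) as [x [y [Hy [Hx Hb]]]]; [apply Rmin_glb_lt; lra|].
pose proof (Rmin_l 1 e1). pose proof (Rmin_r 1 e1).
specialize (HKb x y ltac:(lra) Hx).
assert (Hcomp : c0 * Rpower y (- rho) <= K * Rpower y (t - v) * Rpower y (- rho)).
{ eapply Rle_trans; [exact Hb|]. eapply Rle_trans; [exact HKb|]. right.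
  rewrite Rmult_assoc, <- Rpower_plus. do 2 f_equal. unfold v. ring. }
apply Rmult_le_reg_r in Hcomp; [|apply Rpower_gt0].
assert (Hs : Rpower y (t - v) < c0 / (2 * K)).
{ assert (Hq : 0 < c0 / (2 * K)) by (apply Rdiv_lt_0_compat; lra).
  replace (c0 / (2 * K)) with (Rpower e1 (t - v)).
  - apply Rlt_Rpower_l; lra.
  - unfold e1. rewrite Rpower_mult, Rinv_l, Rpower_1; [reflexivity|exact Hq|lra]. }
apply (Rmult_lt_compat_l K) in Hs; [|exact HK].
replace (K * (c0 / (2 * K))) with (c0 / 2) in Hs by (field; lra). lra.
Qed.

(** * Conclusion *)

Lemma pointwise_C_ext s x0 f g : (forall x, f x = g x) -> pointwise_C s x0 f -> pointwise_C s x0 g.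
Proof.
intros E [Hc [d [p [Hd [K [delta [Hdelta H]]]]]]]. split.
- intros x. apply (continuous_ext f); [exact E|apply Hc].
- exists d, p. split; [exact Hd|]. exists K, delta. split; [exact Hdelta|].
  intros x Hx Hxd. rewrite <- E. now apply H.
Qed.

Lemma uniform_C_ext k s U f g : (forall x, f x = g x) -> uniform_C k s U f -> uniform_C k s U g.
Proof.
intros E [Hd H].
assert (ED : forall j x, CDerive_n f j x = CDerive_n g j x).
{ intros j x. unfold CDerive_n. f_equal; apply Derive_n_ext; intros t; now rewrite E. }
split.
- intros j x Hj Hx. destruct (Hd j x Hj Hx) as [H1 H2].
  split.
  + apply (ex_derive_n_ext (fun t => Re (f t))); [intros t; now rewrite E|exact H1].
  + apply (ex_derive_n_ext (fun t => Im (f t))); [intros t; now rewrite E|exact H2].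
- destruct H as [[Hs [K HK]]|[Hs Hc]]; [left|right]; (split; [exact Hs|]).
  + exists K. intros x y Hx Hy Hxy. rewrite <- !ED. now apply HK.
  + intros j x Hj Hx. apply (continuous_ext (CDerive_n f j)); [intros; apply ED|now apply Hc].
Qed.

Lemma twosided_exponents g c la mu x0 alpha rho c0 D : (forall x, g x = twosided c la mu x) ->
  Csummable c -> la <> RtoC 0 -> 0 < rho < alpha -> size_bound c alpha rho -> 0 < c0 -> 0 < D ->
  (forall eps, 0 < eps -> exists x y, 0 < y < eps /\ Rabs (x - x0) <= D * y /\
      c0 * Rpower y (- rho) <= Cmod (Elap c alpha x y)) ->
  all_holder_exponents_eq g x0 (alpha - rho).
Proof.
intros E Hc Hla Hrho Hsize Hc0 HD Hlow.
apply all_holder_exponents_criterion.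
- lra.
- intros x. apply continuous_of_ccont. apply (ccont_ext (twosided c la mu)); [now symmetry|].
  now apply twosided_ccont.
- intros t _ Ht. apply (twosided_upper_exponent c la mu x0 alpha rho t c0 D); try assumption.
  now apply (pointwise_C_ext t x0 g).
- intros t Ht. destruct (twosided_lower_exponents c la mu alpha rho t Hc Hsize) as (k & s & H1 & H2 & H3); [lra|exact Ht|].
  exists k, s. split; [exact H1|]. split; [exact H2|]. apply (uniform_C_ext k s _ (twosided c la mu)); [now symmetry|exact H3].
Qed.

Theorem theorem3p1 (G : mat2 -> Prop) (r alpha : R) (m : mat2 -> C)
    (f : C -> C) (a : nat -> C)
    (HG : congruence_group G)
    (Hwidth : cusp_infty_width_one G)
    (Hr : 0 < r)
    (Hf : cusp_form G r m f)
    (Hexp : forall z, upper_half_plane z ->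
       is_Cseries (fun n => (a (S n) * e (RtoC (INR (S n)) * z))%C) (f z))
    (Hnonzero : exists z, upper_half_plane z /\ f z <> RtoC 0)
    (Halpha : r / 2 < alpha)
    (Habs : ex_series (fun n => Cmod (coef a alpha (S n)))) :
  (forall x0 : R, irrational x0 ->
     all_holder_exponents_eq (f_exp a alpha) x0 (alpha - r / 2)) /\
  ((forall n : nat, Im (a (S n)) = 0) ->
   forall x0 : R, irrational x0 ->
     all_holder_exponents_eq (f_cos a alpha) x0 (alpha - r / 2) /\
     all_holder_exponents_eq (f_sin a alpha) x0 (alpha - r / 2)).
Proof.
set (c := fun n => coef a alpha (S n)).
assert (Hc : Csummable c) by exact Habs.
assert (Hfz : forall x y, 0 < y -> f (x, y) = Elap c alpha x y).
{ intros x y Hy. rewrite <- (is_Cseries_unique _ _ (Hexp (x, y) Hy)).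
  apply CSeries_ext. intros n.
  replace (RtoC (INR (S n)) * (x, y))%C with ((freq n * x, freq n * y) : C)
    by (unfold freq; apply C_ext; unfold Cmult, RtoC, Re, Im; cbn [fst snd]; ring).
  rewrite e_eq. unfold c, coef, wgt. fold (freq n).
  replace (2 * PI * (freq n * y)) with (2 * PI * freq n * y) by ring.
  rewrite RtoC_mult. field.
  intros E. apply RtoC_inj in E. pose proof (Rpower_gt0 (freq n) alpha). lra. }
assert (Hsize : size_bound c alpha (r / 2)).
{ destruct (cusp_form_upper_bound G r m f HG Hf) as [B [HB H]].
  exists B. split; [exact HB|]. intros x y Hy. rewrite <- Hfz by exact Hy. now apply (H (x, y)). }
assert (key : forall g la mu x0, irrational x0 -> (forall x, g x = twosided c la mu x) -> la <> RtoC 0 ->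
  all_holder_exponents_eq g x0 (alpha - r / 2)).
{ intros g la mu x0 Hx0 E Hla.
  destruct (cusp_form_lower_bound G r m f x0 HG Hf Hnonzero Hx0) as [c0 [D [Hc0 [HD Hlow]]]].
  apply (twosided_exponents g c la mu x0 alpha (r / 2) c0 D); try assumption; [lra|].
  intros eps Heps. destruct (Hlow eps Heps) as [x [y [Hy [Hx Hb]]]].
  exists x, y. split; [exact Hy|]. split; [exact Hx|]. rewrite <- Hfz by lra. exact Hb. }
assert (Hcis : forall k : nat -> R, Csummable (fun n => c n * cis (k n))%C) by (intros; now apply Csummable_cis).
assert (Hhalf : RtoC (/ 2) <> RtoC 0) by (intros E; apply RtoC_inj in E; lra).
assert (H2pi : forall n x, 2 * PI * INR (S n) * x = 2 * PI * (freq n * x)) by (intros; unfold freq; ring).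
assert (Hscal : forall t u, Csummable u -> Csummable (fun n => t * u n)%C).
{ intros t u Hu. apply Csummable_dom with (fun n => Cmod t * Cmod (u n)); [intros n; rewrite Cmod_mult; lra|].
  now apply (ex_series_scal (V := R_NormedModule) (Cmod t)). }
split; [|intros _; split].
- intros x0 Hx0. apply (key _ 1%C (RtoC 0)); [exact Hx0| |].
  + intros x. unfold twosided. rewrite Cmult_1_l, Cmult_0_l, Cplus_0_r.
    apply CSeries_ext. intros n. now rewrite e_RtoC.
  + intros E. apply RtoC_inj in E. lra.
- apply (key _ (RtoC (/ 2)) (RtoC (/ 2))); [assumption| |exact Hhalf].
  intros x. unfold twosided.
  rewrite <- !CSeries_scal, <- CSeries_plus
    by first [apply Hscal; first [apply (Hcis (fun n => freq n * x))|apply (Hcis (fun n => - (freq n * x)))]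
             |apply (Hcis (fun n => freq n * x))|apply (Hcis (fun n => - (freq n * x)))].
  apply CSeries_ext. intros n. rewrite cis_opp, H2pi. fold (c n).
  unfold cis. apply C_ext; unfold Cmult, Cplus, RtoC, Re, Im; cbn [fst snd]; field.
- apply (key _ (- Ci * RtoC (/ 2))%C (Ci * RtoC (/ 2))%C); [assumption| |].
  + intros x. unfold twosided.
    rewrite <- !CSeries_scal, <- CSeries_plus
      by first [apply Hscal; first [apply (Hcis (fun n => freq n * x))|apply (Hcis (fun n => - (freq n * x)))]
               |apply (Hcis (fun n => freq n * x))|apply (Hcis (fun n => - (freq n * x)))].
    apply CSeries_ext. intros n. rewrite cis_opp, H2pi. fold (c n).
    unfold cis. apply C_ext; unfold Cmult, Cplus, Copp, Ci, RtoC, Re, Im; cbn [fst snd]; field.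
  + intros E. apply (f_equal snd) in E. simpl in E. lra.
Qed.
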